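(* Suppose that $P$ is a real polynomial of odd degree with negative leading coefficient. Then every probability measure $\mu$ on $\mathcal C(\mathbb T)$ that is invariant for the dynamic $$(\partial_t-\Delta)u=P(u)+\xi,\qquad u_0\in\mathcal C(\mathbb T),$$ is not Gaussian.
   Context: $\mathbb T=\mathbb R/\mathbb Z$ is the one-dimensional torus and $\mathcal C(\mathbb T)$ is the space of continuous real functions on $\mathbb T$ with the sup norm. The polynomial $P$ acts pointwise. The noise $\xi$ is a centred stationary Gaussian random distribution on $\mathbb R\times\mathbb T$ with covariance $\delta_0\otimes\mathrm{Cov}_\xi$ (white in time), i.e. $\mathbb E\langle\xi,f\rangle\langle\xi,g\rangle=\int_{\mathbb R}\langle \mathrm{Cov}_\xi*f(t,\cdot),g(t,\cdot)\rangle\,\mathrm dt$, where $\mathrm{Cov}_\xi\in\mathcal S'(\mathbb T)$ is such that convolution with $\mathrm{Cov}_\xi$ extends to a bounded operator $L^2(\mathbb T)\to L^2(\mathbb T)$ (e.g. $\mathrm{Cov}_\xi$ a Dirac delta, giving space-time white noise). Solutions are mild: $u_t=e^{t\Delta}u_0+\int_0^te^{(t-s)\Delta}P(u_s)\,\mathrm ds+\int_0^te^{(t-s)\Delta}\xi_s\,\mathrm ds$. For $P$ as in the claim, almost surely there is a unique solution $u\in\mathcal C([0,1],\mathcal C(\mathbb T))$ for every $u_0\in \mathcal C(\mathbb T)$. The measure $\mu$ is invariant if $u_0\sim\mu$, independent of $\xi$, implies $u_t\sim\mu$ for all $t\in[0,1]$. A measure on $\mathcal C(\mathbb T)$ is Gaussian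 if all continuous linear functionals have Gaussian law under it.
   Formalization: The odd degree of P is taken to be at least 3 (for degree 1 the invariant Ornstein–Uhlenbeck measure is Gaussian), and the noise covariance is assumed nonzero (without noise, the Dirac mass at a constant root of P is an invariant, degenerate Gaussian measure). *)

(* Defs.v *)
From HB Require Import structures.
From mathcomp Require Import all_boot all_order all_algebra.
From mathcomp Require Import all_classical all_reals all_analysis.

Set Implicit Arguments.
Unset Strict Implicit.
Unset Printing Implicit Defensive.
Import Order.TTheory GRing.Theory Num.Theory.
Import numFieldNormedType.Exports.
Local Open Scope classical_set_scope.
Local Open Scope ring_scope.

(* Functions on the torus R/Z are represented by 1-periodic functions on R, and
   integrals over the torus by integrals over the period [0, 1]. *)
Definition periodic {R : realType} (f : R -> R) := forall x, f (x + 1) = f x.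

Section continuous_functions_on_the_torus.
Variable R : realType.

Definition CT_pred : {pred R -> R} :=
  fun f => `[< continuous f /\ periodic f >].

Record CT := MkCT { CT_fun :> R -> R ; _ : CT_fun \in CT_pred }.

HB.instance Definition _ := [isSub for CT_fun].
HB.instance Definition _ := [Choice of CT by <:].

Lemma CT_submod_closed : submod_closed CT_pred.
Proof.
split; first by apply/asboolP; split => [x|x //]; exact: cvg_cst.
move=> a f g /asboolP[cf pf] /asboolP[cg pg]; apply/asboolP; split => x.
- by apply: cvgD; [apply: cvgZl_tmp; exact: cf|exact: cg].
- by rewrite !fctE pf pg.
Qed.

HB.instance Definition _ := GRing.isSubmodClosed.Build R (R -> R) CT_pred
  CT_submod_closed.
HB.instance Definition _ := [SubChoice_isSubLmodule of CT by <:].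

Lemma CT_continuous (f : CT) : continuous f.
Proof. by case: f => f /= /asboolP[]. Qed.

Lemma CT_periodic (f : CT) : periodic f.
Proof. by case: f => f /= /asboolP[]. Qed.

Lemma CT_unit_interval (f : CT) x :
  exists2 y, y \in `[0, 1]%R & f x = f y.
Proof.
have fN n y : f (y + n%:R) = f y.
  elim: n => [|n IH]; first by rewrite addr0.
  by rewrite -natr1 addrA CT_periodic.
have fZ (k : int) y : f (y + k%:~R) = f y.
  case: k => n; first exact: fN.
  by rewrite NegzE mulrNz -[RHS](fN n.+1) -[in LHS](fN n.+1) subrK fN.
exists (x - (Num.floor x)%:~R); last by rewrite -mulrNz fZ.
rewrite in_itv/= subr_ge0 Num.Theory.floor_le_tmp /= lerBlDl.
by have := Num.Theory.floorD1_gt x; rewrite intrD => /ltW.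
Qed.

Definition CT_norm (f : CT) : R := sup (range (fun x => `|f x|)).

Lemma CT_has_ubound (f : CT) : has_ubound (range (fun x => `|f x|)).
Proof.
have cf : {within `[0, 1], continuous (fun x => `|f x|)}.
  apply: continuous_subspaceT => x.
  by apply: cvg_norm; exact: CT_continuous.
have [c _ hc] := EVT_max ler01 cf.
exists `|f c| => _ [x _ <-]; have [y y01 ->] := CT_unit_interval f x.
exact: hc.
Qed.

Lemma CT_le_norm (f : CT) x : `|f x| <= CT_norm f.
Proof. by apply: ub_le_sup; [exact: CT_has_ubound|exists x]. Qed.

Lemma CT_norm_le (f : CT) a : (forall x, `|f x| <= a) -> CT_norm f <= a.
Proof.
by move=> fa; apply: ge_sup => [|_ [x _ <-]//]; exists `|f 0|, 0.
Qed.

Lemma CT_normD (f g : CT) : CT_norm (f + g) <= CT_norm f + CT_norm g.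
Proof.
by apply: CT_norm_le => x; rewrite (le_trans (ler_normD _ _))// lerD// CT_le_norm.
Qed.

Lemma CT_normZ a (f : CT) : CT_norm (a *: f) = `|a| * CT_norm f.
Proof.
have le b g : CT_norm (b *: g) <= `|b| * CT_norm g.
  by apply: CT_norm_le => x; rewrite normrM ler_wpM2l// CT_le_norm.
apply/eqP; rewrite eq_le le/=; have [->|a0] := eqVneq a 0.
  by rewrite normr0 mul0r (le_trans _ (CT_le_norm _ 0)).
rewrite mulrC -ler_pdivlMr ?normr_gt0// mulrC -normfV.
by apply: le_trans (le a^-1 _); rewrite scalerA mulVf// scale1r.
Qed.

Lemma CT_norm0_eq0 (f : CT) : CT_norm f = 0 -> f = 0.
Proof.
move=> f0; apply/val_inj/funext => x; apply/eqP.
by rewrite -normr_le0 -f0; exact: CT_le_norm.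
Qed.

HB.instance Definition _ :=
  Lmodule_isNormed.Build R CT CT_normD CT_normZ CT_norm0_eq0.

(* The Borel sigma-algebra of the sup norm. *)
HB.instance Definition _ := Measurable.copy CT (g_sigma_algebraType (@open CT)).

End continuous_functions_on_the_torus.

Section distributions.
Variable R : realType.
Local Notation leb := (@lebesgue_measure R).

Definition smoothT (f : R -> R) :=
  periodic f /\ forall n x, derivable (derive1n n f) x 1.

(* Sequential continuity is equivalent to continuity for linear functionals on
   the Frechet space of smooth functions, and likewise below on the strict
   inductive limit of Frechet spaces of test functions on R x R/Z. *)
Definition distributionT (L : (R -> R) -> R) :=
  (forall a f g, smoothT f -> smoothT g ->
     L (fun x => a * f x + g x) = a * L f + L g) /\
  (forall (F : nat -> R -> R) f, (forall k, smoothT (F k)) -> smoothT f ->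
     (forall n, {uniform, (fun k => derive1n n (F k)) @ \oo --> derive1n n f}) ->
     L (F k) @[k --> \oo] --> L f).

Definition convT (L : (R -> R) -> R) (f : R -> R) : R -> R :=
  fun x => L (fun y => f (x - y)).

Definition L2_bounded_convT (L : (R -> R) -> R) :=
  exists C : R, forall f, smoothT f ->
    \int[leb]_(x in `[0, 1]) (convT L f x) ^+ 2 <=
    C * \int[leb]_(x in `[0, 1]) (f x) ^+ 2.

(* Iterated partial derivatives of a function of (t, x); the letters true and
   false stand for the t- and the x-derivative. *)
Fixpoint partials (w : seq bool) (f : R * R -> R) : R * R -> R :=
  if w is b :: w' then
    fun z => 'D_(if b then (1, 0) else (0, 1)) (partials w' f) z
  else f.

Definition vanishes_beyond (M : R) (f : R * R -> R) :=
  forall t x, M < `|t| -> f (t, x) = 0.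

Definition test_function (f : R * R -> R) :=
  [/\ forall t, periodic (fun x => f (t, x)),
      exists M, vanishes_beyond M f &
      forall w z, differentiable (partials w f) z].

Definition distributionRT (L : (R * R -> R) -> R) :=
  (forall a f g, test_function f -> test_function g ->
     L (fun z => a * f z + g z) = a * L f + L g) /\
  (forall (F : nat -> R * R -> R) f,
     (forall k, test_function (F k)) -> test_function f ->
     (exists M, forall k, vanishes_beyond M (F k)) ->
     (forall w, {uniform, (fun k => partials w (F k)) @ \oo --> partials w f}) ->
     L (F k) @[k --> \oo] --> L f).

End distributions.

Section probability.
Context {R : realType} {d} {Omega : measurableType d}.
Variable Pr : probability Omega R.

(* Degenerate Gaussian laws (Dirac masses) are included. *)
Definition gaussian_rv (X : Omega -> R) :=
  measurable_fun setT X /\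
  exists m s : R, forall B, measurable B ->
    Pr (X @^-1` B) = if s == 0 then \d_m B else normal_prob m s B.

Definition has_law {d'} {T : measurableType d'} (X : Omega -> T)
    (mu : probability T R) :=
  measurable_fun setT X /\ forall B, measurable B -> Pr (X @^-1` B) = mu B.

End probability.

Section noise.
Context {R : realType} {d} {Omega : measurableType d}.
Variable Pr : probability Omega R.
Local Notation leb := (@lebesgue_measure R).

(* [xi f w] is the pairing <xi(w), f>.  Stationarity is a consequence of the
   translation invariance of the covariance. *)
Definition noise (Cov : (R -> R) -> R) (xi : (R * R -> R) -> Omega -> R) :=
  [/\ forall w, distributionRT (fun f => xi f w),
      forall f, test_function f -> gaussian_rv Pr (xi f),
      forall f, test_function f -> 'E_Pr[xi f]%E = 0%E &
      forall f g, test_function f -> test_function g ->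
        'E_Pr[(fun w => xi f w * xi g w)%R]%E =
        (\int[leb]_t \int[leb]_(x in `[0, 1])
           (convT Cov (fun y => f (t, y)) x * g (t, x)))%:E].

Definition noise_events (xi : (R * R -> R) -> Omega -> R) :
    set (set Omega) :=
  <<s [set E | exists f B,
         [/\ test_function f, measurable B & E = xi f @^-1` B]] >>.

Definition independent_of_noise (xi : (R * R -> R) -> Omega -> R) {d'}
    {T : measurableType d'} (X : Omega -> T) :=
  forall B E, measurable B -> noise_events xi E ->
    Pr (X @^-1` B `&` E) = (Pr (X @^-1` B) * Pr E)%E.

(* [X] is <xi, f> for [f] in L^2(R x R/Z): the extension of <xi, .> from test
   functions by continuity from L^2(R x R/Z) to L^2(Omega). *)
Definition wiener_integral (xi : (R * R -> R) -> Omega -> R)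
    (f : R * R -> R) (X : Omega -> R) :=
  exists F : nat -> R * R -> R,
    [/\ forall n, test_function (F n),
        (\int[leb]_t \int[leb]_(x in `[0%R, 1%R])
           ((F n (t, x) - f (t, x)) ^+ 2)%:E)%E @[n --> \oo] --> 0%E &
        (\int[Pr]_w ((xi (F n) w - X w) ^+ 2)%:E)%E @[n --> \oo] --> 0%E].

End noise.

Section mild_solutions.
Context {R : realType}.
Local Notation leb := (@lebesgue_measure R).

(* The kernel of exp(t Delta) on R/Z for t > 0, as a Fourier series. *)
Definition heat_kernel (t x : R) : R :=
  1 + 2 * limn (fun n => \sum_(1 <= k < n)
    expR (- (2 * pi * k%:R) ^+ 2 * t) * cos (2 * pi * k%:R * x)).

Definition heat (t : R) (f : R -> R) (x : R) : R :=
  if t <= 0 then f x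
  else \int[leb]_(y in `[0, 1]) (heat_kernel t (x - y) * f y).

(* Integrating this function against xi gives the value at x of
   int_0^t exp((t - s) Delta) xi_s ds. *)
Definition duhamel_kernel (t x : R) (z : R * R) : R :=
  if 0 < z.1 < t then heat_kernel (t - z.1) (x - z.2) else 0.

Context {d} {Omega : measurableType d}.
Variable Pr : probability Omega R.

Definition stochastic_convolution (xi : (R * R -> R) -> Omega -> R)
    (Z : R -> Omega -> CT R) :=
  [/\ forall t, 0 <= t <= 1 -> measurable_fun setT (Z t),
      forall t x, 0 <= t <= 1 ->
        wiener_integral Pr xi (duhamel_kernel t x) (fun w => Z t w x) &
      \forall w \ae Pr, {within `[0, 1], continuous (fun t => Z t w)}].

Definition mild_solution (P : {poly R}) (xi : (R * R -> R) -> Omega -> R)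
    (u0 : Omega -> CT R) (u : R -> Omega -> CT R) :=
  (forall t, 0 <= t <= 1 -> measurable_fun setT (u t)) /\
  exists2 Z, stochastic_convolution xi Z &
    \forall w \ae Pr,
      {within `[0, 1], continuous (fun t => u t w)} /\
      forall t x, 0 <= t <= 1 ->
        u t w x = heat t (u0 w) x
          + \int[leb]_(s in `[0, t]) heat (t - s) (fun y => P.[u s w y]) x
          + Z t w x.

Definition invariant_measure (P : {poly R}) (xi : (R * R -> R) -> Omega -> R)
    (mu : probability (CT R) R) :=
  forall u0 u, has_law Pr u0 mu -> independent_of_noise Pr xi u0 ->
    mild_solution P xi u0 u ->
    forall t, 0 <= t <= 1 -> has_law Pr (u t) mu.

Definition gaussian_measure (mu : probability (CT R) R) :=
  forall l : {linear CT R -> R}, continuous l -> gaussian_rv mu l.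

End mild_solutions.

(* Main.v *)
Require Import Defs.
From HB Require Import structures.
From mathcomp Require Import all_boot all_order all_algebra.
From mathcomp Require Import all_classical all_reals all_analysis.
From mathcomp Require Import measurable_realfun real_interval.
From mathcomp Require Import lebesgue_integral_fubini.
From mathcomp Require Import ring lra.
Import Order.TTheory GRing.Theory Num.Theory.
Import numFieldNormedType.Exports.
Local Open Scope classical_set_scope.
Local Open Scope ring_scope.

(* Suppose mu is Gaussian and fix a point x.  Write the solution at time t as
   [U = G + N], where [G] collects the heat flow of the initial datum and the
   stochastic convolution, and [N] is the time integral of the drift.  Then [G]
   has a Gaussian moment generating function (the two summands are independent
   Gaussians), [U] has the time-independent law of the evaluation at x under
   mu, [N / t] converges almost surely to [P X] with [X] the value at time 0,
   and its fourth moments are bounded.  Hence, with [v] the variance of [X],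
   [(E expR (l * U) - E expR (l * G)) / t] tends to
   [l * E (expR (l * X) * P X)], which by the Cameron-Martin formula is
   [l * E (P (X + l * v))] up to the factor [E expR (l * X)]; but it is also the
   limit of difference quotients of Gaussian moment generating functions, so
   [l * E (P (X + l * v))] is a quadratic polynomial in [l].  If [v != 0] this
   forces the degree of [P] to be at most 1.

   If instead [v = 0] at every x, then mu is a Dirac mass, the solution is
   constant in time, and the stochastic convolution at time 1 is deterministic.
   Being an L^2 limit of centred variables, it is uncorrelated with all of the
   noise, so the Duhamel kernel is orthogonal to every [Cov * g]; testing with
   [g] concentrated near time 1 gives [Cov f = 0] for all smooth [f]. *)

Set Implicit Arguments.
Unset Strict Implicit.
Unset Printing Implicit Defensive.

(** * Gaussian laws *)

(** Everything in the small-time argument happens at one point [x] and concerns real random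
    variables only. The obstacle is that the drift is not known to be Gaussian or independent of
    [G], and that the mean and variance of [G] at time [t] are never computed: they are only shown
    to be bounded. What survives the limit is the shape of the moment generating function, whose
    logarithm is [l * a + l ^+ 2 * b] with unknown [a] and [b]. Fourth moments of [N / t] enter
    because uniform integrability is obtained by squaring the difference quotient of the
    exponentials and separating drift and exponential by the arithmetic-geometric inequality. The
    stochastic convolution is given as an L^2 limit of [xi (F n)], so [G] carries only
    [gaussian_mgf], while the fixed law of [X] carries the stronger [gaussian_tilt]. The limit of
    [N / t] is a Korovkin argument: positivity of the heat kernel, mass one and the first Fourier
    mode. Positivity is not visible on the Fourier series and is proved through Fejer sums. In the
    degenerate case the test functions live near time 1 because there [heat (1 - t)] is close to the
    identity, so the pairing with the Duhamel kernel sees [Cov f] itself. *)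

Section density.
Context d (T : measurableType d) (R : realType).
Local Open Scope ereal_scope.
Variables (mu nu : {measure set T -> \bar R}) (p : T -> R).
Import HBNNSimple.
Hypotheses (mp : measurable_fun setT p) (p0 : forall x, (0 <= p x)%R).
Hypothesis nuE : forall A, measurable A -> nu A = \int[mu]_(x in A) (p x)%:E.

Let nn_integral_density (g : {nnsfun T >-> R}) :
  \int[nu]_x (g x)%:E = \int[mu]_x ((g x)%:E * (p x)%:E).
Proof.
have gE x : (g x)%:E = \sum_(k \in range g) k%:E * (\1_(g @^-1` [set k]) x)%:E.
  by rewrite fsumEFin//= fimfunE.
under [LHS]eq_integral do rewrite gE.
rewrite ge0_integral_fsum//; last 2 first.
- by move=> r; exact/measurable_EFinP/measurableT_comp.
- by move=> r x _; exact: nnfun_muleindic_ge0.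
have mI r : measurable_fun setT (fun x => (\1_(g @^-1` [set r]) x)%:E * (p x)%:E).
  by apply: emeasurable_funM => //; exact/measurable_EFinP.
transitivity (\sum_(k \in range g)
    \int[mu]_x (k%:E * ((\1_(g @^-1` [set k]) x)%:E * (p x)%:E))).
  apply: eq_fsbigr => i; rewrite inE => -[z _ <-{i}].
  rewrite ge0_integralZl//; last 2 first.
  - exact/measurable_EFinP.
  - by rewrite lee_fin.
  rewrite integral_indic// setIT ge0_integralZl//; last 2 first.
  - by move=> x _; rewrite mule_ge0// lee_fin.
  - by rewrite lee_fin.
  rewrite nuE; last exact: measurable_sfunP.
  congr (_ * _); rewrite [LHS]integral_mkcond; apply: eq_integral => x _.
  by rewrite /= patchE indicE; case: ifPn => _; rewrite ?mul1e ?mul0e.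
rewrite -ge0_integral_fsum//.
- apply: eq_integral => x _; rewrite [in RHS]gE ge0_mule_fsuml//.
    by apply: eq_fsbigr => k _; rewrite muleA.
  by move=> k; exact: nnfun_muleindic_ge0.
- by move=> r; exact: measurable_funeM.
- by move=> r x _; rewrite muleA mule_ge0 ?lee_fin//; exact: nnfun_muleindic_ge0.
Qed.

Lemma ge0_integral_density (g : T -> \bar R) :
  measurable_fun setT g -> (forall x, 0 <= g x) ->
  \int[nu]_x g x = \int[mu]_x (g x * (p x)%:E).
Proof.
move=> mg g0; pose h := nnsfun_approx measurableT mg.
have hcvg x : (h n x)%:E @[n --> \oo] --> g x by exact: cvg_nnsfun_approx.
have hnd x : {homo (fun n => (h n x)%:E) : a b / (a <= b)%N >-> a <= b}.
  by move=> a b ab; rewrite lee_fin; exact/lefP/nd_nnsfun_approx.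
have -> : \int[nu]_x g x = limn (fun n => \int[nu]_x (h n x)%:E).
  rewrite -monotone_convergence//.
  - by apply: eq_integral => x _; apply/esym/cvg_lim.
  - by move=> n; exact/measurable_EFinP.
  - by move=> n x _; rewrite lee_fin.
under eq_fun do rewrite nn_integral_density.
rewrite -monotone_convergence//.
- apply: eq_integral => x _; apply/cvg_lim => //.
  exact: cvgeZr.
- by move=> n; apply: emeasurable_funM => //; exact/measurable_EFinP.
- by move=> n x _; rewrite mule_ge0// lee_fin.
- by move=> x _ a b ab; apply: lee_wpmul2r; rewrite ?lee_fin//; exact: hnd.
Qed.

End density.

Section normal_law.
Variable R : realType.
Implicit Types (m s l c : R) (g : R -> R).

Lemma ge0_integral_normal m s (g : R -> \bar R) : measurable_fun setT g ->
    (forall x, 0 <= g x)%E ->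
  (\int[normal_prob m s]_x g x =
   \int[lebesgue_measure]_x (g x * (normal_pdf m s x)%:E))%E.
Proof.
move=> mg g0; apply: ge0_integral_density => //.
- exact: measurable_normal_pdf.
- by move=> x; exact: normal_pdf_ge0.
Qed.

Lemma ge0_integral_shift g c : continuous g -> (forall x, 0 <= g x) ->
  (\int[lebesgue_measure]_x (g x)%:E =
   \int[lebesgue_measure]_x (g (x + c))%:E)%E.
Proof.
move=> cg g0; have dE : (fun x : R => x + c)^`()%classic = cst 1.
  apply/funext => x; rewrite derive1E deriveD// derive_id derive_cst addr0//.
rewrite (@increasing_ge0_integration_by_substitutionT _ (fun x => x + c))//.
- by apply: eq_integral => x _; rewrite dE /= !fctE mulr1.
- by move=> x y xy; rewrite ltrD2r.
- by rewrite dE => x; exact: cvg_cst.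
- by rewrite dE; exact: is_cvg_cst.
- by rewrite dE; exact: is_cvg_cst.
- exact: cvg_addrr_Ny.
- exact: cvg_addrr.
Qed.

(** Completing the square: after translating the variable by [l * s ^+ 2], the factor [expR (l * x)]
    is absorbed by the Gaussian density and leaves the constant in front. Nonnegativity of [g] makes
    both integrals meaningful without integrability. *)
Lemma normal_tilt m s l g : s != 0 -> continuous g -> (forall x, 0 <= g x) ->
  (\int[normal_prob m s]_x (expR (l * x) * g x)%:E =
   (expR (l * m + l ^+ 2 * s ^+ 2 / 2))%:E *
   \int[normal_prob m s]_x (g (x + l * s ^+ 2)%R)%:E)%E.
Proof.
move=> s0 cg g0.
have cexp : continuous (fun x => expR (l * x)).
  by move=> x; apply: continuous_comp; [exact: mulrl_continuous|exact: continuous_expR].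
have cshift : continuous (fun x => g (x + l * s ^+ 2)).
  move=> x; apply: (@continuous_comp _ _ _ (fun x => x + l * s ^+ 2)).
    by apply: cvgD => //; exact: cvg_cst.
  exact: cg.
rewrite !ge0_integral_normal; last first.
- by move=> x; rewrite lee_fin mulr_ge0 ?expR_ge0.
- apply/measurable_EFinP; apply: continuous_measurable_fun => x.
  by apply: cvgM; [exact: cexp|exact: cg].
- by move=> x; rewrite lee_fin.
- apply/measurable_EFinP; exact: continuous_measurable_fun.
have cpdf := @continuous_normal_pdf R m s s0.
under eq_integral do rewrite -EFinM.
rewrite (@ge0_integral_shift _ (l * s ^+ 2)); last first.
- by move=> x; rewrite !mulr_ge0 ?expR_ge0 ?normal_pdf_ge0.
- move=> x; apply: cvgM; last exact: cpdf.
  by apply: cvgM; [exact: cexp|exact: cg].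
rewrite -ge0_integralZl//; last 2 first.
- under eq_fun do rewrite -EFinM.
  apply/measurable_EFinP; apply: continuous_measurable_fun => x.
  by apply: cvgM; [exact: cshift|exact: cpdf].
- by move=> x _; rewrite -EFinM lee_fin mulr_ge0 ?normal_pdf_ge0.
apply: eq_integral => x _; rewrite -!EFinM; congr EFin.
rewrite /normal_pdf (negbTE s0) /normal_fun.
set e1 := expR (l * _); set e2 := expR (- _ / _).
set e3 := expR (l * _ + _); set e4 := expR (- _ / _).
have E : e1 * e2 = e3 * e4.
  by rewrite -!expRD; congr expR; rewrite -mulr_natr; field; exact: s0.
transitivity (g (x + l * s ^+ 2) * normal_peak s * (e1 * e2)); first by ring.
by rewrite E; ring.
Qed.

End normal_law.

Section gaussian_tilt.
Context {R : realType} {d} {Omega : measurableType d}.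
Variable Pr : probability Omega R.
Implicit Types X : Omega -> R.

(* The Cameron-Martin formula; with [g = 1] it gives the moment generating
   function [expR (l * m + l ^+ 2 * v / 2)]. *)
Definition gaussian_tilt X (m v : R) :=
  [/\ measurable_fun setT X, 0 <= v,
     (v = 0 -> Pr (X @^-1` [set m]) = 1%E) &
     forall l (g : R -> R), continuous g -> (forall x, 0 <= g x) ->
     (\int[Pr]_w (expR (l * X w) * g (X w))%:E =
      (expR (l * m + l ^+ 2 * v / 2))%:E * \int[Pr]_w (g (X w + l * v)%R)%:E)%E].

(** The weaker notion meant for sums and limits: it passes to almost sure limits by convergence of
    expectations, without identifying a law. *)
Definition gaussian_mgf X (m v : R) :=
  measurable_fun setT X /\ forall l,
    (\int[Pr]_w (expR (l * X w))%:E = (expR (l * m + l ^+ 2 * v / 2))%:E)%E.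

Lemma integral_cstP (r : R) : (\int[Pr]_w r%:E = r%:E)%E.
Proof.
have := integral_cst Pr measurableT r%:E.
rewrite /cst => ->; rewrite -[RHS]mule1; congr (_ * _)%E.
exact: probability_setT.
Qed.

Lemma gaussian_tilt_mgf X m v : gaussian_tilt X m v -> gaussian_mgf X m v.
Proof.
move=> [mX v0 _ tX]; split=> // l; have := tX l (cst 1).
under eq_integral do rewrite mulr1.
move=> ->//; last by move=> x; exact: cvg_cst.
by rewrite [X in (_ * X)%E](_ : _ = 1%E) ?mule1// integral_cstP.
Qed.

(** The map [phi] serves two uses: [phi = id] when [nu] is the law of [X] on the line, and [phi] a
    functional on [T] when [X] has the law of [phi] under [nu], without naming the image measure. *)
Lemma ge0_integral_law d' (T : measurableType d') (nu : {measure set T -> \bar R})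
    (phi : T -> R) X (h : R -> \bar R) :
  measurable_fun setT X -> measurable_fun setT phi ->
  (forall B, measurable B -> Pr (X @^-1` B) = nu (phi @^-1` B)) ->
  measurable_fun setT h -> (forall x, 0 <= h x)%E ->
  (\int[Pr]_w h (X w) = \int[nu]_x h (phi x))%E.
Proof.
move=> mX mphi XE mh h0.
rewrite -[LHS](@ge0_integral_pushforward _ _ _ _ _ _ mX Pr setT h)//.
rewrite -[RHS](@ge0_integral_pushforward _ _ _ _ _ _ mphi nu setT h)//.
by apply: eq_measure_integral => B mB _; exact: XE.
Qed.

Lemma gaussian_rv_tilt X : gaussian_rv Pr X -> exists m v, gaussian_tilt X m v.
Proof.
move=> [mX [m [s XE]]]; exists m, (s ^+ 2); split => //; first exact: sqr_ge0.
  move/eqP; rewrite sqrf_eq0 => s0.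
  by rewrite XE// s0 diracE mem_set.
move=> l g cg g0.
have cexp : continuous (fun x => expR (l * x)).
  by move=> x; apply: continuous_comp; [exact: mulrl_continuous|exact: continuous_expR].
have mh : measurable_fun setT (fun x => (expR (l * x) * g x)%:E).
  apply/measurable_EFinP; apply: continuous_measurable_fun => x.
  by apply: cvgM; [exact: cexp|exact: cg].
have mg : measurable_fun setT (fun x : R => (g (x + l * s ^+ 2))%:E).
  apply/measurable_EFinP; apply: continuous_measurable_fun => x.
  apply: (@continuous_comp _ _ _ (fun x => x + l * s ^+ 2)); last exact: cg.
  by apply: cvgD => //; exact: cvg_cst.
have h0 x : (0 <= (expR (l * x) * g x)%:E)%E by rewrite lee_fin mulr_ge0 ?expR_ge0.
have gs0 x : (0 <= (g (x + l * s ^+ 2))%:E)%E by rewrite lee_fin.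
have [s0|s0] := eqVneq s 0.
  have XE' B : measurable B -> Pr (X @^-1` B) = \d_m B.
    by move=> mB; rewrite XE// s0 eqxx.
  rewrite (@ge0_integral_law _ _ \d_m id X _ mX _ XE' mh h0)//.
  rewrite (@ge0_integral_law _ _ \d_m id X _ mX _ XE' mg gs0)//.
  rewrite !integral_dirac// !diracT !mul1e s0 expr0n/= !(mulr0, mul0r, addr0).
  by rewrite EFinM.
have XE' B : measurable B -> Pr (X @^-1` B) = normal_prob m s B.
  by move=> mB; rewrite XE// (negbTE s0).
rewrite (@ge0_integral_law _ _ (normal_prob m s) id X _ mX _ XE' mh h0)//.
rewrite (@ge0_integral_law _ _ (normal_prob m s) id X _ mX _ XE' mg gs0)//.
exact: normal_tilt.
Qed.

End gaussian_tilt.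

(** * Convergence of expectations under second moment bounds; bounds on Gaussian parameters *)

Section square_bounded_convergence.
Context {R : realType} {d} {Omega : measurableType d}.
Variable Pr : probability Omega R.

Lemma integrable_square (Y : Omega -> R) (C : R) : measurable_fun setT Y ->
  (\int[Pr]_w (Y w ^+ 2)%:E <= C%:E)%E ->
  Pr.-integrable setT (EFin \o Y).
Proof.
move=> mY YC; apply/integrableP; split; first exact/measurable_EFinP.
apply: (@le_lt_trans _ _ (\int[Pr]_w (1 + Y w ^+ 2)%:E)%E).
  apply: ge0_le_integral => //.
  - by apply: measurableT_comp => //; exact/measurable_EFinP.
  - by apply/measurable_EFinP; apply: measurable_funD => //; exact: measurable_funX.
  - move=> w _ /=; rewrite lee_fin.
    have := sqr_ge0 (`|Y w| - 1); rewrite sqrrB real_normK ?num_real// expr1n mulr1.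
    have := normr_ge0 (Y w); rewrite mulr2n; lra.
under eq_integral do rewrite EFinD.
rewrite ge0_integralD//; last 2 first.
- by move=> w _; rewrite lee_fin sqr_ge0.
- by apply/measurable_EFinP; exact: measurable_funX.
by rewrite integral_cstP lte_add_pinfty ?ltry//; apply: le_lt_trans YC _; exact: ltry.
Qed.

Lemma fatou_ae_le (f_ : nat -> Omega -> R) (f : Omega -> R) (C : \bar R) :
  (forall n, measurable_fun setT (f_ n)) -> measurable_fun setT f ->
  (forall n w, 0 <= f_ n w) -> (forall w, 0 <= f w) ->
  (\forall w \ae Pr, f_ n w @[n --> \oo] --> f w) ->
  (forall n, \int[Pr]_w (f_ n w)%:E <= C)%E ->
  (\int[Pr]_w (f w)%:E <= C)%E.
Proof.
move=> mf_ mf f_0 f0 ff fC.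
have mf_' n : measurable_fun setT (fun w => (f_ n w)%:E) by exact/measurable_EFinP.
have -> : (\int[Pr]_w (f w)%:E = \int[Pr]_w limn_einf (fun n => (f_ n w)%:E))%E.
  apply: ae_eq_integral => //.
  - exact/measurable_EFinP.
  - rewrite /limn_einf; apply: measurableT_comp => //.
    apply: measurable_fun_limn_esup => n.
    by apply: measurableT_comp.
  - apply: filterS ff => w fw _; apply/esym.
    have : (f_ n w)%:E @[n --> \oo] --> (f w)%:E.
      by apply: cvg_EFin; [exact: nearW|].
    by move/cvg_limn_einf_sup => [].
apply: le_trans (fatou _ _ _ _) _ => //.
  by move=> n w _; rewrite lee_fin.
rewrite limn_einf_lim; apply: lime_le; first exact: is_cvg_einfs.
near=> n; apply: le_trans (fC n); apply: ereal_inf_lbound.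
by exists n => /=.
Unshelve. all: by end_near.
Qed.

(** Bounded second moments give uniform integrability. Fatou passes the bound [C] to [Y]; then the
    distance [D] satisfies [D <= min D M + D ^+ 2 / M], where the truncated part goes to 0 by
    dominated convergence and the other part has integral at most [4 * C / M]. *)
Lemma cvg_square_bounded (Y_ : nat -> Omega -> R) (Y : Omega -> R) (C : R) :
  (forall n, measurable_fun setT (Y_ n)) -> measurable_fun setT Y ->
  (forall n, \int[Pr]_w (Y_ n w ^+ 2)%:E <= C%:E)%E ->
  (\forall w \ae Pr, Y_ n w @[n --> \oo] --> Y w) ->
  Pr.-integrable setT (EFin \o Y) /\
  (\int[Pr]_w (Y_ n w)%:E)%E @[n --> \oo] --> (\int[Pr]_w (Y w)%:E)%E.
Proof.
move=> mY_ mY YC Ycvg.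
have C0 : 0 <= C.
  rewrite -lee_fin; apply: le_trans (YC 0); apply: integral_ge0 => w _.
  by rewrite lee_fin sqr_ge0.
have mY2_ n : measurable_fun setT (fun w => (Y_ n w ^+ 2)%:E).
  by apply/measurable_EFinP; exact: measurable_funX.
have mY2 : measurable_fun setT (fun w => (Y w ^+ 2)%:E).
  by apply/measurable_EFinP; exact: measurable_funX.
have YC' : (\int[Pr]_w (Y w ^+ 2)%:E <= C%:E)%E.
  apply: (@fatou_ae_le (fun n w => Y_ n w ^+ 2)) => //.
  - by move=> n; exact: measurable_funX.
  - exact: measurable_funX.
  - by move=> n w; exact: sqr_ge0.
  - by move=> w; exact: sqr_ge0.
  - by apply: filterS Ycvg => w Yw; rewrite expr2; under eq_fun do rewrite expr2; exact: cvgM.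
have iY := integrable_square mY YC'.
have iY_ n := integrable_square (mY_ n) (YC n).
split => //.
pose D n w : R := `|Y_ n w - Y w|.
have mD n : measurable_fun setT (D n).
  by apply: measurableT_comp => //; exact: measurable_funB.
have D0 n w : 0 <= D n w by exact: normr_ge0.
have D2 n : (\int[Pr]_w (D n w ^+ 2)%:E <= (4 * C)%:E)%E.
  apply: (@le_trans _ _ (\int[Pr]_w (2%:E * (Y_ n w ^+ 2)%:E + 2%:E * (Y w ^+ 2)%:E))%E).
    apply: ge0_le_integral => //.
    - by move=> w _; rewrite lee_fin sqr_ge0.
    - by apply/measurable_EFinP; exact: measurable_funX.
    - by apply: emeasurable_funD; exact: measurable_funeM.
    - move=> w _; rewrite -!EFinM -EFinD lee_fin /D real_normK ?num_real//.
      by have := sqr_ge0 (Y_ n w + Y w); nra.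
  rewrite ge0_integralD//; last 4 first.
  - by move=> w _; rewrite -EFinM lee_fin mulr_ge0// sqr_ge0.
  - exact: measurable_funeM.
  - by move=> w _; rewrite -EFinM lee_fin mulr_ge0// sqr_ge0.
  - exact: measurable_funeM.
  rewrite !ge0_integralZl//; try by move=> w _; rewrite lee_fin sqr_ge0.
  have -> : ((4 * C)%:E = 2%:E * C%:E + 2%:E * C%:E)%E.
    by rewrite -!EFinM -EFinD; congr EFin; ring.
  by apply: leeD; apply: lee_wpmul2l.
have Dcvg e : 0 < e -> \forall n \near \oo, (\int[Pr]_w (D n w)%:E <= e%:E)%E.
  (* This level makes [4 * C / M] at most [e / 2]; the added 1 keeps [M] positive when [C = 0]. *)
  move=> e0; pose M := (4 * C + 1) / (e / 2).
  have M0 : 0 < M by rewrite divr_gt0//; lra.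
  have mmin n : measurable_fun setT (fun w => (Num.min (D n w) M)%:E).
    by apply/measurable_EFinP; exact: measurable_minr.
  have /(_ _ _ _ _) := @dominated_convergence _ _ _ Pr setT measurableT
    (fun n w => (Num.min (D n w) M)%:E) (cst 0%E) (cst M%:E) mmin.
  case => //.
  - apply: filterS Ycvg => w Yw _; apply: cvg_EFin; first exact: nearW.
    apply: (@squeeze_cvgr _ _ _ _ (cst 0) (D ^~ w)).
    + by apply: nearW => n /=; rewrite le_min D0 ltW//= ge_min lexx.
    + exact: cvg_cst.
    + rewrite -(@normr0 _ R) -(subrr (Y w)); apply: cvg_norm.
      by apply: cvgB => //; exact: cvg_cst.
  - exact: finite_measure_integrable_cst.
  - apply: aeW => w n _ /=; rewrite lee_fin ger0_norm ?ge_min ?lexx ?orbT//.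
    by rewrite le_min D0 ltW.
  move=> _ _; rewrite integral0 => hcvg.
  have : \forall n \near \oo, (\int[Pr]_w (Num.min (D n w) M)%:E < (e / 2)%:E)%E.
    have := hcvg [set x | (x < (e / 2)%:E)%E]; apply.
    apply: open_nbhs_nbhs; split; first exact: open_ereal_lt_ereal.
    by rewrite /= lte_fin divr_gt0.
  apply: filterS => n hn.
  have -> : (e%:E = (e / 2)%:E + (e / 2)%:E)%E.
    by rewrite -EFinD; congr EFin; field.
  apply: (@le_trans _ _ (\int[Pr]_w ((Num.min (D n w) M)%:E + M^-1%:E * (D n w ^+ 2)%:E))%E).
    apply: ge0_le_integral => //.
    - by move=> w _; rewrite lee_fin.
    - exact/measurable_EFinP.
    - apply: emeasurable_funD => //; apply: measurable_funeM.
      by apply/measurable_EFinP; exact: measurable_funX.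
    - move=> w _; rewrite -EFinM -EFinD lee_fin.
      have [DM|DM] := leP (D n w) M.
        by rewrite lerDl mulr_ge0 ?sqr_ge0// invr_ge0 ltW.
      rewrite -lerBlDl mulrC ler_pdivlMr//.
      by have := D0 n w; nra.
  rewrite ge0_integralD//; last 3 first.
  - by move=> w _; rewrite lee_fin le_min D0 ltW.
  - by move=> w _; rewrite -EFinM lee_fin mulr_ge0 ?sqr_ge0// invr_ge0 ltW.
  - apply: measurable_funeM.
    by apply/measurable_EFinP; exact: measurable_funX.
  apply: leeD; first exact: ltW.
  rewrite ge0_integralZl//; last 3 first.
  - by apply/measurable_EFinP; exact: measurable_funX.
  - by move=> w _; rewrite lee_fin sqr_ge0.
  - by rewrite lee_fin invr_ge0 ltW.
  apply: (@le_trans _ _ (M^-1%:E * (4 * C)%:E)%E).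
    by apply: lee_wpmul2l => //; rewrite lee_fin invr_ge0 ltW.
  rewrite -EFinM lee_fin /M invf_div mulrAC ler_pdivrMr; last lra.
  by nra.
have fY n : (\int[Pr]_w (Y_ n w)%:E)%E \is a fin_num.
  by apply: integrable_fin_num => //; exact: iY_.
have fY' : (\int[Pr]_w (Y w)%:E)%E \is a fin_num by apply: integrable_fin_num.
rewrite -(fineK fY'); under eq_fun do rewrite -(fineK (fY _)).
apply: cvg_EFin; first exact: nearW.
apply/cvgrPdist_le => e e0; have := Dcvg e e0; apply: filterS => n hn.
rewrite -lee_fin distrC; apply: le_trans hn.
have -> : (`|fine (\int[Pr]_w (Y_ n w)%:E) - fine (\int[Pr]_w (Y w)%:E)|%:E =
   `|\int[Pr]_w (Y_ n w)%:E - \int[Pr]_w (Y w)%:E|)%E.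
  by rewrite -[in RHS](fineK (fY n)) -[in RHS](fineK fY').
rewrite -integralB_EFin//.
apply: le_trans (le_abse_integral _ _ _) _ => //.
by apply: emeasurable_funB; exact/measurable_EFinP.
Qed.

(** A tail bound at a single level controls both parameters. The integral of [expR (l * X)] is split
    at |X| = M; the tail part is estimated by the generating function at [2 * l] and the tail
    probability. The threshold [expR (- 9)] makes this work whenever [l ^+ 2 * v <= 9]. *)
Lemma mgf_tight (X : Omega -> R) (m v M : R) :
  gaussian_mgf Pr X m v -> 0 <= v -> 0 <= M ->
  (Pr [set w | M < `|X w|]%R <= (expR (- 9) / 2)%:E)%E ->
  v <= 2 * M ^+ 2 /\ `|m| <= 3 * M + 2.
Proof.
move=> [mX Xmgf] v0 M0 PM.
have mB : measurable [set w | M < `|X w|]%R.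
  have -> : [set w | M < `|X w|]%R = (fun w => `|X w|) @^-1` `]M, +oo[.
    by apply/seteqP; split => w /=; rewrite in_itv/= andbT.
  rewrite -[X in measurable X]setTI; apply: (measurableT_comp (f := fun x : R => `|x|)) => //.
have e4 : 4 <= expR 2 :> R.
  have -> : 2 = 1 + 1 :> R by ring.
  by rewrite expRD; have := expR_ge1Dx (1 : R); nra.
(* The split gives [a0 <= K + a0 / 2 + a0 / 4] with [K] the exponential of |l| * M, hence
   [a0 <= 4 * K <= expR 2 * K]: this is the origin of the summand 2. *)
have key l : l ^+ 2 * v <= 9 -> l * m + l ^+ 2 * v / 2 <= `|l| * M + 2.
  move=> lv; set a0 := expR (l * m + l ^+ 2 * v / 2).
  have a0_gt0 : 0 < a0 by exact: expR_gt0.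
  (* On the tail, [W <= a / 2 * W ^+ 2 + a^-1 / 2] for [W = expR (l * X)]. The weight [a] is [a0]
     divided by the generating function at [2 * l], so that the first term contributes exactly
     [a0 / 2]. *)
  pose a := expR (- (l * m) - 3 / 2 * (l ^+ 2 * v)).
  have a_gt0 : 0 < a by exact: expR_gt0.
  have : (a0%:E <= (expR (`|l| * M))%:E + ((a / 2)%:E * (expR (2 * l * m + (2 * l) ^+ 2 * v / 2))%:E
       + (a^-1 / 2)%:E * Pr [set w | M < `|X w|]%R))%E.
    rewrite /a0 -(Xmgf l) -(Xmgf (2 * l)) -(integral_cstP Pr (expR (`|l| * M))).
    rewrite -[[set w | _]]setIT -(@integral_indic _ _ _ Pr setT)//.
    have mE : measurable_fun setT (fun w => (expR (2 * l * X w))%:E).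
      apply/measurable_EFinP; apply: measurableT_comp => //.
      exact: measurable_funM.
    have mI : measurable_fun setT (fun w => (\1_[set w | M < `|X w|] w : R)%:E).
      exact/measurable_EFinP.
    have c1 : 0 <= a / 2 by rewrite divr_ge0// ltW.
    have c2 : 0 <= a^-1 / 2 by rewrite divr_ge0// invr_ge0 ltW.
    rewrite -(ge0_integralZl _ _ mE)//.
    rewrite -(ge0_integralZl _ _ mI)//.
    rewrite -ge0_integralD//;
      try exact: measurable_funeM;
      try (by move=> w _; rewrite -EFinM lee_fin mulr_ge0 ?expR_ge0).
    rewrite -ge0_integralD//;
      try (by apply: emeasurable_funD; exact: measurable_funeM);
      try (by move=> w _; rewrite -!EFinM -EFinD lee_fin; apply: addr_ge0; apply: mulr_ge0; rewrite ?expR_ge0).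
    apply: ge0_le_integral.
    - by [].
    - by move=> w _; rewrite lee_fin expR_ge0.
    - apply/measurable_EFinP; apply: measurableT_comp => //; exact: measurable_funM.
    - by apply: emeasurable_funD => //; apply: emeasurable_funD; exact: measurable_funeM.
    - move=> w _; rewrite -!EFinM -!EFinD lee_fin indicE.
      have [XM|XM] := leP `|X w| M.
        rewrite (_ : (w \in _) = false) ?mulr0 ?addr0; last first.
          by apply/negbTE; rewrite notin_setE /= ltNge XM.
        apply: ler_wpDr; first by rewrite mulr_ge0 ?expR_ge0.
        rewrite ler_expR (le_trans (ler_norm _))// normrM; exact: ler_wpM2l.
      rewrite mem_set//= mulr1.
      have -> : 2 * l * X w = l * X w + l * X w by ring.
      rewrite expRD; set W := expR (l * X w).
      apply: ler_wpDl; first exact: expR_ge0.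
      have : 0 <= a^-1 * (a * W - 1) ^+ 2 by rewrite mulr_ge0 ?sqr_ge0 ?invr_ge0 ?ltW.
      have -> : a^-1 * (a * W - 1) ^+ 2 = a * (W * W) - 2 * W + a^-1.
        by field; rewrite gt_eqF.
      by lra.
  set K := expR (`|l| * M); move=> h0.
  have h1 : (a0%:E <= (K + (a / 2 * expR (2 * l * m + (2 * l) ^+ 2 * v / 2)
       + a^-1 / 2 * (expR (- 9) / 2)))%:E)%E.
    apply: le_trans h0 _; rewrite !EFinD !EFinM leeD2l// leeD2l//.
    by apply: lee_wpmul2l => //; rewrite lee_fin divr_ge0// invr_ge0 ltW.
  move: h1; rewrite lee_fin.
  have -> : a / 2 * expR (2 * l * m + (2 * l) ^+ 2 * v / 2) = a0 / 2.
    by rewrite mulrAC /a -expRD /a0; congr (expR _ / _); field.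
  have h2 : a^-1 / 2 * (expR (- 9) / 2) <= a0 / 4.
    have : a^-1 * expR (- 9) <= a0.
      rewrite /a -expRN -expRD ler_expR; lra.
    by lra.
  move=> h3; have {h2}h3 : a0 <= 4 * K by lra.
  have : a0 <= expR (`|l| * M + 2).
    by rewrite expRD; apply: le_trans h3 _; rewrite mulrC ler_pM2l ?expR_gt0.
  by rewrite ler_expR.
have vM : v <= 2 * M ^+ 2.
  have [->|v_neq0] := eqVneq v 0; first by rewrite mulr_ge0 ?sqr_ge0.
  have sv : 0 < Num.sqrt v by rewrite sqrtr_gt0 lt_neqAle eq_sym v_neq0.
  have s2 : Num.sqrt v ^+ 2 = v by rewrite sqr_sqrtr.
  (* The largest admissible value, [l ^+ 2 * v = 9]. Adding [key] at [l] and [- l] cancels the mean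
     and leaves [9 <= 2 * (l * M) + 4]. *)
  pose l := 3 / Num.sqrt v.
  have lv : l ^+ 2 * v = 9 by rewrite -s2 /l; field; rewrite gt_eqF.
  have l0 : 0 < l by rewrite divr_gt0.
  have k1 := key l; have k2 := key (- l); rewrite sqrrN normrN in k2.
  rewrite lv lexx gtr0_norm// in k1 k2; have {k1}k1 := k1 isT; have {k2}k2 := k2 isT.
  have : 5 <= 2 * (l * M) by lra.
  rewrite /l mulrAC mulrA ler_pdivlMr// => h; rewrite -s2.
  by nra.
split => //.
have M1 : 0 < M + 1 by lra.
(* Small enough for [key] by the variance bound just obtained; dividing [l * m <= l * M + 2] by [l]
   gives [3 * M + 2]. The added 1 covers [M = 0]. *)
pose l := 1 / (M + 1); have l0 : 0 < l by rewrite divr_gt0.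
have lM : l * (M + 1) = 1 by rewrite /l divfK// gt_eqF.
have lv : l ^+ 2 * v <= 9.
  apply: (@le_trans _ _ (l ^+ 2 * (2 * M ^+ 2))).
    by rewrite ler_wpM2l// sqr_ge0.
  have : (l * M) <= 1 by rewrite -lM ler_pM2l// lerDl.
  have : 0 <= l * M by rewrite mulr_ge0// ltW.
  by nra.
have k1 := key l lv; have k2 := key (- l); rewrite sqrrN normrN in k2.
have {k2}k2 := k2 lv.
have lv0 : 0 <= l ^+ 2 * v by rewrite mulr_ge0// sqr_ge0.
rewrite gtr0_norm// in k1 k2.
rewrite ler_norml; apply/andP; split; rewrite -(ler_pM2l l0); nra.
Qed.

End square_bounded_convergence.

(** * Polynomials of Gaussian variables *)

Section polynomials_of_gaussian_variables.
Context {R : realType} {d} {Omega : measurableType d}.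
Variable Pr : probability Omega R.

(** Termwise from |x|^i <= i! * exp |x|. The majorant is a sum of two exponentials so that its
    expectation can be read off the moment generating function at 1 and -1. *)
Lemma poly_le_cosh (Q : {poly R}) :
  exists2 C, 0 <= C & forall x, `|Q.[x]| <= C * (expR x + expR (- x)).
Proof.
have expr_le i (x : R) : `|x| ^+ i <= i`!%:R * (expR x + expR (- x)).
  apply: (@le_trans _ _ (i`!%:R * expR `|x|)).
    have i0 : 0 < i`!%:R :> R by rewrite ltr0n fact_gt0.
    rewrite -ler_pdivrMl// mulrC; case: i i0 => [|i] i0.
      by rewrite expr0 fact0 divr1 -[leLHS](@expR0 R) ler_expR.
    by apply: le_trans (expR_ge1Dxn i (normr_ge0 x)); rewrite lerDr.
  rewrite ler_wpM2l//; have [x0|x0] := ler0P x.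
    by rewrite lerDr expR_ge0.
  by rewrite lerDl expR_ge0.
exists (\sum_(i < size Q) `|Q`_i| * i`!%:R).
  by apply: sumr_ge0 => i _; rewrite mulr_ge0.
move=> x; rewrite horner_coef; apply: le_trans (ler_norm_sum _ _ _) _.
rewrite mulr_suml; apply: ler_sum => i _.
by rewrite normrM normrX -mulrA ler_wpM2l.
Qed.

Lemma gaussian_mgf_integrable (X : Omega -> R) m v l : gaussian_mgf Pr X m v ->
  Pr.-integrable setT (EFin \o (fun w => expR (l * X w))).
Proof.
move=> [mX Xmgf]; apply/integrableP; split.
  apply/measurable_EFinP; apply: measurableT_comp => //.
  exact: measurable_funM.
under eq_integral do rewrite /= ger0_norm ?expR_ge0//.
by rewrite Xmgf ltry.
Qed.

Lemma measurable_horner_comp (Q : {poly R}) (X : Omega -> R) :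
  measurable_fun setT X -> measurable_fun setT (fun w => Q.[X w]).
Proof.
move=> mX; apply: (@measurableT_comp _ _ _ _ _ _ (horner Q)) => //.
apply: continuous_measurable_fun; exact: continuous_horner.
Qed.

(** The constant comes before the variable: it depends on [Q] alone, so bounded means and variances
    bound the moments of a whole family at once. *)
Lemma gaussian_mgf_poly_le (Q : {poly R}) : exists C, forall (X : Omega -> R) m v,
  gaussian_mgf Pr X m v ->
  (\int[Pr]_w (`|Q.[X w]|)%:E <= (C * (expR (m + v / 2) + expR (- m + v / 2)))%:E)%E.
Proof.
have [C C0 QC] := poly_le_cosh Q; exists C => X m v XG.
have [mX Xmgf] := XG.
have e1 := Xmgf 1; have e2 := Xmgf (-1).
have i1 := gaussian_mgf_integrable 1 XG; have i2 := gaussian_mgf_integrable (-1) XG.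
apply: (@le_trans _ _ (\int[Pr]_w (C%:E * ((expR (1 * X w))%:E + (expR (-1 * X w))%:E)))%E).
  apply: ge0_le_integral => //.
  - apply/measurable_EFinP; apply: measurableT_comp => //.
    exact: measurable_horner_comp.
  - apply: measurable_funeM; apply: emeasurable_funD.
      by have /integrableP[] := i1.
    by have /integrableP[] := i2.
  - by move=> w _; rewrite -EFinD -EFinM lee_fin mul1r mulN1r; exact: QC.
rewrite integralZl//; last exact: integrableD.
rewrite integralD// e1 e2 -EFinD -EFinM lee_fin.
by rewrite !mul1r !mulN1r !expr1n sqrrN expr1n !mul1r.
Qed.

(** [gaussian_tilt] speaks of nonnegative functions only. The signed polynomial is written as
    [g - h], with [h] the exponential majorant and [g = Q + h] nonnegative, and the formula is
    applied to both. *)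
Lemma gaussian_tilt_poly (X : Omega -> R) m v l (Q : {poly R}) :
  gaussian_tilt Pr X m v ->
  [/\ Pr.-integrable setT (EFin \o (fun w => expR (l * X w) * Q.[X w])),
      (forall c, Pr.-integrable setT (EFin \o (fun w => Q.[X w + c]))) &
      \int[Pr]_w (expR (l * X w) * Q.[X w]) =
      expR (l * m + l ^+ 2 * v / 2) * \int[Pr]_w Q.[X w + l * v]].
Proof.
move=> tX; have XG := gaussian_tilt_mgf tX; have [mX v0 _ tiltX] := tX.
have [C C0 QC] := poly_le_cosh Q.
pose h x := C * (expR x + expR (- x)); pose g x := Q.[x] + h x.
have h0 x : 0 <= h x by rewrite mulr_ge0// addr_ge0 ?expR_ge0.
have g0 x : 0 <= g x by rewrite /g -lerBlDr sub0r; have := QC x; rewrite ler_norml => /andP[].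
have ch : continuous h.
  move=> x; apply: cvgM; first exact: cvg_cst.
  apply: cvgD; first exact: continuous_expR.
  by apply: (@continuous_comp _ _ _ -%R expR); [exact: opp_continuous|exact: continuous_expR].
have cQ : continuous (horner Q) by exact: continuous_horner.
have cg : continuous g by move=> x; apply: cvgD; [exact: cQ|exact: ch].
have mXc c : measurable_fun setT (fun w => X w + c) by exact: measurable_funD.
have mc (f : R -> R) c : continuous f -> measurable_fun setT (fun w => f (X w + c) : R).
  move=> cf; apply: (@measurableT_comp _ _ _ _ _ _ f) => //.
  exact: continuous_measurable_fun.
have mc0 (f : R -> R) : continuous f -> measurable_fun setT (fun w => f (X w) : R).
  by move=> cf; apply: (@measurableT_comp _ _ _ _ _ _ f) => //; exact: continuous_measurable_fun.
have ih c : Pr.-integrable setT (EFin \o (fun w => h (X w + c))).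
  apply: (@eq_integrable _ _ _ _ _ measurableT
     (fun w => (C * expR c)%:E * (expR (1 * X w))%:E + (C * expR (- c))%:E * (expR (-1 * X w))%:E)%E).
    move=> w _; rewrite -!EFinM -EFinD /=; congr EFin.
    by rewrite /h opprD !expRD mul1r mulN1r; ring.
  apply: integrableD => //; apply: integrableZl => //;
    exact: (gaussian_mgf_integrable _ XG).
have iQ c : Pr.-integrable setT (EFin \o (fun w => Q.[X w + c])).
  apply: le_integrable (ih c) => //; first by apply/measurable_EFinP; exact: mc.
  by move=> w _; rewrite /= lee_fin (ger0_norm (h0 _)); exact: QC.
have ig c : Pr.-integrable setT (EFin \o (fun w => g (X w + c))).
  exact: (integrableD measurableT (iQ c) (ih c)).
have tilt_int (f : R -> R) : continuous f -> (forall x, 0 <= f x) ->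
    (forall c, Pr.-integrable setT (EFin \o (fun w => f (X w + c)))) ->
    Pr.-integrable setT (EFin \o (fun w => expR (l * X w) * f (X w))).
  move=> cf f0 iff; apply/integrableP; split.
    apply/measurable_EFinP; apply: measurable_funM; last exact: mc0.
    by apply: measurableT_comp => //; exact: measurable_funM.
  under eq_integral do rewrite /= ger0_norm ?mulr_ge0 ?expR_ge0//.
  rewrite tiltX//; have /integrableP[_] := iff (l * v).
  under eq_integral do rewrite /= ger0_norm//.
  by move=> hlt; rewrite lte_mul_pinfty// lee_fin expR_ge0.
have ieh := tilt_int h ch h0 ih; have ieg := tilt_int g cg g0 ig.
have ieQ : Pr.-integrable setT (EFin \o (fun w => expR (l * X w) * Q.[X w])).
  apply: le_integrable ieh => //.
    apply/measurable_EFinP; apply: measurable_funM; last exact: mc0.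
    by apply: measurableT_comp => //; exact: measurable_funM.
  move=> w _; rewrite /= lee_fin normrM [leRHS]normrM (ger0_norm (h0 _)) ler_wpM2l//.
split => //.
transitivity (\int[Pr]_w (expR (l * X w) * g (X w) - expR (l * X w) * h (X w))).
  by apply: eq_Rintegral => w _; rewrite -mulrBr /g addrK.
rewrite RintegralB//.
transitivity (expR (l * m + l ^+ 2 * v / 2) *
   \int[Pr]_w (g (X w + l * v) - h (X w + l * v))).
  rewrite RintegralB// mulrBr /Rintegral !tiltX// !fineM//;
    by apply: integrable_fin_num => //; first [exact: ig | exact: ih].
by congr (_ * _); apply: eq_Rintegral => w _; rewrite /g addrK.
Qed.

End polynomials_of_gaussian_variables.

(** * Difference quotients of exponentials of quadratic polynomials *)

Section small_time_limit.
Context {R : realType}.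

(** Convexity: the increment lies between those of the two tangents, whichever of [a] and [b] is
    larger. *)
Lemma expR_sub_itv (a b : R) :
  (a - b) * expR b <= expR a - expR b <= (a - b) * expR a.
Proof.
have h (x : R) : 1 + x <= expR x by exact: expR_ge1Dx.
apply/andP; split.
  have -> : expR a = expR (a - b) * expR b by rewrite -expRD subrK.
  by have := h (a - b); have := expR_gt0 b; nra.
have -> : expR b = expR (b - a) * expR a by rewrite -expRD subrK.
by have := h (b - a); have := expR_gt0 a; nra.
Qed.

Lemma sqr_le_itv (p x q : R) : p <= x -> x <= q -> x ^+ 2 <= p ^+ 2 + q ^+ 2.
Proof.
move=> px xq; have := sqr_ge0 p; have := sqr_ge0 q.
by have [x0|x0] := leP 0 x; nra.
Qed.

(** Since [t] tends to 0, the hypothesis forces [expR (y k)] to tend to 1; then [y] is squeezed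
    between [(expR y - 1) / expR y] and [expR y - 1], which agree to first order. *)
Lemma cvg_log_ratio (t y : nat -> R) (L : R) : (forall k, 0 < t k) ->
  t k @[k --> \oo] --> 0 -> (1 - expR (y k)) / t k @[k --> \oo] --> L ->
  y k / t k @[k --> \oo] --> - L.
Proof.
move=> t0 tcvg hL.
have e1 : expR (y k) @[k --> \oo] --> (1 : R).
  have -> : (fun k => expR (y k)) = (fun k => 1 - (1 - expR (y k)) / t k * t k).
    by apply/funext => k; rewrite divfK ?gt_eqF// subKr.
  rewrite [X in _ --> X](_ : 1 = 1 - L * 0); last by rewrite mulr0 subr0.
  by apply: cvgB; [exact: cvg_cst|exact: cvgM].
have hL' : (expR (y k) - 1) / t k @[k --> \oo] --> - L.
  have -> : (fun k => (expR (y k) - 1) / t k) = (fun k => - ((1 - expR (y k)) / t k)).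
    by apply/funext => k; rewrite -mulNr opprB.
  exact: cvgN.
have hL2 : (expR (y k) - 1) / t k * (expR (y k))^-1 @[k --> \oo] --> - L.
  rewrite [X in _ --> X](_ : - L = - L * 1^-1); last by rewrite invr1 mulr1.
  by apply: cvgM => //; apply: cvgV => //; exact: oner_neq0.
apply: (squeeze_cvgr _ hL2 hL'); apply: nearW => k.
have /andP[h1 h2] := expR_sub_itv (y k) 0; rewrite expR0 subr0 mulr1 in h1 h2.
apply/andP; split.
  rewrite mulrAC ler_pM2r ?invr_gt0// ler_pdivrMr ?expR_gt0//.
by rewrite ler_pM2r ?invr_gt0.
Qed.

Lemma horner_eq0_poly (p : {poly R}) : (forall x, p.[x] = 0) -> p = 0.
Proof.
move=> p0; apply: (@roots_geq_poly_eq0 _ p [seq i%:R | i <- iota 0 (size p)]).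
- by apply/allP => x _; apply/rootP.
- rewrite map_inj_in_uniq ?iota_uniq// => i j _ _ /eqP.
  by rewrite eqr_nat => /eqP.
- by rewrite size_map size_iota.
Qed.

(** After taking logarithms, the values at [l = 1] and [l = -1] determine the limits of [a k / t k]
    and [b k / t k]. Hence [p] agrees everywhere with a quadratic polynomial whose coefficients are
    these limits up to sign. *)
Lemma not_quadratic (t : nat -> R) (a b : nat -> R) (p : {poly R}) :
  (forall k, 0 < t k) -> t k @[k --> \oo] --> 0 ->
  (forall l, (1 - expR (l * a k + l ^+ 2 * b k)) / t k @[k --> \oo] --> p.[l]) ->
  (size p <= 3)%N.
Proof.
move=> t0 tcvg hp.
have hy l : (l * a k + l ^+ 2 * b k) / t k @[k --> \oo] --> - p.[l].
  exact: cvg_log_ratio.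
have h1 := hy 1; have h2 := hy (- 1).
have ha : a k / t k @[k --> \oo] --> (- p.[1] + p.[-1]) / 2.
  have -> : (fun k => a k / t k) = (fun k => ((1 * a k + 1 ^+ 2 * b k) / t k -
     (- 1 * a k + (- 1) ^+ 2 * b k) / t k) / 2).
    by apply/funext => k; field; rewrite gt_eqF.
  have -> : - p.[1] + p.[-1] = - p.[1] - - p.[-1] by rewrite opprK.
  by apply: cvgMl; apply: cvgB.
have hb : b k / t k @[k --> \oo] --> (- p.[1] - p.[-1]) / 2.
  have -> : (fun k => b k / t k) = (fun k => ((1 * a k + 1 ^+ 2 * b k) / t k +
     (- 1 * a k + (- 1) ^+ 2 * b k) / t k) / 2).
    by apply/funext => k; field; rewrite gt_eqF.
  by apply: cvgMl; apply: cvgD.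
move: ha hb; set al := (X in _ --> X) => ha; set be := (X in _ --> X) => hb.
have pE l : - p.[l] = l * al + l ^+ 2 * be.
  have h : (l * a k + l ^+ 2 * b k) / t k @[k --> \oo] --> l * al + l ^+ 2 * be.
    have -> : (fun k => (l * a k + l ^+ 2 * b k) / t k) =
       (fun k => l * (a k / t k) + l ^+ 2 * (b k / t k)).
      by apply/funext => k; rewrite mulrDl !mulrA.
    by apply: cvgD; apply: cvgMr.
  exact: (cvg_unique _ (hy l) h).
have p0 : p + al *: 'X + be *: 'X^2 = 0.
  apply: horner_eq0_poly => x; rewrite !hornerD !hornerZ hornerX hornerXn -(opprK p.[x]) pE.
  by ring.
have -> : p = - (al *: 'X + be *: 'X^2).
  by apply/eqP; rewrite -addr_eq0 addrA p0.
rewrite size_polyN (leq_trans (size_polyD _ _))// geq_max.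
by rewrite !(leq_trans (size_scale_leq _ _))// ?size_polyX// size_polyXn.
Qed.

End small_time_limit.

Section gaussian_small_time.
Context {R : realType} {d} {Omega : measurableType d}.
Variable Pr : probability Omega R.

(* As [t -> 0], a drift [t * P X] moves a Gaussian law to a non-Gaussian one,
   because [E (expR (l * X) * P X)] is [E (expR (l * X))] times a polynomial in
   [l] of degree [deg P > 1]. *)
Lemma gaussian_drift_size (P : {poly R}) (t : nat -> R)
    (U G : nat -> Omega -> R) (X : Omega -> R) (m v : R) (m_ v_ : nat -> R) (B C : R) :
  (forall k, 0 < t k) -> t k @[k --> \oo] --> 0 ->
  (forall k, gaussian_tilt Pr (U k) m v) -> gaussian_tilt Pr X m v ->
  (forall k, gaussian_mgf Pr (G k) (m_ k) (v_ k)) ->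
  (forall k, `|m_ k| <= B /\ v_ k <= B) ->
  (forall k, \int[Pr]_w (((U k w - G k w) / t k) ^+ 4)%:E <= C%:E)%E ->
  (\forall w \ae Pr, U k w @[k --> \oo] --> X w /\
     (U k w - G k w) / t k @[k --> \oo] --> P.[X w]) ->
  v != 0 -> (size P <= 2)%N.
Proof.
move=> t0 tcvg UG XG GG GB NC UXcvg v0.
pose D l k w := (expR (l * U k w) - expR (l * G k w)) / t k.
have mU k : measurable_fun setT (U k) by have [] := UG k.
have mG k : measurable_fun setT (G k) by have [] := GG k.
have mX : measurable_fun setT X by have [] := XG.
have mexp l (f : Omega -> R) : measurable_fun setT f ->
    measurable_fun setT (fun w => expR (l * f w)).
  by move=> mf; apply: measurableT_comp => //; exact: measurable_funM.
have [XPi Xi XPE] := gaussian_tilt_poly 0 P XG.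
have Dcvg l : (\int[Pr]_w (D l k w)%:E)%E @[k --> \oo] -->
   (\int[Pr]_w (l * (expR (l * X w) * P.[X w]))%:E)%E.
  (* By the tangent inequalities the square of [D] is at most [l ^+ 2 * (y ^+ 2 * a ^+ 2 + y ^+ 2 *
     b ^+ 2)], where [y] is the drift quotient and [a], [b] the exponentials of [l * U] and [l * G].
     Separating the products leaves fourth powers: those of [y] cost [C], those of [a] and [b] are
     generating functions at [4 * l], bounded by the two terms of [K]. *)
  pose K := expR (4 * l * m + (4 * l) ^+ 2 * v / 2) +
            expR (`|4 * l| * B + (4 * l) ^+ 2 * B / 2).
  have [//| | | |_ ] := @cvg_square_bounded R _ _ Pr (D l)
    (fun w => l * (expR (l * X w) * P.[X w])) (l ^+ 2 * (2 * C + K)).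
  - move=> k; apply: measurable_funM => //; apply: measurable_funB; exact: mexp.
  - apply: measurable_funM => //; apply: measurable_funM; first exact: mexp.
    exact: measurable_horner_comp.
  - move=> k.
    have mN : measurable_fun setT (fun w => (((U k w - G k w) / t k) ^+ 4)%:E).
      apply/measurable_EFinP; apply: measurable_funX.
      by apply: measurable_funM => //; exact: measurable_funB.
    have m4 (f : Omega -> R) : measurable_fun setT f ->
        measurable_fun setT (fun w => (expR (4 * l * f w))%:E).
      by move=> mf; apply/measurable_EFinP; exact: mexp.
    have X4 w : (0 <= (((U k w - G k w) / t k) ^+ 4)%:E)%E.
      by rewrite lee_fin (_ : 4 = 2 * 2)%N// exprM sqr_ge0.
    have E4 (f : Omega -> R) w : (0 <= (expR (4 * l * f w))%:E)%E.
      by rewrite lee_fin expR_ge0.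
    apply: (@le_trans _ _ (\int[Pr]_w ((l ^+ 2)%:E *
       (2%:E * (((U k w - G k w) / t k) ^+ 4)%:E +
        ((expR (4 * l * U k w))%:E + (expR (4 * l * G k w))%:E))))%E).
      apply: ge0_le_integral => //.
      + by move=> w _; rewrite lee_fin sqr_ge0.
      + apply/measurable_EFinP; apply: measurable_funX; apply: measurable_funM => //.
        by apply: measurable_funB; exact: mexp.
      + apply: measurable_funeM; apply: emeasurable_funD; first exact: measurable_funeM.
        by apply: emeasurable_funD; exact: m4.
      + move=> w _; rewrite -[leRHS]/((l ^+ 2 * (2 * ((U k w - G k w) / t k) ^+ 4 +
          (expR (4 * l * U k w) + expR (4 * l * G k w))))%:E) lee_fin.
        set y := (U k w - G k w) / t k.
        set a := expR (l * U k w); set b := expR (l * G k w).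
        have a0 : 0 < a by exact: expR_gt0.
        have b0 : 0 < b by exact: expR_gt0.
        have -> : expR (4 * l * U k w) = a ^+ 4.
          by rewrite /a -expRM_natl; congr expR; ring.
        have -> : expR (4 * l * G k w) = b ^+ 4.
          by rewrite /b -expRM_natl; congr expR; ring.
        have /andP[h1 h2] := expR_sub_itv (l * U k w) (l * G k w).
        rewrite -/a -/b in h1 h2.
        have Dy : l * U k w - l * G k w = l * y * t k.
          by rewrite /y; field; rewrite gt_eqF.
        rewrite Dy in h1 h2.
        have d1 : l * y * b <= D l k w.
          by rewrite /D ler_pdivlMr// mulrAC.
        have d2 : D l k w <= l * y * a.
          by rewrite /D ler_pdivrMr// mulrAC.
        have d3 : D l k w ^+ 2 <= (l * y * a) ^+ 2 + (l * y * b) ^+ 2.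
          by rewrite addrC; exact: sqr_le_itv.
        apply: le_trans d3 _.
        have -> : (l * y * a) ^+ 2 + (l * y * b) ^+ 2 =
            l ^+ 2 * (y ^+ 2 * a ^+ 2 + y ^+ 2 * b ^+ 2) by ring.
        rewrite ler_wpM2l ?sqr_ge0//.
        have := sqr_ge0 (y ^+ 2 - a ^+ 2); have := sqr_ge0 (y ^+ 2 - b ^+ 2).
        have -> : y ^+ 4 = (y ^+ 2) ^+ 2 by rewrite -exprM.
        have -> : a ^+ 4 = (a ^+ 2) ^+ 2 by rewrite -exprM.
        have -> : b ^+ 4 = (b ^+ 2) ^+ 2 by rewrite -exprM.
        have := sqr_ge0 (a ^+ 2); have := sqr_ge0 (b ^+ 2).
        move: (y ^+ 2) (a ^+ 2) (b ^+ 2) => y' a' b'.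
        by nra.
    have m2 : measurable_fun setT (fun w => 2%:E * (((U k w - G k w) / t k) ^+ 4)%:E)%E.
      exact: measurable_funeM.
    have mUG : measurable_fun setT (fun w => (expR (4 * l * U k w))%:E + (expR (4 * l * G k w))%:E)%E.
      by apply: emeasurable_funD; exact: m4.
    rewrite ge0_integralZl//; last 3 first.
    + exact: emeasurable_funD.
    + by move=> w _; rewrite adde_ge0 ?mule_ge0 ?adde_ge0.
    + by rewrite lee_fin sqr_ge0.
    rewrite ge0_integralD//; last 2 first.
    + by move=> w _; rewrite mule_ge0.
    + by move=> w _; rewrite adde_ge0.
    rewrite ge0_integralZl// ge0_integralD//; last 2 first.
    + exact: m4.
    + exact: m4.
    have [_ ->] := gaussian_tilt_mgf (UG k); have [_ ->] := GG k.
    rewrite [leRHS]EFinM; apply: lee_wpmul2l; first by rewrite lee_fin sqr_ge0.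
    rewrite [leRHS]EFinD [(2 * C)%:E]EFinM; apply: leeD; first exact: lee_wpmul2l.
    rewrite -EFinD lee_fin lerD2l ler_expR.
    have [mB vB] := GB k; apply: lerD.
      by rewrite (le_trans (ler_norm _))// normrM ler_wpM2l.
    by rewrite ler_pM2r// ler_wpM2l// sqr_ge0.
  - apply: filterS UXcvg => w [UX NP].
    have Gcvg : G k w @[k --> \oo] --> X w.
      have -> : (fun k => G k w) = (fun k => U k w - (U k w - G k w) / t k * t k).
        by apply/funext => k; rewrite divfK ?gt_eqF// subKr.
      rewrite [X in _ --> X](_ : X w = X w - P.[X w] * 0); last by rewrite mulr0 subr0.
      by apply: cvgB => //; exact: cvgM.
    have ecvg (f : nat -> R) : f k @[k --> \oo] --> X w ->
       l * ((U k w - G k w) / t k) * expR (l * f k) @[k --> \oo] -->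
       l * (expR (l * X w) * P.[X w]).
      move=> fX; rewrite [X in _ --> X](_ : _ = l * P.[X w] * expR (l * X w)); last by ring.
      apply: cvgM; first exact: cvgMr.
      apply: continuous_cvg; first exact: continuous_expR.
      exact: cvgMr.
    apply: (squeeze_cvgr _ (ecvg _ Gcvg) (ecvg _ UX)); apply: nearW => k.
    have /andP[h1 h2] := expR_sub_itv (l * U k w) (l * G k w).
    have Dy : l * U k w - l * G k w = l * ((U k w - G k w) / t k) * t k.
      by field; rewrite gt_eqF.
    rewrite Dy in h1 h2; rewrite /D ler_pdivlMr// ler_pdivrMr//.
    by rewrite !(mulrAC _ (expR _)) h1 h2.
  - by [].
have iN i : Pr.-integrable setT (EFin \o (fun w => (P^`N(i)).[X w])).
  have [_ /(_ 0) + _] := gaussian_tilt_poly 0 (P^`N(i)) XG.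
  by congr (_.-integrable _ _); apply/funext => w /=; rewrite addr0.
pose E i := \int[Pr]_w (P^`N(i)).[X w].
have QE h : \int[Pr]_w P.[X w + h] = \sum_(i < size P) E i * h ^+ i.
  rewrite /E /Rintegral.
  have -> : (\int[Pr]_w (P.[X w + h])%:E =
     \int[Pr]_w (\sum_(i < size P) ((h ^+ i)%:E * ((P^`N(i)).[X w])%:E)))%E.
    apply: eq_integral => w _; rewrite nderiv_taylor; last exact: mulrC.
    by rewrite -sumEFin; apply: eq_bigr => i _; rewrite mulrC EFinM.
  rewrite integral_sum//; last by move=> i; apply: integrableZl => //; exact: iN.
  rewrite -sum_fine; last first.
    move=> i _; apply: integrable_fin_num => //.
    by apply: integrableZl => //; exact: iN.
  apply: eq_bigr => i _; rewrite integralZl//; last exact: iN.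
  by rewrite fineM//=; [exact: mulrC|exact: (integrable_fin_num measurableT (iN i))].
(* Taylor expansion of [P] at [X] makes the expectation of [P.[X + l * v]] a polynomial in [l]. Its
   top coefficient is [lead_coef P] times a power of [v], so [v != 0] preserves the degree. *)
pose q := \poly_(i < size P) (E i * v ^+ i).
have qE l : q.[l] = \int[Pr]_w P.[X w + l * v].
  rewrite QE horner_poly; apply: eq_bigr => i _.
  by rewrite exprMn; ring.
have [->|P0] := eqVneq P 0; first by rewrite size_poly0.
have sP : (0 < size P)%N by rewrite lt0n size_poly_eq0.
have Elead : E (size P).-1 = lead_coef P.
  have -> : E (size P).-1 = \int[Pr]_w (cst (lead_coef P) w).
    apply: eq_Rintegral => w _ /=; rewrite [P^`N(_)]size1_polyC.
      by rewrite hornerC coef_nderivn addn0 binn mulr1n.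
    apply/leq_sizeP => j j0; rewrite coef_nderivn nth_default ?mul0rn//.
    by rewrite -[X in (X <= _)%N](prednK sP) -addn1 leq_add2l.
  by rewrite Rintegral_cst// [X in fine X]probability_setT mulr1.
have q_size : size q = size P.
  apply: size_poly_eq; rewrite Elead mulf_neq0 ?lead_coef_eq0//.
  by rewrite expf_eq0 negb_and v0 orbT.
have q_neq0 : q != 0 by rewrite -size_poly_eq0 q_size -lt0n.
(* The limit of the difference quotients is [l * q.[l]] after normalisation: the factor [l], from
   differentiating the exponential, raises the degree by one. *)
suff : (size (q * 'X)%R <= 3)%N by rewrite size_mulX// q_size.
apply: (@not_quadratic _ t (fun k => m_ k - m) (fun k => (v_ k - v) / 2)) => // l.
pose M := l * m + l ^+ 2 * v / 2.
have DE k : (\int[Pr]_w (D l k w)%:E =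
    ((expR M - expR (l * m_ k + l ^+ 2 * v_ k / 2)) / t k)%:E)%E.
  have iU := gaussian_mgf_integrable l (gaussian_tilt_mgf (UG k)).
  have iG := gaussian_mgf_integrable l (GG k).
  under eq_integral do rewrite EFinM.
  rewrite integralZr//; last first.
    by under eq_fun do rewrite EFinB; exact: integrableB.
  under eq_integral do rewrite EFinB.
  rewrite integralB_EFin//.
  by have [_ ->] := gaussian_tilt_mgf (UG k); have [_ ->] := GG k.
have [ePi _ ePE] := gaussian_tilt_poly l P XG.
have LE : (\int[Pr]_w (l * (expR (l * X w) * P.[X w]))%:E =
    (l * (expR M * q.[l]))%:E)%E.
  rewrite qE -ePE.
  under eq_integral do rewrite EFinM.
  rewrite integralZl// EFinM; congr (_ * _)%E.
  by rewrite /Rintegral fineK//; exact: (integrable_fin_num measurableT ePi).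
have := Dcvg l; rewrite LE; under eq_fun do rewrite DE.
move/fine_cvg => /= h.
(* Dividing by [expR M], the generating function of [X], removes the Gaussian factor from both
   sides. *)
have -> : (fun k => (1 - expR (l * (m_ k - m) + l ^+ 2 * ((v_ k - v) / 2))) / t k) =
   (fun k => expR (- M) * ((expR M - expR (l * m_ k + l ^+ 2 * v_ k / 2)) / t k)).
  apply/funext => k; rewrite [RHS]mulrA [in RHS]mulrBr -!expRD addNr expR0.
  by congr ((1 - expR _) / _); rewrite /M; field.
rewrite hornerM hornerX (_ : q.[l] * l = expR (- M) * (l * (expR M * q.[l]))).
  exact: cvgMr.
by rewrite expRN; field; rewrite gt_eqF ?expR_gt0.
Qed.

End gaussian_small_time.

(** * Almost sure and L^2 limits of Gaussian variables, and independent sums *)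

Section gaussian_limits.
Context {R : realType} {d} {Omega : measurableType d}.
Variable Pr : probability Omega R.

Lemma dominated_cvg_prob (f_ : nat -> Omega -> R) (f : Omega -> R) (C : R) :
  (forall n, measurable_fun setT (f_ n)) -> measurable_fun setT f ->
  (forall n w, `|f_ n w| <= C) ->
  (\forall w \ae Pr, f_ n w @[n --> \oo] --> f w) ->
  (\int[Pr]_w (f_ n w)%:E)%E @[n --> \oo] --> (\int[Pr]_w (f w)%:E)%E.
Proof.
move=> mf_ mf fC ff.
have [| | | | | _ _ //] := @dominated_convergence _ _ _ Pr setT measurableT
  (fun n w => (f_ n w)%:E) (fun w => (f w)%:E) (cst C%:E).
- by move=> n; exact/measurable_EFinP.
- exact/measurable_EFinP.
- by apply: filterS ff => w fw _; apply: cvg_EFin; [exact: nearW|].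
- exact: finite_measure_integrable_cst.
- by apply: aeW => w n _ /=; rewrite lee_fin.
Qed.

(** The cutoff [c M] is continuous, zero for |x| <= M and one for |x| >= M + 1, so its expectation
    passes to the limit where the indicator of a tail would not. This is why the level found for [X]
    increases by 1. *)
Lemma ae_cvg_tight (X_ : nat -> Omega -> R) (X : Omega -> R) (e : R) : 0 < e ->
  (forall n, measurable_fun setT (X_ n)) -> measurable_fun setT X ->
  (\forall w \ae Pr, X_ n w @[n --> \oo] --> X w) ->
  exists2 M, 0 <= M &
    \forall n \near \oo, (Pr [set w | M < `|X_ n w|]%R <= e%:E)%E.
Proof.
move=> e0 mX_ mX XX.
pose c (M x : R) := Num.min 1 (Num.max 0 (`|x| - M)).
have mc M (Y : Omega -> R) : measurable_fun setT Y -> measurable_fun setT (fun w => c M (Y w)).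
  move=> mY; apply: measurable_minr => //; apply: measurable_maxr => //.
  by apply: measurable_funB => //; apply: measurableT_comp.
have c0 M x : 0 <= c M x by rewrite /c le_min ler01 le_max lexx.
have c1 M x : `|c M x| <= 1 by rewrite ger0_norm// /c ge_min lexx.
have h1 : (\int[Pr]_w (c n%:R (X w))%:E)%E @[n --> \oo] --> (\int[Pr]_w (0 : R)%:E)%E.
  apply: (@dominated_cvg_prob _ _ 1) => //.
  - by move=> n; exact: mc.
  - apply: aeW => w; apply: cvg_near_cst.
    near=> n; rewrite /c; apply/eqP; rewrite (@max_l _ _ 0) ?min_r//.
    rewrite subr_le0; near: n; exact: nbhs_infty_ger.
rewrite integral0 in h1.
have [n0 _ hn0] : \forall n \near \oo, (\int[Pr]_w (c n%:R (X w))%:E < e%:E)%E.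
  have := h1 [set x | (x < e%:E)%E]; apply.
  by apply: open_nbhs_nbhs; split; [exact: open_ereal_lt_ereal|rewrite /= lte_fin].
have {hn0}hM := hn0 n0 (leqnn _); set M := n0%:R in hM.
have h2 : (\int[Pr]_w (c M (X_ n w))%:E)%E @[n --> \oo] --> (\int[Pr]_w (c M (X w))%:E)%E.
  apply: (@dominated_cvg_prob _ _ 1) => //.
  - by move=> n; exact: mc.
  - exact: mc.
  - apply: filterS XX => w Xw.
    have cc : continuous (c M).
      move=> x; apply: (@continuous_min _ _ (cst 1) (fun x => Num.max 0 (`|x| - M))).
        exact: cvg_cst.
      apply: (@continuous_max _ _ (cst 0) (fun x => `|x| - M)); first exact: cvg_cst.
      by apply: cvgB; [exact: norm_continuous|exact: cvg_cst].
    by apply: continuous_cvg => //; exact: cc.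
exists (M + 1); first by rewrite addr_ge0.
have : \forall n \near \oo, (\int[Pr]_w (c M (X_ n w))%:E < e%:E)%E.
  have := h2 [set x | (x < e%:E)%E]; apply.
  by apply: open_nbhs_nbhs; split; [exact: open_ereal_lt_ereal|].
apply: filterS => n hn; apply: le_trans (ltW hn).
have mB : measurable [set w | M + 1 < `|X_ n w|]%R.
  have -> : [set w | M + 1 < `|X_ n w|]%R = (fun w => `|X_ n w|) @^-1` `]M + 1, +oo[.
    by apply/seteqP; split => w /=; rewrite in_itv/= andbT.
  rewrite -[X in measurable X]setTI; apply: (measurableT_comp (f := fun x : R => `|x|)) => //.
rewrite -[[set w | _]]setIT -(@integral_indic _ _ _ Pr setT)//.
apply: ge0_le_integral => //.
- exact/measurable_EFinP.
- by apply/measurable_EFinP; exact: mc.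
- move=> w _; rewrite lee_fin indicE.
  have [XM|XM] := leP (`|X_ n w|) (M + 1).
    by rewrite (_ : (w \in _) = false)//; apply/negbTE; rewrite notin_setE /= ltNge XM.
  rewrite mem_set//= /c le_min lexx/= le_max; apply/orP; right.
  by rewrite lerBrDl ltW.
Unshelve. all: by end_near.
Qed.

Lemma gaussian_mgf_ae_bounded (X_ : nat -> Omega -> R) (X : Omega -> R) (m v : nat -> R) :
  (forall n, gaussian_mgf Pr (X_ n) (m n) (v n)) -> (forall n, 0 <= v n) ->
  measurable_fun setT X ->
  (\forall w \ae Pr, X_ n w @[n --> \oo] --> X w) ->
  exists B, \forall n \near \oo, `|m n| <= B /\ v n <= B.
Proof.
move=> XG v0 mX XX; have e0 : 0 < expR (- 9) / 2 :> R by rewrite divr_gt0 ?expR_gt0.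
have mX_ n : measurable_fun setT (X_ n) by have [] := XG n.
have [M M0 hM] := ae_cvg_tight e0 mX_ mX XX.
exists (2 * M ^+ 2 + 3 * M + 2); apply: filterS hM => n hn.
have [h1 h2] := mgf_tight (XG n) (v0 n) M0 hn.
have := sqr_ge0 M; split; lra.
Qed.

(** From some index [K] on, the parameters are bounded, hence so are the second moments of
    [expR (l * X_ n)], which are generating functions at [2 * l]. The generating functions therefore
    converge, and their logarithms at 1 and -1 give back the convergence of means and variances. *)
Lemma gaussian_mgf_ae_cvg (X_ : nat -> Omega -> R) (X : Omega -> R) (m v : nat -> R) :
  (forall n, gaussian_mgf Pr (X_ n) (m n) (v n)) -> (forall n, 0 <= v n) ->
  measurable_fun setT X ->
  (\forall w \ae Pr, X_ n w @[n --> \oo] --> X w) ->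
  exists m' v', gaussian_mgf Pr X m' v' /\ 0 <= v'.
Proof.
move=> XG v0 mX XX; have [B [K _ hB]] := gaussian_mgf_ae_bounded XG v0 mX XX.
pose a l n := l * m (n + K)%N + l ^+ 2 * v (n + K)%N / 2.
have hB' n : `|m (n + K)%N| <= B /\ v (n + K)%N <= B by apply: hB; rewrite /= leq_addl.
have aB l n : `|a l n| <= `|l| * B + l ^+ 2 * B / 2.
  have [h1 h2] := hB' n.
  apply: le_trans (ler_normD _ _) _; apply: lerD; first by rewrite normrM ler_wpM2l.
  have sl := sqr_ge0 l; rewrite ger0_norm.
    by rewrite ler_pM2r ?invr_gt0// ler_wpM2l.
  by apply: divr_ge0 => //; exact: mulr_ge0.
have ecvg l : (expR (a l n))%:E @[n --> \oo] --> (\int[Pr]_w (expR (l * X w))%:E)%E.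
  have mexp (f : Omega -> R) : measurable_fun setT f ->
      measurable_fun setT (fun w => expR (l * f w)).
    by move=> mf; apply: measurableT_comp => //; exact: measurable_funM.
  have [| | | | _ ] := @cvg_square_bounded R _ _ Pr
    (fun n w => expR (l * X_ (n + K)%N w)) (fun w => expR (l * X w))
    (expR (`|2 * l| * B + (2 * l) ^+ 2 * B / 2)).
  - by move=> n; apply: mexp; have [] := XG (n + K)%N.
  - exact: mexp.
  - move=> n; under eq_integral do rewrite -expRM_natl mulrA.
    have [_ ->] := XG (n + K)%N; rewrite lee_fin ler_expR.
    by apply: le_trans (aB (2 * l) n); exact: ler_norm.
  - apply: filterS XX => w Xw; apply: continuous_cvg; first exact: continuous_expR.
    by apply: cvgMr; rewrite -(cvg_shiftn K) in Xw.
  by apply: cvg_trans; apply: near_eq_cvg; apply: nearW => n; have [_ ->] := XG (n + K)%N.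
have ecvg' l : expR (a l n) @[n --> \oo] --> fine (\int[Pr]_w (expR (l * X w))%:E)%E.
  pose C := expR (`|l| * B + l ^+ 2 * B / 2).
  have h1 : (\int[Pr]_w (expR (l * X w))%:E <= C%:E)%E.
    apply: (cvge_to_le (ecvg l)); apply: nearW => n.
    by rewrite lee_fin ler_expR (le_trans (ler_norm _)).
  apply: (fine_cvg (f := fun n => (expR (a l n))%:E)); rewrite fineK; first exact: ecvg.
  rewrite ge0_fin_numE; first by apply: le_lt_trans h1 _; exact: ltry.
  by apply: integral_ge0 => w _; rewrite lee_fin expR_ge0.
pose E l := fine (\int[Pr]_w (expR (l * X w))%:E)%E.
(* The logarithm may be taken in the limit because the generating functions are also bounded away
   from 0. *)
have E0 l : 0 < E l.
  apply: (@lt_le_trans _ _ (expR (- (`|l| * B + l ^+ 2 * B / 2)))); first exact: expR_gt0.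
  apply: (cvgr_to_ge (ecvg' l)); apply: nearW => n; rewrite ler_expR lerNl.
  by apply: le_trans (aB l n); rewrite -normrN; exact: ler_norm.
have acvg l : a l n @[n --> \oo] --> ln (E l).
  have -> : a l = (fun n => ln (expR (a l n))) by apply/funext => n; rewrite expRK.
  by apply: continuous_cvg; [exact: continuous_ln|exact: ecvg'].
pose m' := (ln (E 1) - ln (E (-1))) / 2.
pose v' := ln (E 1) + ln (E (-1)).
have mcvg : m (n + K)%N @[n --> \oo] --> m'.
  have -> : (fun n => m (n + K)%N) = (fun n => (a 1 n - a (-1) n) / 2).
    by apply/funext => n; rewrite /a; field.
  by apply: cvgMl; apply: cvgB.
have vcvg : v (n + K)%N @[n --> \oo] --> v'.
  have -> : (fun n => v (n + K)%N) = (fun n => (a 1 n + a (-1) n)).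
    by apply/funext => n; rewrite /a; field.
  exact: cvgD.
exists m', v'; split; last by apply: (cvgr_to_ge vcvg); exact: nearW.
split => // l.
have aE : expR (a l n) @[n --> \oo] --> expR (l * m' + l ^+ 2 * v' / 2).
  apply: continuous_cvg; first exact: continuous_expR.
  by apply: cvgD; [exact: cvgMr|apply: cvgMl; exact: cvgMr].
have aE' : (expR (a l n))%:E @[n --> \oo] --> (expR (l * m' + l ^+ 2 * v' / 2))%:E.
  by apply: cvg_EFin; [exact: nearW|exact: aE].
exact: (cvg_unique (@ereal_hausdorff R) (ecvg l) aE').
Qed.

Lemma ge0_integral_indep (A Y : Omega -> R) (f g : R -> R) :
  measurable_fun setT A -> measurable_fun setT Y ->
  (forall B C, measurable B -> measurable C ->
    Pr (A @^-1` B `&` Y @^-1` C) = Pr (A @^-1` B) * Pr (Y @^-1` C))%E ->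
  measurable_fun setT f -> measurable_fun setT g ->
  (forall x, 0 <= f x) -> (forall x, 0 <= g x) ->
  (\int[Pr]_w (f (A w) * g (Y w))%:E =
   \int[Pr]_w (f (A w))%:E * \int[Pr]_w (g (Y w))%:E)%E.
Proof.
move=> mA mY indep mf mg f0 g0.
pose A' : {mfun Omega >-> R} := HB.pack A
  (isMeasurableFun.Build _ _ _ _ A mA).
pose Y' : {mfun Omega >-> R} := HB.pack Y
  (isMeasurableFun.Build _ _ _ _ Y mY).
pose m1 : probability R R := distribution Pr A'.
pose m2 : probability R R := distribution Pr Y'.
pose AY w := (A w, Y w).
have mAY : measurable_fun setT AY by exact: measurable_fun_pair.
pose h (z : R * R) := ((f z.1)%:E * (g z.2)%:E)%E.
have mh : measurable_fun setT h.
  apply: emeasurable_funM; apply/measurable_EFinP.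
    exact: (measurableT_comp mf).
  exact: (measurableT_comp mg).
have h0 z : (0 <= h z)%E by rewrite mule_ge0// lee_fin.
have mfE : measurable_fun setT (fun x => (f x)%:E) by exact/measurable_EFinP.
have mgE : measurable_fun setT (fun x => (g x)%:E) by exact/measurable_EFinP.
have -> : (\int[Pr]_w (f (A w) * g (Y w))%:E = \int[pushforward Pr AY]_z h z)%E.
  by rewrite ge0_integral_pushforward.
have -> : (\int[pushforward Pr AY]_z h z = \int[m1 \x m2]_z h z)%E.
  apply: eq_measure_integral => S mS _; apply/esym.
  by apply: (product_measure_unique (m' := pushforward Pr AY)) => // B C mB mC; exact: indep.
rewrite fubini_tonelli1// /fubini_F /h /=.
have gE : (\int[m2]_y (g y)%:E = \int[Pr]_w (g (Y w))%:E)%E.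
  by rewrite /m2 /distribution ge0_integral_pushforward//= => y _; rewrite lee_fin.
have fE : (\int[m1]_y (f y)%:E = \int[Pr]_w (f (A w))%:E)%E.
  by rewrite /m1 /distribution ge0_integral_pushforward//= => y _; rewrite lee_fin.
under eq_integral => x _.
  rewrite ge0_integralZl//; last 2 first.
  - by move=> y _; rewrite lee_fin.
  - by rewrite lee_fin.
  over.
rewrite ge0_integralZr//; last 2 first.
- by move=> x _; rewrite lee_fin.
- by apply: integral_ge0 => y _; rewrite lee_fin.
by rewrite fE gE.
Qed.

(** Indices are chosen with squared error at most 2^-(k+1). The sum of the squared errors then has
    finite expectation, so it is finite almost surely and its terms tend to 0. The selection [s] is
    just a choice of indices, not necessarily increasing. *)
Lemma L2_cvg_ae_subseq (Y_ : nat -> Omega -> R) (Y : Omega -> R) :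
  (forall n, measurable_fun setT (Y_ n)) -> measurable_fun setT Y ->
  (\int[Pr]_w ((Y_ n w - Y w) ^+ 2)%:E)%E @[n --> \oo] --> 0%E ->
  exists s : nat -> nat,
    \forall w \ae Pr, Y_ (s n) w @[n --> \oo] --> Y w.
Proof.
move=> mY_ mY Y0.
have small k : exists n, (\int[Pr]_w ((Y_ n w - Y w) ^+ 2)%:E <= (1 / (2 ^ k.+1)%:R)%:E)%E.
  have [N _ hN] : \forall n \near \oo,
      (\int[Pr]_w ((Y_ n w - Y w) ^+ 2)%:E < (1 / (2 ^ k.+1)%:R)%:E)%E.
    have := Y0 [set x | (x < (1 / (2 ^ k.+1)%:R)%:E)%E]; apply.
    apply: open_nbhs_nbhs; split; first exact: open_ereal_lt_ereal.
    by rewrite /= lte_fin divr_gt0// ltr0n expn_gt0.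
  by exists N; apply/ltW/hN; exact: leqnn.
have [s hs] := choice small; exists s.
pose D k w := (Y_ (s k) w - Y w) ^+ 2.
have mD k : measurable_fun setT (fun w => (D k w)%:E).
  by apply/measurable_EFinP; apply: measurable_funX; exact: measurable_funB.
have D0 k w : (0 <= (D k w)%:E)%E by rewrite lee_fin sqr_ge0.
have sum_lty : (\int[Pr]_w (\sum_(k <oo) (D k w)%:E) < +oo)%E.
  rewrite integral_nneseries//.
  apply: (@le_lt_trans _ _ (\sum_(k <oo) (1 / (2 ^ k.+1)%:R)%:E)%E).
    apply: lee_nneseries => [k _ _|k _]; last exact: hs.
    exact: integral_ge0.
  by apply: le_lt_trans (epsilon_trick0 xpredT ler01) _; exact: ltry.
have msum : measurable_fun setT (fun w => \sum_(k <oo) (D k w)%:E)%E.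
  by apply: ge0_emeasurable_sum.
have isum : Pr.-integrable setT (fun w => \sum_(k <oo) (D k w)%:E)%E.
  apply/integrableP; split => //.
  by under eq_integral do rewrite gee0_abs ?nneseries_ge0//.
have := integrable_ae measurableT isum; apply: filterS => w /(_ I) fsum.
have scvg : cvgn (series (D ^~ w)).
  apply: nondecreasing_is_cvgn.
    by apply: nondecreasing_series => n _ _; exact: sqr_ge0.
  exists (fine (\sum_(k <oo) (D k w)%:E)%E) => _ [n _ <-].
  rewrite -lee_fin fineK// /series/= -sumEFin.
  exact: nneseries_lim_ge.
have /cvg_series_cvg_0 h := scvg.
have : Num.sqrt (D n w) @[n --> \oo] --> Num.sqrt 0.
  by apply: continuous_cvg => //; exact: sqrt_continuous.
rewrite sqrtr0 => h'; apply/cvgrPdist_lt => e e0.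
move/cvgrPdist_lt : h' => /(_ e e0); apply: filterS => n.
by rewrite sub0r normrN sqrtr_sqr normr_id distrC.
Qed.

Lemma indep_gaussian_mgfD (A Y : Omega -> R) (m v m' v' : R) :
  gaussian_mgf Pr A m v -> gaussian_mgf Pr Y m' v' ->
  (forall B C, measurable B -> measurable C ->
    Pr (A @^-1` B `&` Y @^-1` C) = Pr (A @^-1` B) * Pr (Y @^-1` C))%E ->
  gaussian_mgf Pr (A \+ Y) (m + m') (v + v').
Proof.
move=> [mA AE] [mY YE] indep; split; first exact: measurable_funD.
move=> l; under eq_integral do rewrite mulrDr expRD.
have mexp : measurable_fun setT (fun x : R => expR (l * x)).
  by apply: measurableT_comp => //; exact: measurable_funM.
rewrite (ge0_integral_indep mA mY indep mexp mexp);
  try by move=> x; exact: expR_ge0.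
by rewrite AE YE -EFinM -expRD; congr (expR _)%:E; ring.
Qed.

(** Independence is used for the approximants, where it is available; the sum with [Z] is reached
    afterwards as an almost sure limit along a subsequence. *)
Lemma L2_limit_gaussian_mgfD (A Z : Omega -> R) (Y_ : nat -> Omega -> R) :
  gaussian_rv Pr A -> (forall n, gaussian_rv Pr (Y_ n)) ->
  (forall n B C, measurable B -> measurable C ->
    Pr (A @^-1` B `&` Y_ n @^-1` C) = Pr (A @^-1` B) * Pr (Y_ n @^-1` C))%E ->
  measurable_fun setT Z ->
  (\int[Pr]_w ((Y_ n w - Z w) ^+ 2)%:E)%E @[n --> \oo] --> 0%E ->
  exists m v, gaussian_mgf Pr (A \+ Z) m v /\ 0 <= v.
Proof.
move=> gA gY indep mZ YZ.
have [mA [vA tA]] := gaussian_rv_tilt gA; have [_ vA0 _ _] := tA.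
have [p hp] := choice (fun n => gaussian_rv_tilt (gY n)).
have [q hq] := choice hp.
have mY n : measurable_fun setT (Y_ n) by have [] := hq n.
have mA' : measurable_fun setT A by have [] := tA.
have [s hs] := L2_cvg_ae_subseq mY mZ YZ.
apply: (@gaussian_mgf_ae_cvg (fun n => A \+ Y_ (s n)) _
    (fun n => mA + p (s n)) (fun n => vA + q (s n))).
- by move=> n; apply: indep_gaussian_mgfD;
    [exact: gaussian_tilt_mgf|exact: gaussian_tilt_mgf|exact: indep].
- by move=> n; apply: addr_ge0 => //; have [] := hq (s n).
- exact: measurable_funD.
- by apply: filterS hs => w hw; apply: cvgD; [exact: cvg_cst|].
Qed.

End gaussian_limits.

(** * The heat semigroup *)

Lemma cvg_sum_seq (R : realType) (I : Type) (r : seq I) (f : I -> nat -> R) (l : I -> R) :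
  (forall i, f i n @[n --> \oo] --> l i) ->
  \sum_(i <- r) f i n @[n --> \oo] --> \sum_(i <- r) l i.
Proof.
move=> fl; elim: r => [|i r IH].
  by under eq_fun do rewrite big_nil; rewrite big_nil; exact: cvg_cst.
by under eq_fun do rewrite big_cons; rewrite big_cons; apply: cvgD.
Qed.

(** * Positivity of theta series through Fejer sums *)

Section fejer_positivity.
Variable R : realType.
Implicit Types (a b : R -> R) (M : nat) (x : R).

(* [M] times the [M]-th Cesaro mean of the series with coefficients [a];
   nonnegative for every [a] that is a limit of mixtures of characters. *)
Let fejer a M x : R :=
  \sum_(i < M) \sum_(j < M) a (i%:R - j%:R) * cos ((i%:R - j%:R) * x).

(** The Fejer kernel: squared modulus of the sum of the first [M] characters. *)
Let fejer1_ge0 M x : 0 <= fejer (cst 1) M x.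
Proof.
have -> : fejer (cst 1) M x =
    (\sum_(i < M) cos (i%:R * x)) ^+ 2 + (\sum_(i < M) sin (i%:R * x)) ^+ 2.
  rewrite !expr2 !mulr_suml -big_split /=; apply: eq_bigr => i _.
  rewrite !mulr_sumr -big_split /=; apply: eq_bigr => j _.
  by rewrite mul1r mulrBl cosB.
by rewrite addr_ge0// sqr_ge0.
Qed.

(** Multiplying coefficients by a cosine averages two translates, so it preserves nonnegativity in
    [x]. *)
Let fejer_cos a M x c :
  fejer (fun k => a k * cos (c * k)) M x =
  (fejer a M (x + c) + fejer a M (x - c)) / 2.
Proof.
have E (k : R) : a k * cos (c * k) * cos (k * x) =
    (a k * cos (k * (x + c)) + a k * cos (k * (x - c))) / 2.
  by rewrite mulrDr mulrBr cosD cosB (mulrC k c); field.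
rewrite /fejer -big_split mulr_suml /=; apply: eq_bigr => i _.
rewrite -big_split mulr_suml /=; apply: eq_bigr => j _; exact: E.
Qed.

Let fejer_cosX M c j x : 0 <= fejer (fun k => cos (c * k) ^+ j) M x.
Proof.
elim: j x => [|j IH] x; first by under eq_fun do rewrite expr0; exact: fejer1_ge0.
under eq_fun do rewrite exprSr.
by rewrite fejer_cos divr_ge0// addr_ge0.
Qed.

Let fejerD a b M x : fejer (fun k => a k + b k) M x = fejer a M x + fejer b M x.
Proof.
rewrite /fejer -big_split /=; apply: eq_bigr => i _.
by rewrite -big_split /=; apply: eq_bigr => j _; rewrite mulrDl.
Qed.

Let fejerZ (r : R) a M x : fejer (fun k => r * a k) M x = r * fejer a M x.
Proof.
rewrite /fejer mulr_sumr; apply: eq_bigr => i _.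
by rewrite mulr_sumr; apply: eq_bigr => j _; rewrite mulrA.
Qed.

Let fejer_cvg (a_ : nat -> R -> R) a M x :
  (forall k, a_ n k @[n --> \oo] --> a k) ->
  fejer (a_ n) M x @[n --> \oo] --> fejer a M x.
Proof.
move=> aa; rewrite /fejer.
apply: (@cvg_sum_seq _ _ _ (fun (i : 'I_M) n => \sum_(j < M) a_ n (i%:R - j%:R) * cos ((i%:R - j%:R) * x))) => i.
apply: (@cvg_sum_seq _ _ _ (fun (j : 'I_M) n => a_ n (i%:R - j%:R) * cos ((i%:R - j%:R) * x))) => j.
by apply: cvgMl; exact: aa.
Qed.

(** The exponential series in [cos (c * k)] has nonnegative coefficients because [K >= 0], and each
    power of the cosine is covered by [fejer_cosX]. *)
Let fejer_exp_cos K M c x : 0 <= K ->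
  0 <= fejer (fun k => expR (K * (cos (c * k) - 1))) M x.
Proof.
move=> K0; have -> : (fun k => expR (K * (cos (c * k) - 1))) =
    (fun k => expR (- K) * expR (K * cos (c * k))).
  by apply/funext => k; rewrite -expRD; congr expR; ring.
rewrite fejerZ mulr_ge0 ?expR_ge0//.
have h : fejer (fun k => series (exp_coeff (K * cos (c * k))) n) M x @[n --> \oo] -->
    fejer (fun k => expR (K * cos (c * k))) M x.
  by apply: fejer_cvg => k; exact: is_cvg_series_exp_coeff.
apply: (cvgr_to_ge h); apply: nearW => n.
elim: n => [|n IH].
  rewrite /fejer sumr_ge0// => i _; rewrite sumr_ge0// => j _.
  by rewrite /series /= big_geq// mul0r.
have -> : (fun k => series (exp_coeff (K * cos (c * k))) n.+1) =
   (fun k => series (exp_coeff (K * cos (c * k))) n + K ^+ n / n`!%:R * cos (c * k) ^+ n).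
  apply/funext => k; rewrite seriesSr; congr (_ + _).
  by rewrite /exp_coeff /= exprMn mulrAC.
by rewrite fejerD fejerZ addr_ge0// mulr_ge0// divr_ge0// exprn_ge0.
Qed.

Lemma cvg_sin_ratio (c : R) : n.+1%:R * sin (c / n.+1%:R) @[n --> \oo] --> c.
Proof.
pose f (s : R) := sin (c * s).
have df : is_derive (0 : R) (1 : R) f c.
  have dc : is_derive (0 : R) (1 : R) (fun s => c * s) c.
    have -> : (fun s : R => c * s) = c \*: (id : R -> R) by [].
    by apply: is_derive_eq; rewrite /GRing.scale /= mulr1.
  apply: (@is_derive_eq _ _ _ (sin \o (fun s => c * s)) _ _ _ (cos (c * 0) * c)).
  by rewrite mulr0 cos0 mul1r.
have [df1 df2] := df.
have h : (h^-1 *: (f (h *: (1 : R) + 0) - f 0)) @[h --> 0^'] --> c by rewrite -df2.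
have hN : (n.+1%:R^-1 : R) @[n --> \oo] --> (0 : R)^'.
  move=> A A0; have {}A0 : nbhs (0 : R) [set y | y != 0 -> A y] by exact: A0.
  have : \forall n \near \oo, (@harmonic R n != 0 -> A (harmonic n)).
    exact: (@cvg_harmonic R _ A0).
  by apply: filterS => n /=; apply; rewrite gt_eqF// invr_gt0.
have := cvg_comp _ _ hN h.
apply: cvg_trans; apply: near_eq_cvg; apply: nearW => n /=.
by rewrite invrK /f mulr0 sin0 subr0 addr0 /GRing.scale /= mulr1.
Qed.

(** The Gaussian is a limit of the previous weights with [c = 1 / N] and [K = 2 * t * N ^+ 2],
    because [1 - cos r = 2 * sin (r / 2) ^+ 2]. This is the central limit theorem for a simple
    random walk in continuous time, on the side of characteristic functions. *)
Let fejer_gauss_ge0 (t : R) M x : 0 <= t -> 0 <= fejer (fun k => expR (- (t * k ^+ 2))) M x.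
Proof.
move=> t0.
have h : fejer (fun k => expR (2 * t * n.+1%:R ^+ 2 * (cos (n.+1%:R^-1 * k) - 1))) M x
    @[n --> \oo] --> fejer (fun k => expR (- (t * k ^+ 2))) M x.
  apply: fejer_cvg => k; apply: continuous_cvg; first exact: continuous_expR.
  have -> : (fun n : nat => 2 * t * n.+1%:R ^+ 2 * (cos (n.+1%:R^-1 * k) - 1)) =
     (fun n : nat => - (4 * t) * (n.+1%:R * sin (k / 2 / n.+1%:R)) ^+ 2).
    apply/funext => n; have -> : n.+1%:R^-1 * k = (k / 2 / n.+1%:R) *+ 2.
      by rewrite -mulr_natr; field.
    by rewrite cos_mulr2n cos2sin2 mulr2n exprMn; ring.
  rewrite [X in _ --> X](_ : _ = - (4 * t) * (k / 2) ^+ 2); last by field.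
  by apply: cvgMr; rewrite expr2; under eq_fun do rewrite expr2; apply: cvgM; exact: cvg_sin_ratio.
apply: (cvgr_to_ge h); apply: nearW => n; apply: fejer_exp_cos.
by rewrite mulr_ge0 ?sqr_ge0// mulr_ge0.
Qed.

(** Passing from [M] to [M + 1] adds a row and a column, which for even [a] are equal; together with
    the diagonal they form a partial sum of the cosine series. So [fejer] is a sum of partial
    sums. *)
Let fejerS a M x : (forall k, a (- k) = a k) ->
  fejer a M.+1 x =
  fejer a M x + (a 0 + 2 * \sum_(1 <= k < M.+1) a k%:R * cos (k%:R * x)).
Proof.
move=> aN; rewrite /fejer big_ord_recr /=.
have row : \sum_(j < M) a (M%:R - j%:R) * cos ((M%:R - j%:R) * x) =
    \sum_(1 <= k < M.+1) a k%:R * cos (k%:R * x).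
  rewrite big_add1 /= big_nat_rev /= add0n big_mkord; apply: eq_bigr => j _.
  by rewrite subnSK// natrB// ltnW.
rewrite big_ord_recr /= row subrr mul0r cos0 mulr1.
under eq_bigr do rewrite big_ord_recr /=.
rewrite big_split /= -row.
have -> : \sum_(i < M) a (i%:R - M%:R) * cos ((i%:R - M%:R) * x) =
    \sum_(j < M) a (M%:R - j%:R) * cos ((M%:R - j%:R) * x).
  by apply: eq_bigr => j _; rewrite -(aN (_ - _)) -(cosN (_ * x)) -mulNr opprB.
by ring.
Qed.

(** The partial sums may be negative, but their Cesaro means have the same limit and are
    nonnegative. *)
Lemma theta_limit_ge0 (t x L : R) : 0 <= t ->
  1 + 2 * \sum_(1 <= k < n) expR (- (t * k%:R ^+ 2)) * cos (k%:R * x) @[n --> \oo] --> L ->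
  0 <= L.
Proof.
move=> t0 hL; pose a (k : R) := expR (- (t * k ^+ 2)).
pose u n := 1 + 2 * \sum_(1 <= k < n.+1) a k%:R * cos (k%:R * x).
have hu : u n @[n --> \oo] --> L by move: hL; rewrite -cvg_shiftS.
apply: (cvgr_to_ge (cesaro hu)); apply: nearW => n.
rewrite /arithmetic_mean /=; apply: mulr_ge0 => //.
have -> : series u n.+1 = fejer a n.+1 x.
  elim: n.+1 => [|m IH]; first by rewrite /series /fejer /= big_geq// big_ord0.
  rewrite seriesSr IH fejerS => [|k]; last by rewrite /a sqrrN.
  by rewrite /u /a expr0n/= mulr0 oppr0 expR0.
exact: fejer_gauss_ge0.
Qed.

End fejer_positivity.

(** * The heat kernel: convergence, positivity, mass and first Fourier mode *)

Section heat_kernel_theory.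
Variable R : realType.
Local Notation leb := (@lebesgue_measure R).
Implicit Types (t x y z : R) (f g : R -> R).

Let e t (k : nat) : R := expR (- (2 * pi * k%:R) ^+ 2 * t).
Let S t n z : R := \sum_(1 <= k < n) e t k * cos (2 * pi * k%:R * z).
Let B t : R := 1 + 2 * (1 - e t 1)^-1.

Let e_ge0 t k : 0 <= e t k. Proof. exact: expR_ge0. Qed.

Let e1_lt1 t : 0 < t -> e t 1 < 1.
Proof.
move=> t0; rewrite /e mulr1 expR_lt1 mulNr oppr_lt0 mulr_gt0// exprn_gt0//.
by rewrite mulr_gt0// pi_gt0.
Qed.

(** From [k <= k ^+ 2]. Comparison with this geometric series gives the bound [B], uniform in the
    position and in the number of terms. *)
Let e_le t k : 0 < t -> e t k <= e t 1 ^+ k.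
Proof.
move=> t0; rewrite /e -expRM_natl ler_expR mulr1 !mulNr mulrN lerN2.
rewrite exprMn mulrAC [leLHS](_ : _ = k%:R * ((2 * pi) ^+ 2 * t)); last by ring.
rewrite [leRHS](_ : _ = k%:R ^+ 2 * ((2 * pi) ^+ 2 * t)); last by ring.
apply: ler_wpM2r; first by rewrite mulr_ge0 ?sqr_ge0// ltW.
by rewrite -natrX ler_nat; case: k => // k; rewrite expnS leq_pmulr// expn_gt0.
Qed.

Let geom_le t n : 0 < t -> \sum_(1 <= k < n) e t k <= (1 - e t 1)^-1.
Proof.
move=> t0; have q1 := e1_lt1 t0; have q0 := e_ge0 t 1.
apply: (@le_trans _ _ (series (geometric 1 (e t 1)) n)).
  rewrite /series /=; case: n => [|n]; first by rewrite !big_geq.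
  rewrite [leRHS]big_ltn// mul1r expr0; apply: ler_wpDl => //.
  by apply: ler_sum_nat => k _; rewrite mul1r e_le.
rewrite geometric_seriesE ?lt_eqF//= mul1r ler_pdivrMr ?subr_gt0//.
by rewrite mulVf ?gt_eqF ?subr_gt0// gerBl exprn_ge0.
Qed.

Let S_bound t n z : 0 < t -> `|1 + 2 * S t n z| <= B t.
Proof.
move=> t0; apply: le_trans (ler_normD _ _) _; rewrite normr1 lerD2l normrM ger0_norm//.
rewrite ler_pM2l//; apply: le_trans (geom_le n t0).
apply: le_trans (ler_norm_sum _ _ _) _; apply: ler_sum => k _.
by rewrite normrM (ger0_norm (e_ge0 _ _)) ler_piMr// cos_max.
Qed.

Lemma heat_kernel_cvg t z : 0 < t ->
  1 + 2 * S t n z @[n --> \oo] --> heat_kernel t z.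
Proof.
move=> t0; apply: cvgD; first exact: cvg_cst.
apply: cvgMr.
suff : cvgn (fun n => S t n z) by [].
(* [S] starts at index 1 while [series] starts at 0, so a zero term is put in front. *)
pose w k := if k is 0%N then 0 else e t k * cos (2 * pi * k%:R * z).
have -> : (fun n => S t n z) = series w.
  apply/funext => -[|n]; first by rewrite /series /S /= !big_geq.
  rewrite /series /= [RHS]big_ltn//= add0r; apply: eq_big_nat => k /andP[k1 _].
  by case: k k1.
apply: normed_cvg.
apply: (@series_le_cvg _ _ (geometric 1 (e t 1))) => [n|n|n|].
- exact: normr_ge0.
- by rewrite /= mul1r exprn_ge0.
- rewrite /= mul1r; case: n => [|n]; first by rewrite normr0 expr0.
  apply: le_trans (e_le n.+1 t0).
  by rewrite /w normrM (ger0_norm (e_ge0 _ _)) ler_piMr// cos_max.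
- by apply: is_cvg_geometric_series; rewrite ger0_norm// e1_lt1.
Qed.

Lemma heat_kernel_ge0 t z : 0 < t -> 0 <= heat_kernel t z.
Proof.
move=> t0; apply: (@theta_limit_ge0 _ (4 * pi ^+ 2 * t) (2 * pi * z)).
  by apply: mulr_ge0; [apply: mulr_ge0 => //; exact: sqr_ge0|exact: ltW].
have := @heat_kernel_cvg t z t0; apply: cvg_trans; apply: near_eq_cvg; apply: nearW => n.
congr (1 + 2 * _); apply: eq_bigr => k _; rewrite /e; congr (expR _ * cos _); by ring.
Qed.

Lemma heat_kernel_bounded t : 0 < t -> exists C, forall z, `|heat_kernel t z| <= C.
Proof.
move=> t0; exists (B t) => z.
have h : `|1 + 2 * S t n z| @[n --> \oo] --> `|heat_kernel t z|.
  by apply: cvg_norm; exact: heat_kernel_cvg.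
by apply: (cvgr_to_le h); apply: nearW => n; exact: S_bound.
Qed.

Lemma measurable_heat_kernel (D : set (R * R)) : measurable D ->
  (forall p, D p -> 0 < p.1) ->
  measurable_fun D (fun p => heat_kernel p.1 p.2).
Proof.
move=> mD D0; apply: (@measurable_fun_cvg _ _ _ _ (fun n p => 1 + 2 * S p.1 n p.2)).
  move=> n; apply: measurable_funD => //; apply: measurable_funM => //.
  apply: (@measurable_sum _ _ _ _ _ _ (fun k p => e p.1 k * cos (2 * pi * k%:R * p.2))) => k.
  apply: measurable_funTS; apply: measurable_funM.
    apply: measurableT_comp => //; exact: measurable_funM.
  apply: measurableT_comp; last exact: measurable_funM.
  by apply: continuous_measurable_fun; exact: continuous_cos.
by move=> p /D0 p0; exact: heat_kernel_cvg.
Qed.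

Lemma measurable_heat_kernel_slice t : 0 < t -> measurable_fun setT (heat_kernel t).
Proof.
move=> t0; apply: (@measurable_fun_cvg _ _ _ _ (fun n z => 1 + 2 * S t n z)).
  move=> n; apply: measurable_funD => //; apply: measurable_funM => //.
  apply: (@measurable_sum _ _ _ _ _ _ (fun k z => e t k * cos (2 * pi * k%:R * z))) => k.
  apply: measurable_funM => //.
  apply: measurableT_comp; last exact: measurable_funM.
  by apply: continuous_measurable_fun; exact: continuous_cos.
by move=> z _; exact: heat_kernel_cvg.
Qed.

Let cos_periodicN (k : nat) x : sin (x - 2 * pi * k%:R) = sin x.
Proof.
rewrite -[in RHS](subrK (2 * pi * k%:R) x).
have -> : 2 * pi * k%:R = (pi *+ 2) *+ k :> R by rewrite -(mulr_natr (pi *+ 2)) -(mulr_natr pi 2) (mulrC pi).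
by rewrite (periodicn (@sinD2pi R)).
Qed.

Let int_cos (k : nat) x : (0 < k)%N ->
  (\int[leb]_(y in `[0%R, 1%R]) (cos (2 * pi * k%:R * (x - y)))%:E = 0)%E.
Proof.
move=> k0; pose c : R := 2 * pi * k%:R.
have c0 : c != 0 by rewrite gt_eqF// mulr_gt0 ?ltr0n// mulr_gt0// pi_gt0.
pose F y := c^-1 * sin (c * (y - x)).
have dF y : is_derive y (1 : R) F (cos (c * (x - y))).
  have d1 : is_derive y (1 : R) (fun y => c * (y - x)) c.
    have -> : (fun y => c * (y - x)) = c \*: ((id : R -> R) - cst x).
      by apply/funext => s; rewrite !fctE.
    by apply: is_derive_eq; rewrite subr0 /GRing.scale /= mulr1.
  have d2 := @is_derive1_comp _ sin (fun y => c * (y - x)) y _ _ (is_derive_sin _) d1.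
  have -> : F = c^-1 \*: (sin \o (fun y => c * (y - x))) by [].
  apply: is_derive_eq; rewrite /GRing.scale /= mulrCA mulVf// mulr1.
  by rewrite -cosN -mulrN opprB.
have cF : continuous F.
  by move=> y; apply: differentiable_continuous; apply/derivable1_diffP; have [] := dF y.
rewrite (@continuous_FTC2 _ _ F)//.
- rewrite -EFinB /F -mulrBr -(cos_periodicN k (c * (1 - x))) -/c.
  have -> : c * (1 - x) - c = c * (0 - x) by ring.
  by rewrite subrr mulr0.
- apply: continuous_subspaceT => y.
  apply: continuous_comp; last exact: continuous_cos.
  by apply: cvgMr; apply: cvgB => //; exact: cvg_cst.
- split.
  + by move=> y _; have [] := dF y.
  + by apply: cvg_at_right_filter; exact: cF.
  + by apply: cvg_at_left_filter; exact: cF.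
- by move=> y _; rewrite derive1E; have [] := dF y.
Qed.

Let int01 : leb `[0%R, 1%R] = 1%E.
Proof. by rewrite lebesgue_measure_itv /= lte_fin ltr01 oppr0 adde0. Qed.

Lemma continuous_integrable01 f : continuous f ->
  leb.-integrable `[0%R, 1%R] (EFin \o f).
Proof.
move=> cf; apply: continuous_compact_integrable; first exact: segment_compact.
exact: continuous_subspaceT.
Qed.

Lemma heat_kernel_integrable t x f : 0 < t -> continuous f ->
  leb.-integrable `[0%R, 1%R] (EFin \o (fun y => heat_kernel t (x - y) * f y)).
Proof.
move=> t0 cf; have [C hC] := heat_kernel_bounded t0.
have iCf : leb.-integrable `[0%R, 1%R] (fun y => C%:E * (EFin \o f) y)%E.
  by apply: integrableZl => //; exact: continuous_integrable01.
apply: le_integrable iCf => //.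
  apply/measurable_EFinP; apply: measurable_funTS; apply: measurable_funM; last first.
    exact: continuous_measurable_fun.
  apply: measurableT_comp; first exact: measurable_heat_kernel_slice.
  exact: measurable_funB.
move=> y _; rewrite /= lee_fin !normrM ler_wpM2r//.
exact: le_trans (hC _) (ler_norm _).
Qed.

Let S_cvg_integral t x g : 0 < t -> continuous g ->
  (\int[leb]_(y in `[0%R, 1%R]) ((1 + 2 * S t n (x - y)) * g y)%:E)%E @[n --> \oo] -->
  (\int[leb]_(y in `[0%R, 1%R]) (heat_kernel t (x - y) * g y)%:E)%E.
Proof.
move=> t0 cg.
have mS n : measurable_fun setT (fun y => 1 + 2 * S t n (x - y)).
  apply: measurable_funD => //; apply: measurable_funM => //.
  apply: (@measurable_sum _ _ _ _ _ _ (fun k y => e t k * cos (2 * pi * k%:R * (x - y)))) => k.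
  apply: measurable_funM => //.
  apply: measurableT_comp; last by apply: measurable_funM => //; exact: measurable_funB.
  by apply: continuous_measurable_fun; exact: continuous_cos.
have mg : measurable_fun setT g by exact: continuous_measurable_fun.
have iB : leb.-integrable `[0%R, 1%R] (fun y => (B t)%:E * `|(g y)%:E|)%E.
  apply: integrableZl => //; apply: integrable_abse; exact: continuous_integrable01.
have [| | | | | _ _ //] := @dominated_convergence _ _ _ leb `[0%R, 1%R] _
  (fun n y => ((1 + 2 * S t n (x - y)) * g y)%:E)
  (fun y => (heat_kernel t (x - y) * g y)%:E) _ _ _ _ iB.
- by [].
- by move=> n; apply/measurable_EFinP; apply: measurable_funTS;
    apply: measurable_funM; [exact: mS|exact: mg].
- apply/measurable_EFinP; apply: measurable_funTS; apply: measurable_funM => //.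
  apply: measurableT_comp; first exact: measurable_heat_kernel_slice.
  exact: measurable_funB.
- apply: aeW => y _; apply: cvg_EFin; first exact: nearW.
  by apply: cvgMl; exact: heat_kernel_cvg.
- apply: aeW => y n _; rewrite lee_fin normrM; apply: ler_wpM2r => //.
  exact: S_bound.
Qed.

Let cS t n x : continuous (fun y => 1 + 2 * S t n (x - y)).
Proof.
move=> y; apply: cvgD; first exact: cvg_cst.
apply: cvgMr; rewrite /S.
elim: (index_iota 1 n) => [|k s IH].
  by under eq_fun do rewrite big_nil; rewrite big_nil; exact: cvg_cst.
under eq_fun do rewrite big_cons; rewrite big_cons; apply: cvgD => //.
apply: cvgMr; apply: continuous_cvg; first exact: continuous_cos.
by apply: cvgMr; apply: cvgB => //; exact: cvg_cst.
Qed.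

Let ccos (k : nat) x : continuous (fun y => cos (2 * pi * k%:R * (x - y))).
Proof.
move=> y; apply: (@continuous_comp _ _ _ (fun y => 2 * pi * k%:R * (x - y)) cos).
  by apply: cvgMr; apply: cvgB => //; exact: cvg_cst.
exact: continuous_cos.
Qed.

Let S_integral t n x g : continuous g ->
  \int[leb]_(y in `[0%R, 1%R]) ((1 + 2 * S t n (x - y)) * g y) =
  \int[leb]_(y in `[0%R, 1%R]) g y + 2 * \sum_(1 <= k < n) e t k *
    \int[leb]_(y in `[0%R, 1%R]) (cos (2 * pi * k%:R * (x - y)) * g y).
Proof.
move=> cg; elim: n => [|n IH].
  rewrite big_geq// mulr0 addr0; apply: eq_Rintegral => y _.
  by rewrite /S big_geq// mulr0 addr0 mul1r.
case: n IH => [|n] IH.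
  rewrite big_geq// mulr0 addr0; apply: eq_Rintegral => y _.
  by rewrite /S big_geq// mulr0 addr0 mul1r.
have ci1 : continuous (fun y => (1 + 2 * S t n.+1 (x - y)) * g y).
  by move=> y; apply: cvgM; [exact: cS|exact: cg].
have ci2 : continuous (fun y => cos (2 * pi * n.+1%:R * (x - y)) * g y).
  by move=> y; apply: cvgM; [exact: ccos|exact: cg].
have ci3 : continuous (fun y => 2 * e t n.+1 * (cos (2 * pi * n.+1%:R * (x - y)) * g y)).
  by move=> y; apply: cvgMr; exact: ci2.
rewrite big_nat_recr//= mulrDr addrA -IH mulrA.
rewrite -RintegralZl//; last exact: continuous_integrable01.
rewrite -RintegralD//; [|exact: continuous_integrable01|exact: continuous_integrable01].
apply: eq_Rintegral => y _; rewrite /S [in LHS]big_nat_recr//=.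
by ring.
Qed.

Let int_cos_cos (k : nat) x : (0 < k)%N ->
  \int[leb]_(y in `[0%R, 1%R]) (cos (2 * pi * k%:R * (x - y)) * cos (2 * pi * 1%:R * (x - y))) =
  (k == 1%N)%:R / 2.
Proof.
move=> k0.
have cc j : leb.-integrable `[0%R, 1%R] (EFin \o (fun y => cos (2 * pi * j%:R * (x - y)))).
  exact/continuous_integrable01/ccos.
transitivity (2^-1 * \int[leb]_(y in `[0%R, 1%R])
    (cos (2 * pi * k.+1%:R * (x - y)) + cos (2 * pi * k.-1%:R * (x - y)))).
  rewrite -RintegralZl//; last first.
    by apply: continuous_integrable01 => y; apply: cvgD; exact: ccos.
  apply: eq_Rintegral => y _; set z := x - y.
  have -> : 2 * pi * k.+1%:R * z = 2 * pi * k%:R * z + 2 * pi * 1%:R * z.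
    by rewrite -addn1 natrD; ring.
  have -> : 2 * pi * k.-1%:R * z = 2 * pi * k%:R * z - 2 * pi * 1%:R * z.
    by rewrite -subn1 natrB//; ring.
  by rewrite cosD cosB; field.
rewrite RintegralD// {1}/Rintegral int_cos//= add0r.
case: eqVneq => [->/=|k1].
  under eq_Rintegral do rewrite mulr0 mul0r cos0.
  by rewrite Rintegral_cst// [X in fine X]int01 mulr1 mulrC.
rewrite /Rintegral int_cos ?mulr0 ?mul0r//.
by case: k k0 k1 => [//|[]].
Qed.

Lemma heat_kernel_mass t x : 0 < t ->
  (\int[leb]_(y in `[0%R, 1%R]) (heat_kernel t (x - y))%:E = 1)%E.
Proof.
move=> t0; have c1 : continuous (cst 1 : R -> R) by move=> y; exact: cvg_cst.
have h := @S_cvg_integral t x _ t0 c1.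
under eq_integral do rewrite -(mulr1 (heat_kernel _ _)).
apply: (cvg_unique (@ereal_hausdorff R) h).
apply: cvg_near_cst; apply: nearW => n.
rewrite -[LHS]fineK; last first.
  apply: integrable_fin_num => //; apply: continuous_integrable01 => y.
  by apply: cvgM; [exact: cS|exact: cvg_cst].
have E0 : \int[leb]_(y in `[0%R, 1%R]) (cst 1 y : R) = 1.
  by rewrite Rintegral_cst// [X in fine X]int01 mulr1.
have := @S_integral t n x _ c1; rewrite E0 /Rintegral => ->.
rewrite big_nat big1 ?mulr0 ?addr0// => k /andP[k1 _].
by under eq_integral do rewrite mulr1; rewrite int_cos//= mulr0.
Qed.

(** The first mode is an eigenfunction. With the mass it is the only explicit integral that
    [heat_korovkin] asks for. *)
Lemma heat_kernel_cos t x : 0 < t ->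
  (\int[leb]_(y in `[0%R, 1%R]) (heat_kernel t (x - y) * cos (2 * pi * (x - y)))%:E =
   (expR (- (2 * pi) ^+ 2 * t))%:E)%E.
Proof.
move=> t0; have c1 := @ccos 1 x.
have h := @S_cvg_integral t x _ t0 c1.
under eq_integral do rewrite -(mulr1 (2 * pi)).
apply: (cvg_unique (@ereal_hausdorff R) h).
apply: cvg_near_cst; near=> n.
have n1 : (1 < n)%N by near: n; exists 2%N.
rewrite -[LHS]fineK; last first.
  apply: integrable_fin_num => //; apply: continuous_integrable01 => y.
  by apply: cvgM; [exact: cS|exact: ccos].
have := @S_integral t n x _ c1; rewrite {1}/Rintegral => ->.
rewrite {1}/Rintegral int_cos//= add0r big_ltn// big_nat big1 => [|k /andP[k1 _]].
  by rewrite addr0 int_cos_cos// eqxx/= mul1r /e mulr1; congr EFin; field.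
by rewrite int_cos_cos// ?(ltn_trans _ k1)// gtn_eqF// mul0r mulr0.
Unshelve. all: by end_near.
Qed.

End heat_kernel_theory.

(** Jensen's inequality for the fourth power in the form needed for averages: the tangent at [c],
    kept as a constant plus a multiple of [a] so that a linear operator can be applied to it term by
    term. *)
Lemma expr4_tangent (R : realFieldType) (c a : R) :
  c ^+ 4 - 4 * c ^+ 3 * c + 4 * c ^+ 3 * a <= a ^+ 4.
Proof.
rewrite -subr_ge0; have -> : a ^+ 4 - (c ^+ 4 - 4 * c ^+ 3 * c + 4 * c ^+ 3 * a) =
  (a - c) ^+ 2 * ((a + c) ^+ 2 + c ^+ 2 *+ 2) by rewrite mulr2n; ring.
by rewrite mulr_ge0 ?sqr_ge0// addr_ge0 ?mulrn_wge0 ?sqr_ge0.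
Qed.

(** * The heat flow as a positive operator *)

Section heat_operator.
Variable R : realType.
Local Notation leb := (@lebesgue_measure R).
Implicit Types (t x y : R) (f g : R -> R).

Let int01 : leb `[0%R, 1%R] = 1%E.
Proof. by rewrite lebesgue_measure_itv /= lte_fin ltr01 oppr0 adde0. Qed.

Lemma heatE t f x : 0 < t ->
  heat t f x = \int[leb]_(y in `[0, 1]) (heat_kernel t (x - y) * f y).
Proof. by move=> t0; rewrite /heat leNgt t0. Qed.

Lemma heat_le t f g x : continuous f -> continuous g -> (forall y, f y <= g y) ->
  heat t f x <= heat t g x.
Proof.
move=> cf cg fg; have [t0|t0] := leP t 0; first by rewrite /heat t0.
rewrite !heatE//; apply: le_Rintegral => //; [exact: heat_kernel_integrable|exact: heat_kernel_integrable|].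
by move=> y _; rewrite ler_wpM2l// heat_kernel_ge0.
Qed.

Lemma heatD t f g x : continuous f -> continuous g ->
  heat t (fun y => f y + g y) x = heat t f x + heat t g x.
Proof.
move=> cf cg; have [t0|t0] := leP t 0; first by rewrite /heat t0.
rewrite !heatE// -RintegralD//; [|exact: heat_kernel_integrable|exact: heat_kernel_integrable].
by apply: eq_Rintegral => y _; rewrite mulrDr.
Qed.

Lemma heatZ t (a : R) f x : continuous f ->
  heat t (fun y => a * f y) x = a * heat t f x.
Proof.
move=> cf; have [t0|t0] := leP t 0; first by rewrite /heat t0.
rewrite !heatE// -RintegralZl//; last exact: heat_kernel_integrable.
by apply: eq_Rintegral => y _; rewrite mulrCA.
Qed.

Lemma heat_cst t (a : R) x : heat t (fun=> a) x = a.
Proof.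
have [t0|t0] := leP t 0; first by rewrite /heat t0.
rewrite heatE//; under eq_Rintegral do rewrite mulrC.
have i1 : leb.-integrable `[0%R, 1%R] (EFin \o (fun y => heat_kernel t (x - y))).
  apply: eq_integrable (@heat_kernel_integrable _ t x (cst 1) t0 _) => //.
    by move=> y _ /=; rewrite mulr1.
  by move=> y; exact: cvg_cst.
by rewrite RintegralZl// /Rintegral heat_kernel_mass// mulr1.
Qed.

Lemma heat_norm_le t f x (M : R) : continuous f -> (forall y, `|f y| <= M) ->
  `|heat t f x| <= M.
Proof.
move=> cf fM; have cc (a : R) : continuous (fun _ : R => a) by move=> y; exact: cvg_cst.
rewrite ler_norml -(heat_cst t (- M) x) -[X in _ && (_ <= X)](heat_cst t M x).
by apply/andP; split; apply: heat_le => // y; have := fM y; rewrite ler_norml => /andP[].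
Qed.

Lemma heat_expr4_le t f x : continuous f ->
  heat t f x ^+ 4 <= heat t (fun y => f y ^+ 4) x.
Proof.
move=> cf; set c := heat t f x.
have cf4 : continuous (fun y => f y ^+ 4).
  move=> y; apply: (@continuous_comp _ _ _ f (fun u => u ^+ 4)); first exact: cf.
  exact: exprn_continuous.
have caff : continuous (fun y => c ^+ 4 - 4 * c ^+ 3 * c + 4 * c ^+ 3 * f y).
  by move=> y; apply: cvgD; [exact: cvg_cst|apply: cvgMr; exact: cf].
have cc : continuous (fun y : R => c ^+ 4 - 4 * c ^+ 3 * c) by move=> y; exact: cvg_cst.
have ccf : continuous (fun y => 4 * c ^+ 3 * f y) by move=> y; apply: cvgMr; exact: cf.
have -> : c ^+ 4 = heat t (fun y => c ^+ 4 - 4 * c ^+ 3 * c + 4 * c ^+ 3 * f y) x.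
  by rewrite heatD// heat_cst heatZ// -/c; ring.
apply: heat_le => // y; exact: expr4_tangent.
Qed.

(** Korovkin's principle: the heat flow is positive, fixes constants and has an explicit value on
    the cosine, so a pointwise bound by [e + K * (1 - cos _)] can be integrated exactly. At [t = 0]
    the flow is the identity by convention and the bound is read at [y = x]. *)
Lemma heat_korovkin t f x (c e K : R) : 0 <= t -> continuous f ->
  (forall y, `|f y - c| <= e + K * (1 - cos (2 * pi * (x - y)))) ->
  `|heat t f x - c| <= e + K * (1 - expR (- (2 * pi) ^+ 2 * t)).
Proof.
move=> t0 cf fc; have [t0'|t_gt0] := leP t 0.
  have -> : t = 0 by apply/le_anti; rewrite t0 t0'.
  rewrite /heat lexx mulr0 expR0 subrr mulr0 addr0.
  by have := fc x; rewrite subrr mulr0 cos0 subrr mulr0 addr0.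
pose g y := cos (2 * pi * (x - y)).
have cg : continuous g.
  move=> y; apply: (@continuous_comp _ _ _ (fun y => 2 * pi * (x - y)) cos).
    by apply: cvgMr; apply: cvgB => //; exact: cvg_cst.
  exact: continuous_cos.
have cZ (a : R) : continuous (fun y => a * g y) by move=> y; apply: cvgMr; exact: cg.
have cc (a : R) : continuous (fun _ : R => a) by move=> y; exact: cvg_cst.
have cD (a b : R) : continuous (fun y => a + b * g y).
  by move=> y; apply: cvgD; [exact: cc|exact: cZ].
have hg (a b : R) : heat t (fun y => a + b * g y) x = a + b * expR (- (2 * pi) ^+ 2 * t).
  rewrite heatD// heat_cst heatZ// heatE// /g /Rintegral heat_kernel_cos//.
rewrite ler_distl; apply/andP; split.
  have -> : c - (e + K * (1 - expR (- (2 * pi) ^+ 2 * t))) =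
      (c - e - K) + K * expR (- (2 * pi) ^+ 2 * t) by ring.
  rewrite -hg; apply: heat_le => // y.
  by have := fc y; rewrite ler_distl -/(g y) => /andP[+ _]; lra.
have -> : c + (e + K * (1 - expR (- (2 * pi) ^+ 2 * t))) =
    (c + e + K) + - K * expR (- (2 * pi) ^+ 2 * t) by ring.
rewrite -hg; apply: heat_le => // y.
by have := fc y; rewrite ler_distl -/(g y) => /andP[_]; lra.
Qed.

Lemma periodicZ (g : R -> R) (k : int) y : Defs.periodic g -> g (y + k%:~R) = g y.
Proof.
move=> pg; have gN n z : g (z + n%:R) = g z.
  elim: n => [|n IH]; first by rewrite addr0.
  by rewrite -natr1 addrA pg.
case: k => n; first exact: gN.
by rewrite NegzE mulrNz -[LHS](gN n.+1) subrK.
Qed.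

(** Close to [x] continuity gives [e]; at distance at least [d] the cosine term is bounded below,
    and [K] is large enough to pay for twice the sup norm. *)
Lemma periodic_le_cos (f : CT R) x (e : R) : 0 < e ->
  exists2 K, 0 <= K & forall y, `|f y - f x| <= e + K * (1 - cos (2 * pi * (x - y))).
Proof.
move=> e0.
have : \forall y \near x, `|f x - f y| < e by have /cvgrPdist_lt := @CT_continuous R f x; apply.
move=> /nbhs_ballP[d0 /= d0_gt0 hd0].
(* The cap 1/2 keeps [2 * pi * d] in [0, pi], where the cosine decreases. *)
pose d := Num.min d0 (1 / 2); have d_gt0 : 0 < d by rewrite lt_min d0_gt0/=.
have d_le : d <= 1 / 2 by rewrite /d ge_min lexx orbT.
have pi0 := pi_gt0 R.
have cd : 0 < 1 - cos (2 * pi * d).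
  rewrite subr_gt0 -[ltRHS](@cos0 R) ltr_cos ?in_itv/=; last 2 first.
  - by rewrite lexx ltW.
  - by apply/andP; split; nra.
  - by nra.
pose M := CT_norm f; have M0 : 0 <= M by exact: le_trans (CT_le_norm f 0).
exists (2 * M / (1 - cos (2 * pi * d))).
  by rewrite divr_ge0 ?(ltW cd)// mulr_ge0.
(* The nearest integer to [y - x]: subtracting it moves [y] within half a period of [x]. *)
move=> y; pose k := Num.floor (y - x + 1 / 2).
pose y' := y - k%:~R.
have y'E : y = y' + k%:~R by rewrite subrK.
have y'x : `|y' - x| <= 1 / 2.
  have h1 := Num.Theory.floor_le_tmp (y - x + 1 / 2).
  have h2 := Num.Theory.floorD1_gt (y - x + 1 / 2).
  rewrite intrD -/k in h1 h2; rewrite ler_norml /y'; lra.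
have fy : f y = f y' by rewrite y'E periodicZ//; exact: CT_periodic.
have cy : cos (2 * pi * (x - y)) = cos (2 * pi * (x - y')).
  rewrite y'E; apply: (periodicZ (g := fun z => cos (2 * pi * (x - z)))) => z.
  have -> : 2 * pi * (x - z) = 2 * pi * (x - (z + 1)) + pi *+ 2 by rewrite -mulr_natr; ring.
  by rewrite cosD2pi.
rewrite fy cy.
have K0 : 0 <= 2 * M / (1 - cos (2 * pi * d)) by rewrite divr_ge0 ?(ltW cd)// mulr_ge0.
have c1 : 0 <= 1 - cos (2 * pi * (x - y')) by rewrite subr_ge0 cos_le1.
have [near|far] := ltP `|y' - x| d.
  apply: ler_wpDr; first exact: mulr_ge0.
  rewrite distrC ltW//; apply: hd0; rewrite /ball /= distrC.
  by apply: lt_le_trans near _; rewrite /d ge_min lexx.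
apply: ler_wpDl; first exact: ltW.
apply: (@le_trans _ _ (2 * M)).
  apply: le_trans (ler_normB _ _) _.
  by have := CT_le_norm f y'; have := CT_le_norm f x; rewrite -/M; lra.
rewrite mulrAC ler_pdivlMr// ler_wpM2l ?mulr_ge0// lerD2l lerN2.
rewrite -(cos_norm (2 * pi * (x - y'))) normrM (@ger0_norm _ (2 * pi)) ?mulr_ge0 ?pi_ge0// distrC.
rewrite le_eqVlt; have [->|ne] := eqVneq d `|y' - x|; first by rewrite eqxx.
rewrite ltr_cos ?in_itv/=; last 2 first.
- by apply/andP; split; nra.
- by apply/andP; split; nra.
by rewrite ltr_pM2l ?mulr_gt0// lt_neqAle ne far orbT.
Qed.

End heat_operator.

(** * The drift along continuous paths *)

Section joint_measurability.
Variable R : realType.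

(** The paths are controlled on [0, 1] only. Composition with this retraction makes them continuous
    on the whole line, so that measurability can be stated on full product spaces. *)
Definition clip01 (s : R) : R := Num.max 0 (Num.min 1 s).

Lemma clip01_itv s : 0 <= clip01 s <= 1.
Proof. by rewrite /clip01 le_max lexx/= ge_max ler01 ge_min lexx. Qed.

Lemma clip01_id s : 0 <= s <= 1 -> clip01 s = s.
Proof. by move=> /andP[s0 s1]; rewrite /clip01 min_r// max_r. Qed.

Lemma continuous_clip01 : continuous clip01.
Proof.
move=> x; apply: (@continuous_max R R (cst 0) (fun x => Num.min 1 x)); first exact: cvg_cst.
apply: (@continuous_min R R (cst 1) (fun x : R => x)); first exact: cvg_cst.
exact: cvg_id.
Qed.

Lemma measurable_clip01 : measurable_fun setT clip01.
Proof. exact: continuous_measurable_fun continuous_clip01. Qed.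

Lemma within_continuous_clip01 (V : topologicalType) (f : R -> V) :
  {within `[0, 1], continuous f} -> continuous (f \o clip01).
Proof.
move=> cf s A fA.
have c01 : `[0, 1]%classic (clip01 s) by rewrite /= in_itv/= clip01_itv.
have hA := cf (clip01 s) A fA.
have E := @nbhs_subspace_in R (`[0%R, 1%R]%classic : set R) (clip01 s) c01.
have {}hA : within (`[0%R, 1%R]%classic : set R) (nbhs (clip01 s)) (f @^-1` A).
  by rewrite E; exact: hA.
have := @continuous_clip01 s _ hA => {}hA.
have {}hA : nbhs s (fun s' => `[0%R, 1%R]%classic (clip01 s') -> A (f (clip01 s'))) := hA.
suff : nbhs s (fun s' => A (f (clip01 s'))) by [].
by move: hA; apply: filterS => s'; apply; rewrite /= in_itv/= clip01_itv.
Qed.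

(** A function measurable in one variable and continuous in the other is a limit of its
    discretisations in the continuous variable, whose preimages are countable unions of
    rectangles. *)
Lemma caratheodory_measurable d (T : measurableType d) (f : R -> T -> R) :
  (forall s, 0 <= s <= 1 -> measurable_fun setT (f s)) ->
  (forall w, {within `[0, 1], continuous (fun s => f s w)}) ->
  measurable_fun setT (fun p : T * R => f (clip01 p.2) p.1).
Proof.
move=> mf cf.
pose g n (s : R) := Num.truncn (clip01 s * n.+1%:R).
(* The outer [clip01] keeps the grid point in [0, 1] for every index of the countable union below,
   where [f] is known to be measurable. *)
pose h n (p : T * R) := f (clip01 ((g n p.2)%:R / n.+1%:R)) p.1.
have mg n k : measurable [set s | g n s = k].
  have -> : [set s | g n s = k] = (fun s => clip01 s * n.+1%:R) @^-1` `[k%:R, k.+1%:R[.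
    apply/seteqP; split => s /=; rewrite in_itv/=.
      by move=> <-; apply: Num.Theory.truncn_itv; rewrite mulr_ge0//; have /andP[] := clip01_itv s.
    by move=> /Num.Theory.truncn_def.
  rewrite -[X in measurable X]setTI.
  have mcl : measurable_fun setT (fun s => clip01 s * n.+1%:R).
    by apply: measurable_funM => //; exact: measurable_clip01.
  by apply: mcl => //; exact: measurable_itv.
apply: (@measurable_fun_cvg _ _ _ _ h).
  move=> n _ B mB; rewrite setTI.
  have -> : h n @^-1` B = \bigcup_k ((f (clip01 (k%:R / n.+1%:R)) @^-1` B) `*` [set s | g n s = k]).
    apply/seteqP; split => [[w s] /= Bh|[w s] [k _ [/= Bf gk]]].
      by exists (g n s).
    by rewrite /h /= gk.
  apply: bigcupT_measurable => k; apply: measurableX => //.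
  rewrite -[X in measurable X]setTI; apply: mf => //; exact: clip01_itv.
move=> [w s] _ /=; rewrite /h /=.
have cfw := within_continuous_clip01 (cf w).
have -> : f (clip01 s) w = f (clip01 (clip01 s)) w by rewrite (clip01_id (clip01_itv s)).
suff gs : (g n s)%:R / n.+1%:R @[n --> \oo] --> clip01 s by exact: (cvg_comp _ _ gs (cfw _)).
apply/cvgrPdist_le => e e0; near=> n.
have c0 : 0 <= clip01 s by have /andP[] := clip01_itv s.
have /andP[h1 h2] : (g n s)%:R <= clip01 s * n.+1%:R < (g n s).+1%:R.
  by apply: Num.Theory.truncn_itv; rewrite mulr_ge0.
have n0 : 0 < n.+1%:R :> R by [].
have e1 : n.+1%:R^-1 <= e.
  near: n; have /cvgrPdist_le /(_ e e0) := @cvg_harmonic R; apply: filterS => n /=.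
  by rewrite sub0r normrN ger0_norm.
have d0 : 0 <= clip01 s - (g n s)%:R / n.+1%:R.
  by rewrite subr_ge0 ler_pdivrMr.
rewrite ger0_norm//; apply: le_trans e1.
rewrite -(ler_pM2r n0) mulVf ?gt_eqF// mulrBl divfK ?gt_eqF//.
by rewrite lerBlDl natr1 ltW.
Unshelve. all: by end_near.
Qed.

End joint_measurability.

(** * Random paths with values in the continuous functions *)

Section CT_valued.
Variable R : realType.

Lemma CT_eval_continuous (y : R) : continuous (fun u : CT R => u y).
Proof.
move=> u A /nbhs_ballP[e /= e0 hA]; apply/nbhs_ballP; exists e => // v uv.
apply: hA; move: uv; rewrite -!ball_normE /= => uv.
by apply: le_lt_trans uv; exact: (CT_le_norm (u - v) y).
Qed.

Lemma CT_norm_continuous : continuous (fun u : CT R => `|u|).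
Proof.
move=> u A /nbhs_ballP[e /= e0 hA]; apply/nbhs_ballP; exists e => // v uv.
apply: hA; move: uv; rewrite -!ball_normE /= => uv.
by apply: le_lt_trans uv; exact: ler_dist_dist.
Qed.

Lemma CT_dist_continuous (a : CT R) : continuous (fun u : CT R => `|u - a|).
Proof.
move=> u A /nbhs_ballP[e /= e0 hA]; apply/nbhs_ballP; exists e => // v uv.
apply: hA; move: uv; rewrite -!ball_normE /= => uv.
by apply: le_lt_trans uv; apply: le_trans (ler_dist_dist _ _) _; rewrite opprB addrA subrK.
Qed.

Lemma CT_within_continuous_comp (g : CT R -> R) (v : R -> CT R) : continuous g ->
  {within `[0, 1], continuous v} -> {within `[0, 1], continuous (g \o v)}.
Proof. by move=> cg cv s A gA; exact: (cv s _ (cg _ _ gA)). Qed.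

Lemma CT_continuous_measurable (g : CT R -> R) : continuous g -> measurable_fun setT g.
Proof.
move=> /continuousP cg; apply: (measurability _ (RGenOpens.measurableE R)).
move=> _ [_ [a [b ->] <-]]; rewrite setTI; apply: sub_sigma_algebra.
exact/cg/interval_open.
Qed.

(** The preceding principle applied twice, first in time and then in space. *)
Lemma CT_joint_measurable d (T : measurableType d) (U : R -> T -> CT R) :
  (forall s, 0 <= s <= 1 -> measurable_fun setT (U s)) ->
  (forall w, {within `[0, 1], continuous (fun s => U s w)}) ->
  measurable_fun setT (fun p : (T * R) * R => U (clip01 p.1.2) p.1.1 (clip01 p.2)).
Proof.
move=> mU cU.
apply: (@caratheodory_measurable _ _ _ (fun y p => U (clip01 p.2) p.1 y)).
  move=> y y01; apply: (@caratheodory_measurable _ _ _ (fun s w => U s w y)).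
    move=> s s01; apply: (@measurableT_comp _ _ _ _ _ _ (fun u : CT R => u y)); last exact: mU.
    by apply: CT_continuous_measurable; exact: CT_eval_continuous.
  by move=> w; apply: (CT_within_continuous_comp (g := fun u => u y)) (cU w); exact: CT_eval_continuous.
move=> p; apply: continuous_subspaceT; exact: CT_continuous.
Qed.

Lemma CT_path_bounded (v : R -> CT R) : {within `[0, 1], continuous v} ->
  exists2 L, 0 <= L & forall s y, 0 <= s <= 1 -> `|v s y| <= L.
Proof.
move=> cv; have cn := CT_within_continuous_comp CT_norm_continuous cv.
have [c _ hc] := EVT_max ler01 cn.
exists `|v c| => // s y s01; apply: le_trans (hc s _); first exact: CT_le_norm.
by rewrite in_itv.
Qed.

Lemma CT_horner_continuous (P : {poly R}) (u : CT R) : continuous (fun y => P.[u y]).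
Proof.
move=> y; apply: (@continuous_comp _ _ _ u (horner P)); first exact: CT_continuous.
exact: continuous_horner.
Qed.

Lemma CT_horner (P : {poly R}) (u : CT R) : exists g : CT R, forall y, g y = P.[u y].
Proof.
have h : (fun y => P.[u y]) \in @CT_pred R.
  apply/asboolP; split; first exact: CT_horner_continuous.
  by move=> y; rewrite (CT_periodic u).
by exists (MkCT h).
Qed.

Lemma poly_lipschitz (P : {poly R}) (L : R) : 0 <= L ->
  exists2 K, 0 <= K & forall a b, `|a| <= L -> `|b| <= L ->
    `|P.[a] - P.[b]| <= K * `|a - b|.
Proof.
move=> L0; elim/poly_ind: P => [|P c [K K0 IH]].
  by exists 0 => // a b _ _; rewrite !horner0 subrr normr0 mul0r.
have [C C0 hC] := poly_le_cosh P.
exists (K * L + C * (expR L + expR L)).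
  by rewrite addr_ge0 ?mulr_ge0// addr_ge0 ?expR_ge0.
move=> a b aL bL; rewrite !hornerMXaddC.
have -> : P.[a] * a + c - (P.[b] * b + c) = (P.[a] - P.[b]) * a + P.[b] * (a - b) by ring.
apply: le_trans (ler_normD _ _) _; rewrite !normrM mulrDl; apply: lerD.
  rewrite mulrAC; apply: ler_pM => //; exact: IH.
apply: ler_wpM2r => //; apply: le_trans (hC b) _; rewrite ler_wpM2l// lerD// ler_expR.
  exact: le_trans (ler_norm _) bL.
by apply: le_trans bL; rewrite -normrN; exact: ler_norm.
Qed.

End CT_valued.

(** * The time integral of the drift *)

Section drift.
Variable R : realType.
Local Notation leb := (@lebesgue_measure R).

Lemma integral01_indic (f : R -> R) :
  (\int[leb]_(y in `[0%R, 1%R]) (f y)%:E = \int[leb]_y (f y * \1_`[0%R, 1%R] y)%:E)%E.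
Proof.
rewrite integral_mkcond; apply: eq_integral => y _; rewrite patchE indicE.
by case: ifP => _; rewrite ?mulr1 ?mulr0.
Qed.

Lemma measurable_duhamel_kernel (t x : R) : measurable_fun setT (duhamel_kernel t x).
Proof.
rewrite /duhamel_kernel; apply: measurable_fun_if => //.
- by apply: measurable_and; apply: measurable_fun_ltr.
- rewrite setTI.
  have mA : measurable ((fun z : R * R => 0 < z.1 < t) @^-1` [set true]).
    rewrite -[X in measurable X]setTI.
    have m1 : measurable_fun setT (fun z : R * R => 0 < z.1 < t).
      by apply: measurable_and; apply: measurable_fun_ltr.
    exact: m1.
  have mm : measurable_fun setT (fun z : R * R => (t - z.1, x - z.2)).
    apply/measurable_fun_pairP; split => /=.
      by apply: measurable_funB.
    by apply: measurable_funB.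
  have mpos : measurable [set p : R * R | 0 < p.1].
    rewrite (_ : [set p | _] = `]0, +oo[ `*` setT); first exact: measurableX.
    by apply/seteqP; split => [[a b]|[a b]] /=; rewrite in_itv/= andbT; [|case].
  have mk := measurable_heat_kernel mpos (fun p hp => hp).
  have im : (fun z : R * R => (t - z.1, x - z.2)) @` ((fun z : R * R => 0 < z.1 < t) @^-1` [set true])
      `<=` [set p : R * R | 0 < p.1].
    by move=> _ [[s y] /= /andP[s0 st] <-]; rewrite /= subr_gt0.
  exact: (measurable_comp mpos im mk (measurable_funTS mm)).
Qed.

Lemma duhamel_kernel_ge0 (t x : R) z : 0 <= duhamel_kernel t x z.
Proof.
rewrite /duhamel_kernel; case: ifP => // /andP[_ h].
by apply: heat_kernel_ge0; rewrite subr_gt0.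
Qed.

Lemma integral_duhamel_kernel (t x s : R) g : 0 < s < t -> continuous g ->
  (\int[leb]_(y in `[0%R, 1%R]) (duhamel_kernel t x (s, y) * g y)%:E = (heat (t - s) g x)%:E)%E.
Proof.
move=> /andP[s0 st] cg; have ts : 0 < t - s by rewrite subr_gt0.
rewrite heatE// /Rintegral fineK.
  by apply: eq_integral => y _; rewrite /duhamel_kernel /= s0 st.
by apply: integrable_fin_num => //; exact: heat_kernel_integrable.
Qed.

Section path.
Variables (v : R -> CT R) (cv : {within `[0, 1], continuous v}) (Q : {poly R}) (x : R).
Let H t s := heat (t - s) (fun y => Q.[v s y]) x.

Let chorner s : continuous (fun y => Q.[v s y]).
Proof.
exact: CT_horner_continuous.
Qed.

Lemma measurable_path_horner : measurable_fun setT (fun p : R * R => Q.[v (clip01 p.1) p.2]).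
Proof.
apply: (measurableT_comp (f := horner Q)).
  by apply: continuous_measurable_fun; exact: continuous_horner.
have h : measurable_fun setT (fun p : R * R => v (clip01 p.2) p.1).
  apply: (@caratheodory_measurable _ _ _ (fun s y => v s y)).
    by move=> s _; apply: continuous_measurable_fun; exact: CT_continuous.
  move=> y; apply: (CT_within_continuous_comp (g := fun u => u y)) cv.
  exact: CT_eval_continuous.
have sw : measurable_fun setT (fun p : R * R => (p.2, p.1)).
  by apply/measurable_fun_pairP; split; [exact: measurable_snd|exact: measurable_fst].
exact: (measurableT_comp h sw).
Qed.

Lemma path_horner_bounded : exists2 M, 0 <= M & forall s y, 0 <= s <= 1 -> `|Q.[v s y]| <= M.
Proof.
have [L L0 hL] := CT_path_bounded cv.
have [K K0 hK] := poly_lipschitz Q L0.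
exists (K * L + `|Q.[0]|); first by rewrite addr_ge0// mulr_ge0.
move=> s y s01; rewrite -(subrK Q.[0] Q.[v s y]); apply: le_trans (ler_normD _ _) _.
rewrite lerD2r; apply: le_trans (hK _ _ (hL _ _ s01) _) _; first by rewrite normr0.
by rewrite subr0 ler_wpM2l// hL.
Qed.

Lemma heat_path_integrable t : 0 < t <= 1 ->
  leb.-integrable `]0, t[ (EFin \o H t).
Proof.
move=> /andP[t0 t1]; have [M M0 hM] := path_horner_bounded.
have i01 s : `]0, t[%classic s -> 0 <= s <= 1.
  by rewrite /= in_itv/= => /andP[/ltW-> /ltW/le_trans]; apply.
apply: measurable_bounded_integrable => //.
- by rewrite /= lebesgue_measure_itv/= lte_fin t0 -EFinB ltry.
(* Tonelli gives measurability in [s] for nonnegative integrands, so the bound [M] is added to [Q]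
   and subtracted afterwards; the heat flow fixes constants. *)
- pose f (p : R * R) := (duhamel_kernel t x p * (Q.[v (clip01 p.1) p.2] + M) * \1_`[0%R, 1%R] p.2)%:E.
  have mf : measurable_fun setT f.
    apply/measurable_EFinP; apply: measurable_funM.
      apply: measurable_funM; first exact: measurable_duhamel_kernel.
      by apply: measurable_funD => //; exact: measurable_path_horner.
    have mi : measurable_fun setT (\1_`[0%R, 1%R] : R -> R) by exact: measurable_indic.
    exact: (measurableT_comp mi measurable_snd).
  have f0 p : (0 <= f p)%E.
    rewrite lee_fin mulr_ge0// mulr_ge0 ?duhamel_kernel_ge0//.
    have := hM (clip01 p.1) p.2 (clip01_itv _); rewrite ler_norml => /andP[+ _].
    by rewrite -subr_ge0 opprK.
  have mF := measurable_fun_fubini_tonelli_F (m2 := leb) f mf f0.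
  apply/measurable_EFinP.
  apply: (@eq_measurable_fun _ _ _ _ _ (fun s => fubini_F leb f s - M%:E)%E).
    move=> s; rewrite inE => hs; have s01 := i01 _ hs; rewrite /= in_itv/= in hs.
    rewrite /fubini_F /f /= -(integral01_indic (fun y => duhamel_kernel t x (s, y) * (Q.[v (clip01 s) y] + M))).
    rewrite clip01_id// integral_duhamel_kernel//; last first.
      by move=> y; apply: cvgD; [exact: chorner|exact: cvg_cst].
    rewrite heatD//; last by move=> y; exact: cvg_cst.
    by rewrite heat_cst -EFinB addrK.
  by apply: measurable_funTS; apply: emeasurable_funB.
- exists M; split; first exact: num_real.
  move=> M' MM' s /i01 s01 /=; apply: le_trans (ltW MM').
  by apply: heat_norm_le => // y; exact: hM.
Qed.

Lemma drift_itv t : 0 < t <= 1 ->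
  \int[leb]_(s in `[0, t]) H t s = \int[leb]_(s in `]0, t[) H t s.
Proof.
move=> t01; have i := heat_path_integrable t01.
have m0 : measurable_fun `]0%R, t[ (EFin \o H t) by apply: measurable_int i.
have m1 : measurable_fun `[0%R, t[ (EFin \o H t) by exact/emeasurable_fun_itv_obnd_cbndP.
by rewrite /Rintegral -integral_itv_bndo_bndc// -integral_itv_obnd_cbnd.
Qed.

End path.

Lemma itv_integrable_cst (t c : R) : 0 < t -> leb.-integrable `]0, t[ (EFin \o (fun=> c)).
Proof.
move=> t0; apply: measurable_bounded_integrable => //; last exact: bounded_cst.
by rewrite /= lebesgue_measure_itv/= lte_fin t0 -EFinB ltry.
Qed.

Lemma itv_Rintegral_cst (t c : R) : 0 < t -> \int[leb]_(s in `]0, t[) c = c * t.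
Proof. by move=> t0; rewrite Rintegral_cst//= lebesgue_measure_itv/= lte_fin t0 -EFinB subr0. Qed.

(** Jensen twice: for the time average over ]0, t[ and for the heat kernel in space. The right-hand
    side is spread over the whole plane, with clipped arguments and cut-offs, so that it is jointly
    measurable once [v] is random. *)
Lemma drift_expr4_le (v : R -> CT R) (Q : {poly R}) (x t : R) :
  {within `[0, 1], continuous v} -> 0 < t <= 1 ->
  ((((\int[leb]_(s in `[0, t]) heat (t - s) (fun y => Q.[v s y]) x) / t) ^+ 4)%R%:E <=
  (t^-1)%:E * \int[leb]_s \int[leb]_y
    (duhamel_kernel t x (s, y) * Q.[v (clip01 s) (clip01 y)] ^+ 4 * \1_`[0%R, 1%R] y)%:E)%E.
Proof.
move=> cv t01; have /andP[t0 t1] := t01; rewrite drift_itv//.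
set N := \int[leb]_(s in _) _; set c := N / t.
pose H4 s := heat (t - s) (fun y => (Q ^+ 4).[v s y]) x.
have iH := heat_path_integrable cv Q x t01.
have iH4 := heat_path_integrable cv (Q ^+ 4) x t01.
have cQ s : continuous (fun y => Q.[v s y]).
  exact: CT_horner_continuous.
pose a := c ^+ 4 - 4 * c ^+ 3 * c.
have iZ : leb.-integrable `]0, t[ (EFin \o (fun s => 4 * c ^+ 3 * heat (t - s) (fun y => Q.[v s y]) x)).
  have iZ' : leb.-integrable `]0, t[ (fun s => (4 * c ^+ 3)%:E *
      (EFin \o (fun s => heat (t - s) (fun y => Q.[v s y]) x)) s)%E.
    by apply: integrableZl.
  exact: iZ'.
have ia := itv_integrable_cst a t0.
have h : c ^+ 4 * t <= \int[leb]_(s in `]0, t[) H4 s.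
  have -> : c ^+ 4 * t = \int[leb]_(s in `]0, t[) (a + 4 * c ^+ 3 * heat (t - s) (fun y => Q.[v s y]) x).
    rewrite RintegralD// itv_Rintegral_cst// RintegralZl// -/N.
    have -> : N = c * t by rewrite /c divfK// gt_eqF.
    by rewrite /a; ring.
  apply: le_Rintegral => //; 
    have mI : measurable (`]0%R, t[%classic : set R) by [].
    have iD := @integrableD _ _ _ leb _ mI _ _ ia iZ.
    exact: iD.
  move=> s _; apply: le_trans (expr4_tangent c _) _; apply: le_trans (heat_expr4_le _ _ (cQ s)) _.
  rewrite le_eqVlt; apply/orP; left; apply/eqP; rewrite /H4; congr (heat _ _ _).
  by apply/funext => y; rewrite horner_exp.
have -> : (\int[leb]_s \int[leb]_y
    (duhamel_kernel t x (s, y) * Q.[v (clip01 s) (clip01 y)] ^+ 4 * \1_`[0%R, 1%R] y)%:E =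
    (\int[leb]_(s in `]0%R, t[) H4 s)%:E)%E.
  rewrite /Rintegral fineK; last exact: integrable_fin_num.
  rewrite [RHS]integral_mkcond; apply: eq_integral => s _; rewrite patchE.
  case: ifPn; rewrite ?inE ?notin_setE /= in_itv/= => hs.
    rewrite -integral_duhamel_kernel//; last first.
      exact: CT_horner_continuous.
    rewrite integral01_indic; apply: eq_integral => y _; congr (_%:E); rewrite indicE.
    case: (boolP (y \in _)); rewrite ?mulr0// inE/= in_itv/= => y01.
    rewrite horner_exp !clip01_id//.
    by move: hs => /andP[/ltW-> /ltW/le_trans]; apply.
  rewrite integral0_eq// => y _; rewrite /duhamel_kernel /=.
  by case: ifPn hs => // _ _; rewrite !mul0r.
rewrite -EFinM lee_fin -(ler_pM2r t0); apply: le_trans h _.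
by rewrite mulrAC mulVf ?mul1r// gt_eqF.
Qed.

Lemma korovkin_term_cvg (K : R) (r : nat -> R) : r k @[k --> \oo] --> 0 ->
  K * (1 - expR (- (2 * pi) ^+ 2 * r k)) @[k --> \oo] --> 0.
Proof.
move=> r0; rewrite -[X in _ --> X](mulr0 K); apply: cvgMr.
rewrite -[X in _ --> X](subrr 1); apply: cvgB; first exact: cvg_cst.
rewrite -[X in _ --> X]expR0 -[X in expR X](mulr0 (- (2 * pi) ^+ 2)).
apply: continuous_cvg; first exact: continuous_expR.
by apply: cvgMr.
Qed.

(** Three errors of size [e / 3]: replacing [v s] by [v 0] under the locally Lipschitz [Q], the
    modulus of continuity of [g], which is [Q] along [v 0], at [x], and the Korovkin term at time
    [t k], which dominates the one at [t k - s]. *)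
Lemma drift_cvg (v : R -> CT R) (Q : {poly R}) (x : R) (t : nat -> R) :
  {within `[0, 1], continuous v} -> (forall k, 0 < t k <= 1) ->
  t k @[k --> \oo] --> 0 ->
  (\int[leb]_(s in `[0, t k]) heat (t k - s) (fun y => Q.[v s y]) x) / t k @[k --> \oo]
    --> Q.[v 0 x].
Proof.
move=> cv t01 tc; apply/cvgrPdist_le => e e0; have e3 : 0 < e / 3 by rewrite divr_gt0.
have [g gE] := CT_horner Q (v 0).
have [K K0 hK] := periodic_le_cos g x e3.
have [L L0 hL] := CT_path_bounded cv.
have [K' K'0 hK'] := poly_lipschitz Q L0.
have eta0 : 0 < e / 3 / (K' + 1) by rewrite divr_gt0// ltr_wpDl.
have z01 : 0 <= (0 : R) <= 1 by rewrite lexx ler01.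
have [del /= del0 hdel] : \forall s \near (0 : R), `|v (clip01 s) - v 0| < e / 3 / (K' + 1).
  have cd := within_continuous_clip01 (CT_within_continuous_comp (@CT_dist_continuous R (v 0)) cv).
  have /cvgrPdist_lt/(_ _ eta0) := cd 0; apply: filterS => s /=.
  by rewrite clip01_id// subrr normr0 sub0r normrN normr_id.
have /cvgrPdist_le/(_ _ e3) hk1 := korovkin_term_cvg K tc.
have /cvgrPdist_lt/(_ _ del0) hk2 := tc.
near=> k; have /andP[tk0 tk1] := t01 k; rewrite drift_itv//.
have hH s : `]0, t k[%classic s -> `|heat (t k - s) (fun y => Q.[v s y]) x - Q.[v 0 x]| <= e.
  rewrite /= in_itv/= => /andP[s0 st].
  have s01 : 0 <= s <= 1 by rewrite ltW//= (le_trans (ltW st)).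
  have hs y : `|Q.[v s y] - g x| <= (e / 3 + e / 3) + K * (1 - cos (2 * pi * (x - y))).
    have -> : Q.[v s y] - g x = (Q.[v s y] - g y) + (g y - g x) by rewrite subrKA.
    rewrite -[leRHS]addrA; apply: le_trans (ler_normD _ _) _.
    apply: lerD; last exact: hK.
    rewrite gE; apply: le_trans (hK' _ _ (hL _ _ s01) (hL _ _ z01)) _.
    have : `|v (clip01 s) - v 0| < e / 3 / (K' + 1).
      apply: hdel; rewrite /= sub0r normrN gtr0_norm//; apply: (lt_trans st).
      have : `|0 - t k| < del by near: k; exact: hk2.
      by rewrite sub0r normrN gtr0_norm.
    rewrite clip01_id// => hb.
    have hb' : `|v s y - v 0 y| <= e / 3 / (K' + 1).
      by apply: le_trans (ltW hb); exact: (CT_le_norm (v s - v 0) y).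
    apply: le_trans (ler_wpM2l K'0 hb') _.
    rewrite mulrCA ler_piMr ?(ltW e3)// ler_pdivrMr ?ltr_wpDl// mul1r lerDl//.
  have ts : 0 <= t k - s by rewrite subr_ge0 ltW.
  have cQ : continuous (fun y => Q.[v s y]).
    exact: CT_horner_continuous.
  rewrite -gE; apply: le_trans (heat_korovkin ts cQ hs) _.
  rewrite [leRHS](_ : e = e / 3 + e / 3 + e / 3); last by lra.
  rewrite lerD2l; apply: (@le_trans _ _ (K * (1 - expR (- (2 * pi) ^+ 2 * t k)))).
    rewrite ler_wpM2l// lerB// ler_expR !mulNr lerN2 ler_wpM2l ?sqr_ge0//.
    by rewrite lerBlDr lerDl ltW.
  have : `|0 - K * (1 - expR (- (2 * pi) ^+ 2 * t k))| <= e / 3 by near: k; exact: hk1.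
  by rewrite sub0r normrN; apply: le_trans; exact: ler_norm.
have iH := heat_path_integrable cv Q x (t01 k).
have lo : (Q.[v 0 x] - e) * t k <= \int[leb]_(s in `]0, t k[) heat (t k - s) (fun y => Q.[v s y]) x.
  rewrite -itv_Rintegral_cst//; apply: le_Rintegral => //; first exact: itv_integrable_cst.
  by move=> s /hH; rewrite ler_distl => /andP[].
have hi : \int[leb]_(s in `]0, t k[) heat (t k - s) (fun y => Q.[v s y]) x <= (Q.[v 0 x] + e) * t k.
  rewrite -itv_Rintegral_cst//; apply: le_Rintegral => //; first exact: itv_integrable_cst.
  by move=> s /hH; rewrite ler_distl => /andP[].
by rewrite distrC ler_distl ler_pdivlMr// ler_pdivrMr// lo hi.
Unshelve. all: by end_near.
Qed.

End drift.

(** * Gaussian measures on continuous functions *)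

Section gaussian_laws.
Variable R : realType.

Lemma gaussian_measure_linear (mu : probability (CT R) R) (f : CT R -> R) :
  (forall a u v, f (a *: u + v) = a * f u + f v) -> continuous f ->
  gaussian_measure mu -> gaussian_rv mu f.
Proof.
move=> lf cf gmu.
pose l : {linear CT R -> R} := HB.pack f (GRing.isLinear.Build R (CT R) R _ f lf).
exact: (gmu l cf).
Qed.

Lemma has_law_integral d (Omega : measurableType d) (Pr : probability Omega R)
    d' (T : measurableType d') (mu : probability T R) (X : Omega -> T) (f : T -> \bar R) :
  has_law Pr X mu -> measurable_fun setT f -> (forall x, 0 <= f x)%E ->
  (\int[Pr]_w f (X w) = \int[mu]_x f x)%E.
Proof.
move=> [mX lX] mf f0.
transitivity (\int[pushforward Pr X]_x f x)%E.
  by rewrite ge0_integral_pushforward// preimage_setT.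
by apply: eq_measure_integral => A mA _; exact: lX.
Qed.

Lemma has_law_gaussian_tilt d (Omega : measurableType d) (Pr : probability Omega R)
    d' (T : measurableType d') (mu : probability T R) (X : Omega -> T) (f : T -> R) m v :
  has_law Pr X mu -> gaussian_tilt mu f m v -> gaussian_tilt Pr (f \o X) m v.
Proof.
move=> XL [mf v0 vE tE]; have [mX lX] := XL; split => //.
- exact: measurableT_comp.
- move=> /vE <-; rewrite comp_preimage lX//.
  by rewrite -[X in measurable X]setTI; exact: mf.
- move=> l g cg g0; have mg := continuous_measurable_fun cg.
  have mfX := measurableT_comp mf mX.
  have XE B : measurable B -> Pr ((f \o X) @^-1` B) = mu (f @^-1` B).
    move=> mB; rewrite comp_preimage lX//.
    by rewrite -[X in measurable X]setTI; exact: mf.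
  have cexp : continuous (fun x => expR (l * x)).
    by move=> x; apply: continuous_comp; [exact: mulrl_continuous|exact: continuous_expR].
  have mh : measurable_fun setT (fun x => (expR (l * x) * g x)%:E).
    apply/measurable_EFinP; apply: continuous_measurable_fun => x.
    by apply: cvgM; [exact: cexp|exact: cg].
  have mg' : measurable_fun setT (fun x : R => (g (x + l * v))%:E).
    apply/measurable_EFinP; apply: continuous_measurable_fun => x.
    apply: (@continuous_comp _ _ _ (fun x => x + l * v)); last exact: cg.
    by apply: cvgD => //; exact: cvg_cst.
  rewrite (ge0_integral_law mfX mf XE mh); last first.
    by move=> x; rewrite lee_fin mulr_ge0 ?expR_ge0.
  rewrite (ge0_integral_law mfX mf XE mg'); last by move=> x; rewrite lee_fin.
  exact: tE.
Qed.

Lemma gaussian_measure_eval_tilt (mu : probability (CT R) R) (y : R) :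
  gaussian_measure mu -> exists m v, gaussian_tilt mu (fun u : CT R => u y) m v.
Proof.
move=> gmu; apply: gaussian_rv_tilt; apply: gaussian_measure_linear => //.
exact: CT_eval_continuous.
Qed.

(** Uniformity in [y] comes from the sup norm: it is one finite random variable dominating every
    evaluation, so a single level [M] serves in [mgf_tight] for all [y]. Its tightness is
    [ae_cvg_tight] for a constant sequence. *)
Lemma gaussian_measure_moment (mu : probability (CT R) R) (Q : {poly R}) :
  gaussian_measure mu -> exists C, forall y : R,
    (\int[mu]_u (`|Q.[u y]|)%:E <= C%:E)%E.
Proof.
move=> gmu.
have mev (y : R) : measurable_fun setT (fun u : CT R => u y).
  by apply: CT_continuous_measurable; exact: CT_eval_continuous.
have mnorm : measurable_fun setT (fun u : CT R => `|u|).
  by apply: CT_continuous_measurable; exact: CT_norm_continuous.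
have e0 : 0 < expR (- 9) / 2 :> R by rewrite divr_gt0 ?expR_gt0.
have [M M0 [n0 _ hM]] := @ae_cvg_tight _ _ _ mu (fun _ u => `|u|) (fun u => `|u|) _ e0
  (fun _ => mnorm) mnorm (aeW _ (fun w => cvg_cst _)).
have {}hM := hM n0 (leqnn _).
have [C hC] := gaussian_mgf_poly_le mu Q.
pose B := 2 * M ^+ 2 + 3 * M + 2.
have B0 : 0 <= B by rewrite !addr_ge0// mulr_ge0// sqr_ge0.
exists (`|C| * (expR (B + B / 2) + expR (B + B / 2))) => y.
have [m [v t]] := gaussian_measure_eval_tilt y gmu; have [_ v0 _ _] := t.
have G := gaussian_tilt_mgf t.
have [|vB mB] := mgf_tight G v0 M0.
  apply: le_trans hM; apply: le_measure; rewrite ?inE.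
  - have -> : [set u : CT R | M < `|u y|] = (fun u : CT R => `|u y|) @^-1` `]M, +oo[.
      by apply/seteqP; split => w /=; rewrite in_itv/= andbT.
    rewrite -[X in measurable X]setTI.
    have mny : measurable_fun setT (fun u : CT R => `|u y|) by apply: measurableT_comp.
    by apply: mny => //; exact: measurable_itv.
  - have -> : [set u : CT R | M < `| `|u| | ] = (fun u : CT R => `|u|) @^-1` `]M, +oo[.
      by apply/seteqP; split => w /=; rewrite in_itv/= andbT normr_id.
    by rewrite -[X in measurable X]setTI; apply: mnorm => //; exact: measurable_itv.
  - move=> u /= /lt_le_trans; apply; rewrite normr_id; exact: CT_le_norm.
apply: le_trans (hC _ _ _ G) _; rewrite lee_fin.
have sM := sqr_ge0 M.
have le1 : expR (m + v / 2) <= expR (B + B / 2).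
  by rewrite ler_expR; move: mB; rewrite ler_norml /B => /andP[_ mB]; lra.
have le2 : expR (- m + v / 2) <= expR (B + B / 2).
  by rewrite ler_expR; move: mB; rewrite ler_norml /B => /andP[mB _]; lra.
apply: (@le_trans _ _ (`|C| * (expR (m + v / 2) + expR (- m + v / 2)))).
  by rewrite ler_wpM2r ?addr_ge0 ?expR_ge0// ler_norm.
by rewrite ler_wpM2l// lerD.
Qed.

End gaussian_laws.

Section drift_moment.
Context {R : realType} {d} {Omega : measurableType d}.
Variable Pr : probability Omega R.
Local Notation leb := (@lebesgue_measure R).

(** The measurable majorant [W] is the Jensen bound. By Tonelli its expectation is an average of the
    fourth moments of [Q] along [U] at fixed time and place: the kernel has mass [t] in time and
    space, which cancels [t^-1]. *)
Lemma drift_moment_le (U : R -> Omega -> CT R) (Q : {poly R}) (x t C : R) :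
  (forall s, 0 <= s <= 1 -> measurable_fun setT (U s)) ->
  (forall w, {within `[0, 1], continuous (fun s => U s w)}) ->
  (forall s y, 0 <= s <= 1 -> (\int[Pr]_w (Q.[U s w y] ^+ 4)%:E <= C%:E)%E) ->
  0 < t <= 1 ->
  exists W : Omega -> \bar R, [/\ measurable_fun setT W, forall w, (0 <= W w)%E,
    (\int[Pr]_w W w <= C%:E)%E &
    forall w, ((((\int[leb]_(s in `[0, t]) heat (t - s) (fun y => Q.[U s w y]) x) / t) ^+ 4)%R%:E
      <= W w)%E].
Proof.
move=> mU cU hC t01; have /andP[t0 t1] := t01.
pose k (p : R * R) := duhamel_kernel t x p * \1_`[0%R, 1%R] p.2.
have k0 p : 0 <= k p by rewrite mulr_ge0// duhamel_kernel_ge0.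
have mk : measurable_fun setT k.
  apply: measurable_funM; first exact: measurable_duhamel_kernel.
  have mi : measurable_fun setT (\1_`[0%R, 1%R] : R -> R) by exact: measurable_indic.
  exact: (measurableT_comp mi measurable_snd).
pose V (p : (Omega * R) * R) := Q.[U (clip01 p.1.2) p.1.1 (clip01 p.2)] ^+ 4.
have V0 p : 0 <= V p by rewrite /V (exprM _ 2 2) sqr_ge0.
have mV : measurable_fun setT V.
  apply: (measurableT_comp (f := fun a : R => Q.[a] ^+ 4)); last exact: CT_joint_measurable.
  apply: measurable_funX; apply: continuous_measurable_fun; exact: continuous_horner.
pose f (p : (Omega * R) * R) := (k (p.1.2, p.2) * V p)%:E.
have f0 p : (0 <= f p)%E by rewrite lee_fin mulr_ge0.
have mf : measurable_fun setT f.
  apply/measurable_EFinP; apply: measurable_funM => //.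
  apply: (measurableT_comp mk); apply/measurable_fun_pairP; split => /=.
    exact: (measurableT_comp measurable_snd measurable_fst).
  exact: measurable_snd.
pose F := fubini_F leb f.
have mF : measurable_fun setT F := measurable_fun_fubini_tonelli_F (m2 := leb) f mf f0.
have F0 p : (0 <= F p)%E by apply: integral_ge0.
pose W0 := fubini_F leb F.
have mW0 : measurable_fun setT W0 := measurable_fun_fubini_tonelli_F (m2 := leb) F mF F0.
exists (fun w => (t^-1)%:E * W0 w)%E; split.
- exact: measurable_funeM.
- by move=> w; rewrite mule_ge0// ?lee_fin ?invr_ge0 ?(ltW t0)//; apply: integral_ge0.
- rewrite ge0_integralZl//; last 2 first.
  + by move=> w _; apply: integral_ge0.
  + by rewrite lee_fin invr_ge0 ltW.
  have kint s : (\int[leb]_y (k (s, y))%:E = (\1_`]0%R, t[ s)%:E)%E.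
    rewrite /k /= -(integral01_indic (fun y => duhamel_kernel t x (s, y))).
    rewrite indicE mem_setE in_itv/=; have [st|st] := boolP (0 < s < t).
      transitivity (\int[leb]_(y in `[0%R, 1%R]) (duhamel_kernel t x (s, y) * 1)%:E)%E.
        by apply: eq_integral => y _; rewrite mulr1.
      rewrite (integral_duhamel_kernel _ st (g := fun=> 1)) ?heat_cst//.
      by move=> y; exact: cvg_cst.
    by rewrite integral0_eq// => y _; rewrite /duhamel_kernel /= (negbTE st).
  have -> : (\int[Pr]_w W0 w = \int[leb]_s \int[Pr]_w F (w, s))%E.
    exact: (fubini_tonelli (m1 := Pr) (m2 := leb) F mF F0).
  have step s : (\int[Pr]_w F (w, s) <= (C * \1_`]0%R, t[ s)%:E)%E.
    have mfs : measurable_fun setT (fun p : Omega * R => f ((p.1, s), p.2)).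
      apply: (measurableT_comp mf); apply/measurable_fun_pairP; split => /=.
        by apply/measurable_fun_pairP; split => /=; [exact: measurable_fst|exact: measurable_cst].
      exact: measurable_snd.
    rewrite (fubini_tonelli (m1 := Pr) (m2 := leb) (fun p : Omega * R => f ((p.1, s), p.2)) mfs)//=.
    rewrite EFinM -kint -ge0_integralZl//; last 3 first.
    + apply/measurable_EFinP; apply: (measurableT_comp mk).
      by apply/measurable_fun_pairP; split => /=; [exact: measurable_cst|exact: measurable_id].
    + by move=> y _; rewrite lee_fin.
    + apply: le_trans (hC (clip01 s) 0 (clip01_itv s)); apply: integral_ge0 => w _.
      by rewrite lee_fin (exprM _ 2 2) sqr_ge0.
    apply: ge0_le_integral => //.
    + by move=> y _; apply: integral_ge0.
    + exact: (measurable_fun_fubini_tonelli_G (m1 := Pr) (fun p : Omega * R => f ((p.1, s), p.2)) mfs).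
    + apply: measurable_funeM; apply/measurable_EFinP; apply: (measurableT_comp mk).
      by apply/measurable_fun_pairP; split => /=; [exact: measurable_cst|exact: measurable_id].
    + move=> y _; rewrite /f /=.
      under eq_integral do rewrite EFinM.
      rewrite ge0_integralZl//; last 3 first.
      * apply/measurable_EFinP; apply: (measurableT_comp mV).
        apply/measurable_fun_pairP; split => /=; last exact: measurable_cst.
        by apply/measurable_fun_pairP; split => /=; [exact: measurable_id|exact: measurable_cst].
      * by move=> w _; rewrite lee_fin.
      * by rewrite lee_fin.
      rewrite [leRHS]muleC; apply: lee_wpmul2l; first by rewrite lee_fin.
      rewrite /V /=.
      exact: (hC (clip01 s) (clip01 y) (clip01_itv s)).
  have C0 : 0 <= C.
    rewrite -lee_fin; apply: le_trans (hC 0 0 _); last by rewrite lexx ler01.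
    by apply: integral_ge0 => w _; rewrite lee_fin (exprM _ 2 2) sqr_ge0.
  have ti : (\int[leb]_s (C * \1_`]0%R, t[ s)%:E = (C * t)%:E)%E.
    transitivity (\int[leb]_s (C%:E * (\1_`]0%R, t[ s)%:E))%E.
      by apply: eq_integral => s _; rewrite -EFinM.
    rewrite ge0_integralZl//; last by apply/measurable_EFinP; exact: measurable_indic.
    rewrite integral_indic// setIT /= lebesgue_measure_itv/= lte_fin t0 -EFinB subr0.
    by rewrite -EFinM.
  apply: (@le_trans _ _ ((t^-1)%:E * (C * t)%:E)%E).
    apply: lee_wpmul2l; first by rewrite lee_fin invr_ge0 ltW.
    rewrite -ti; apply: ge0_le_integral => //.
    + by move=> s _; apply: integral_ge0.
    + exact: (measurable_fun_fubini_tonelli_G (m1 := Pr) F mF F0).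
    + apply/measurable_EFinP; apply: measurable_funM => //; exact: measurable_indic.
  by rewrite -EFinM lee_fin mulrCA mulVf ?mulr1// gt_eqF.
- move=> w; apply: le_trans (drift_expr4_le Q x (cU w) t01) _.
  apply: lee_wpmul2l; first by rewrite lee_fin invr_ge0 ltW.
  rewrite le_eqVlt; apply/orP; left; apply/eqP; apply: eq_integral => s _.
  by apply: eq_integral => y _; rewrite /f /k /V /= mulrAC.
Qed.

End drift_moment.

(** * Small times: the variance vanishes *)

Section variance.
Context {R : realType} {d} {Omega : measurableType d}.
Variable Pr : probability Omega R.
Local Notation leb := (@lebesgue_measure R).

Lemma has_law_gaussian_rv d' (T : measurableType d') (mu : probability T R)
    (X : Omega -> T) (f : T -> R) :
  has_law Pr X mu -> gaussian_rv mu f -> gaussian_rv Pr (f \o X).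
Proof.
move=> [mX lX] [mf [m [s h]]]; split; first exact: measurableT_comp.
exists m, s => B mB; rewrite -h// comp_preimage lX//.
by rewrite -[X in measurable X]setTI; exact: mf.
Qed.

Lemma heat_CT_continuous t x : continuous (fun f : CT R => heat t f x).
Proof.
move=> u A /nbhs_ballP[e /= e0 hA]; apply/nbhs_ballP; exists e => // v uv.
apply: hA; move: uv; rewrite -!ball_normE /= => uv.
apply: le_lt_trans uv; have -> : heat t u x - heat t v x = heat t (u - v) x.
  rewrite -mulN1r -heatZ; last exact: CT_continuous.
  rewrite -heatD; [|exact: CT_continuous|]; last first.
    by move=> y; apply: cvgMr; exact: CT_continuous.
  by congr (heat _ _ _); apply/funext => y; rewrite mulN1r.
by apply: heat_norm_le => [|y]; [exact: (@CT_continuous R (u - v))|exact: CT_le_norm].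
Qed.

Lemma gaussian_measure_heat (mu : probability (CT R) R) t x :
  gaussian_measure mu -> gaussian_rv mu (fun f : CT R => heat t f x).
Proof.
apply: gaussian_measure_linear; last exact: heat_CT_continuous.
move=> a u v; rewrite -heatZ; last exact: CT_continuous.
by rewrite -heatD//; [move=> y; apply: cvgMr; exact: CT_continuous|exact: CT_continuous].
Qed.

(** The heat flow at a point is a continuous linear functional of the initial datum, and each
    approximant [xi (F n)] is measurable for the noise events, hence independent of it. *)
Lemma gaussian_heat_wiener (mu : probability (CT R) R) (u0 : Omega -> CT R)
    (Cov : (R -> R) -> R) xi (Z : Omega -> R) f t x :
  gaussian_measure mu -> has_law Pr u0 mu -> independent_of_noise Pr xi u0 ->
  noise Pr Cov xi -> measurable_fun setT Z -> wiener_integral Pr xi f Z ->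
  exists m v, gaussian_mgf Pr ((fun w => heat t (u0 w) x) \+ Z) m v /\ 0 <= v.
Proof.
move=> gmu lu0 iu0 [_ gxi _ _] mZ [F [tF _ FZ]].
have gh := gaussian_measure_heat t x gmu.
apply: (L2_limit_gaussian_mgfD (Y_ := fun n => xi (F n))) => //.
- exact: has_law_gaussian_rv lu0 gh.
- by move=> n; exact: gxi.
- move=> n B C mB mC; have [mh _] := gh.
  have mhB : measurable ((fun f : CT R => heat t f x) @^-1` B).
    by rewrite -[X in measurable X]setTI; exact: mh.
  apply: (iu0 _ (xi (F n) @^-1` C) mhB).
  by apply: sub_sigma_algebra; exists (F n), C.
Qed.

(** The path is set to 0 on a null set. Joint measurability needs every path continuous, and the two
    versions agree at all times at once off that set. *)
Lemma ae_continuous_modification (u : R -> Omega -> CT R) :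
  (forall s, 0 <= s <= 1 -> measurable_fun setT (u s)) ->
  (\forall w \ae Pr, {within `[0, 1], continuous (fun s => u s w)}) ->
  exists U : R -> Omega -> CT R,
    [/\ forall s, 0 <= s <= 1 -> measurable_fun setT (U s),
        forall w, {within `[0, 1], continuous (fun s => U s w)} &
        \forall w \ae Pr, forall s, U s w = u s w].
Proof.
move=> mu_ [N [mN N0 hN]].
pose U s w := if w \in N then 0 else u s w.
exists U; split.
- move=> s s01; apply: measurable_fun_ifT => //; last exact: mu_.
  apply: (measurable_fun_bool true); rewrite setTI (_ : _ @^-1` _ = N)//.
  by apply/seteqP; split => w /= h; [exact: set_mem|exact: mem_set].
- move=> w; have [wN|wN] := boolP (w \in N).
    rewrite (_ : (fun s => U s w) = (fun=> 0)); last by apply/funext => s; rewrite /U wN.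
    by apply: continuous_subspaceT => s; exact: cvg_cst.
  rewrite (_ : (fun s => U s w) = (fun s => u s w)); last by apply/funext => s; rewrite /U (negbTE wN).
  by move: wN; rewrite notin_setE => wN; apply: contrapT => h; apply: wN; exact: hN.
- exists N; split => // w /= h; apply: contrapT => wN; apply: h => s.
  by rewrite /U ifN// notin_setE.
Qed.

Lemma path_eval_cvg (v : R -> CT R) x (t : nat -> R) :
  {within `[0, 1], continuous v} -> (forall k, 0 <= t k <= 1) ->
  t k @[k --> \oo] --> 0 -> v (t k) x @[k --> \oo] --> v 0 x.
Proof.
move=> cv t01 t0.
have h := within_continuous_clip01 (CT_within_continuous_comp (@CT_eval_continuous R x) cv).
have := cvg_comp _ _ t0 (h 0); rewrite /= clip01_id ?lexx ?ler01// => {}h.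
apply: cvg_trans h; apply: near_eq_cvg; apply: nearW => k /=.
by rewrite clip01_id.
Qed.

Lemma gaussian_invariant_variance0 (Cov : (R -> R) -> R) xi (P : {poly R})
    (mu : probability (CT R) R) (u0 : Omega -> CT R) u x m v :
  noise Pr Cov xi -> (2 < size P)%N ->
  has_law Pr u0 mu -> independent_of_noise Pr xi u0 -> mild_solution Pr P xi u0 u ->
  (forall t, 0 <= t <= 1 -> has_law Pr (u t) mu) ->
  gaussian_measure mu -> gaussian_tilt mu (fun f : CT R => f x) m v -> v = 0.
Proof.
move=> xiN sP lu0 iu0 [mu_ [Z [mZ wZ cZ] usol]] lu gmu tx; apply/eqP/negPn/negP => v0.
have [U [mU cU UE]] : exists U : R -> Omega -> CT R,
    [/\ forall s, 0 <= s <= 1 -> measurable_fun setT (U s),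
        forall w, {within `[0, 1], continuous (fun s => U s w)} &
        \forall w \ae Pr, forall s, U s w = u s w].
  by apply: ae_continuous_modification => //; apply: filterS usol => w [].
(* By invariance these moments under [mu] bound the fourth moments of the drift at every time and
   place. *)
have [C hC] := gaussian_measure_moment (P ^+ 4) gmu.
have mev (f : CT R -> R) : continuous f -> measurable_fun setT f.
  exact: CT_continuous_measurable.
have UC s y : 0 <= s <= 1 -> (\int[Pr]_w (P.[U s w y] ^+ 4)%:E <= C%:E)%E.
  move=> s01.
  have mq : measurable_fun setT (fun f : CT R => (P.[f y] ^+ 4)%:E).
    apply/measurable_EFinP; apply: measurable_funX.
    apply: (measurableT_comp (f := horner P)).
      by apply: continuous_measurable_fun; exact: continuous_horner.
    by apply: mev; exact: CT_eval_continuous.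
  have q0 (f : CT R) : (0 <= (P.[f y] ^+ 4)%:E)%E by rewrite lee_fin (exprM _ 2 2) sqr_ge0.
  have -> : (\int[Pr]_w (P.[U s w y] ^+ 4)%:E = \int[Pr]_w (P.[u s w y] ^+ 4)%:E)%E.
    apply: ge0_ae_eq_integral => //.
    - exact: (measurableT_comp mq (mU s s01)).
    - exact: (measurableT_comp mq (mu_ s s01)).
    - by apply: filterS UE => w hw _; rewrite hw.
  rewrite (has_law_integral (lu s s01) mq q0); apply: le_trans (hC y).
  rewrite le_eqVlt; apply/orP; left; apply/eqP; apply: eq_integral => f _.
  by rewrite horner_exp ger0_norm// (exprM _ 2 2) sqr_ge0.
pose t (k : nat) : R := k.+1%:R^-1.
have t0 k : 0 < t k by rewrite invr_gt0.
have t1 k : t k <= 1 by rewrite invf_le1// ler1n.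
have t01 k : 0 <= t k <= 1 by rewrite ltW//=.
have t01' k : 0 < t k <= 1 by rewrite t0/=.
have tcvg : t k @[k --> \oo] --> 0 by exact: cvg_harmonic.
pose Uk k w := u (t k) w x.
pose G k w := heat (t k) (u0 w) x + Z (t k) w x.
pose X w := u 0 w x.
have UkG k : gaussian_tilt Pr (Uk k) m v by exact: has_law_gaussian_tilt (lu _ (t01 k)) tx.
have XG : gaussian_tilt Pr X m v.
  by apply: has_law_gaussian_tilt (lu 0 _) tx; rewrite lexx ler01.
have mUk k : measurable_fun setT (Uk k) by have [] := UkG k.
have mX : measurable_fun setT X by have [] := XG.
have /choice[p hp] k : exists p : R * R, gaussian_mgf Pr (G k) p.1 p.2 /\ 0 <= p.2.
  have mZk : measurable_fun setT (fun w => Z (t k) w x).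
    apply: (measurableT_comp (f := fun f : CT R => f x)); last exact: mZ.
    by apply: mev; exact: CT_eval_continuous.
  have [m' [v' h]] := gaussian_heat_wiener (t k) x gmu lu0 iu0 xiN mZk (wZ _ x (t01 k)).
  by exists (m', v').
have mG k : measurable_fun setT (G k) by have [[]] := hp k.
pose N k w := \int[leb]_(s in `[0, t k]) heat (t k - s) (fun y => P.[U s w y]) x.
have UGN : \forall w \ae Pr, forall k, Uk k w - G k w = N k w.
  apply: filterS2 UE usol => w hU [_ hu] k; rewrite /Uk hu// /G.
  have -> : N k w = \int[leb]_(s in `[0, t k]) heat (t k - s) (fun y => P.[u s w y]) x.
    by rewrite /N; apply: eq_Rintegral => s _; rewrite hU.
  by ring.
have lim : \forall w \ae Pr, Uk k w @[k --> \oo] --> X w /\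
    (Uk k w - G k w) / t k @[k --> \oo] --> P.[X w].
  apply: filterS2 UE UGN => w hU hN; split.
    have h := @path_eval_cvg (fun s => U s w) x t (cU w) t01 tcvg.
    rewrite /X -hU; apply: cvg_trans h; apply: near_eq_cvg; apply: nearW => k.
    by rewrite hU.
  under eq_fun do rewrite hN.
  by rewrite /X -hU; exact: drift_cvg.
have GX : \forall w \ae Pr, G k w @[k --> \oo] --> X w.
  apply: filterS lim => w [h1 h2].
  have -> : (fun k => G k w) = (fun k => Uk k w - (Uk k w - G k w) / t k * t k).
    by apply/funext => k; rewrite divfK ?gt_eqF// opprB addrCA subrr addr0.
  rewrite -[X in _ --> X]subr0 -[X in _ - X](mulr0 P.[X w]).
  by apply: cvgB => //; exact: cvgM.
(* The parameters of [G k] are bounded only from index [K] on, whence the shifted sequences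
   below. *)
have [B [K _ hB]] := gaussian_mgf_ae_bounded (fun k => (hp k).1) (fun k => (hp k).2) mX GX.
have shift (f : nat -> R) (a : R) : f k @[k --> \oo] --> a -> f (k + K)%N @[k --> \oo] --> a.
  by move=> h; rewrite cvg_shiftn.
suff : (size P <= 2)%N by rewrite leqNgt sP.
apply: (@gaussian_drift_size R _ _ Pr P (fun k => t (k + K)%N) (fun k => Uk (k + K)%N)
  (fun k => G (k + K)%N) X m v (fun k => (p (k + K)%N).1) (fun k => (p (k + K)%N).2) B C) => //.
- exact: (shift t).
- by move=> k; exact: (hp _).1.
- by move=> k; apply: hB; rewrite /= leq_addl.
- move=> k; set n := (k + K)%N.
  have [W [mW W0 WC hW]] := drift_moment_le x mU cU UC (t01' n).
  apply: le_trans WC; apply: ae_ge0_le_integral => //.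
  + by move=> w _; rewrite lee_fin (exprM _ 2 2) sqr_ge0.
  + apply/measurable_EFinP; apply: measurable_funX; apply: measurable_funM => //.
    exact: measurable_funB.
  + by apply: filterS UGN => w hN _; rewrite hN; exact: hW.
- apply: filterS lim => w [h1 h2]; split; first exact: (shift (fun k => Uk k w)).
  exact: (shift (fun k => (Uk k w - G k w) / t k)).
Qed.

End variance.

(** * The degenerate case *)

Section smooth_functions.
Variable R : realType.
Implicit Types f g A B : R -> R.

(** [smoothT] without periodicity, for functions of time. *)
Definition smooth f := forall n x, derivable (derive1n n f) x 1.

Lemma smooth_is_derive f (n : nat) (x : R) : smooth f -> is_derive x 1 (derive1n n f) (derive1n n.+1 f x).
Proof. by move=> sf; apply: DeriveDef; [exact: sf|rewrite derive1nS derive1E]. Qed.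

Lemma smooth_continuous f n : smooth f -> continuous (derive1n n f).
Proof. by move=> sf x; apply: differentiable_continuous; apply/derivable1_diffP; exact: sf. Qed.

Lemma smooth_derive1 f : smooth f -> smooth (derive1 f).
Proof. by move=> sf n x; rewrite -derive1Sn. Qed.

Lemma smooth_is_derive_affine f (c b : R) (n : nat) (y : R) : smooth f ->
  is_derive y 1 (fun y => c ^+ n * derive1n n f (c * y + b))
    (c ^+ n.+1 * derive1n n.+1 f (c * y + b)).
Proof.
move=> sf; have sd := smooth_is_derive n (c * y + b) sf.
have ia : is_derive y 1 (fun y : R => c * y + b) c.
  by apply: is_derive_eq; rewrite addr0 [c *: _]mulr1.
have ic := @is_derive1_comp R (derive1n n f) (fun y => c * y + b) y _ _ sd ia.
have icM := is_deriveZ (c ^+ n) ic.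
have -> : c ^+ n.+1 * derive1n n.+1 f (c * y + b) = c ^+ n *: (derive1n n.+1 f (c * y + b) * c).
  by rewrite exprSr -mulrA; congr (_ * _); rewrite mulrC.
exact: icM.
Qed.

Lemma derive1n_affine f c b n : smooth f ->
  derive1n n (fun y => f (c * y + b)) = fun y => c ^+ n * derive1n n f (c * y + b).
Proof.
move=> sf; elim: n => [|n IH]; first by apply/funext => y; rewrite !derive1n0 expr0 mul1r.
rewrite derive1nS IH; apply/funext => y; rewrite derive1E.
by have [_ ->] := smooth_is_derive_affine c b n y sf.
Qed.

Lemma smooth_affine f c b : smooth f -> smooth (fun y => f (c * y + b)).
Proof.
move=> sf n y; rewrite derive1n_affine//.
by have [] := smooth_is_derive_affine c b n y sf.
Qed.

Lemma derive1n_add f g n :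
  (forall k x, (k < n)%N -> derivable (derive1n k f) x 1 /\ derivable (derive1n k g) x 1) ->
  derive1n n (fun x => f x + g x) = fun x => derive1n n f x + derive1n n g x.
Proof.
elim: n => [//|n IH] h; rewrite derive1nS IH; last by move=> k x kn; apply: h; exact: ltnW.
apply/funext => x; have [hf hg] := h n x (ltnSn n).
by rewrite !derive1nS !derive1E deriveD.
Qed.

(** Induction on the order for all pairs at once: the derivative of a product is a sum of products
    of smooth functions, to which the hypothesis applies again. *)
Lemma smoothM f g : smooth f -> smooth g -> smooth (fun x => f x * g x).
Proof.
move=> sf sg n; suff : forall f g, smooth f -> smooth g -> forall k x, (k <= n)%N ->
    derivable (derive1n k (fun x => f x * g x)) x 1 by move=> h x; exact: h.
elim: n => [|n IH] {sf sg}f {}g sf sg k x.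
  by rewrite leqn0 => /eqP ->; apply: derivableM; [exact: (sf 0)|exact: (sg 0)].
have d0 x' : derivable f x' 1 /\ derivable g x' 1 by split; [exact: (sf 0)|exact: (sg 0)].
case: k => [_|k]; first by apply: derivableM; [exact: (sf 0)|exact: (sg 0)].
rewrite ltnS => kn; rewrite derive1Sn.
have -> : derive1 (fun x => f x * g x) = fun x => f x * derive1 g x + g x * derive1 f x.
  apply/funext => y; have [hf hg] := d0 y.
  have dM : 'D_1 (f * g) y = f y *: 'D_1 g y + g y *: 'D_1 f y := deriveM hf hg.
  by rewrite -!derive1E in dM.
have s1 := IH f (derive1 g) sf (smooth_derive1 sg).
have s2 := IH g (derive1 f) sg (smooth_derive1 sf).
rewrite derive1n_add; last first.
  move=> j y jk; have jn : (j <= n)%N by exact: leq_trans (ltnW jk) kn.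
  by split; [exact: s1|exact: s2].
by apply: derivableD; [exact: s1|exact: s2].
Qed.

Lemma smoothT_bounded f n : smoothT f -> exists2 K, 0 <= K & forall x, `|derive1n n f x| <= K.
Proof.
move=> [pf sf].
have pn : Defs.periodic (derive1n n f).
  move=> x; have := derive1n_affine 1 1 n sf.
  rewrite (_ : (fun y => f (1 * y + 1)) = f); last by apply/funext => y; rewrite mul1r pf.
  by move=> h; rewrite [in RHS]h expr1n !mul1r.
have hC : derive1n n f \in @CT_pred R by apply/asboolP; split => //; exact: smooth_continuous.
exists (CT_norm (MkCT hC)); last exact: (CT_le_norm (MkCT hC)).
by apply: le_trans (CT_le_norm (MkCT hC) 0).
Qed.

Lemma smoothT_lipschitz f n : smoothT f ->
  exists2 K, 0 <= K & forall x y, `|derive1n n f x - derive1n n f y| <= K * `|x - y|.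
Proof.
move=> fT; have [K K0 hK] := smoothT_bounded n.+1 fT; have [_ sf] := fT; exists K => //.
have main x y : x <= y -> `|derive1n n f y - derive1n n f x| <= K * `|y - x|.
  move=> xy; have [||c _ ->] := @MVT_segment R (derive1n n f) (derive1n n.+1 f) x y xy.
  - by move=> z _; exact: smooth_is_derive.
  - by apply: continuous_subspaceT; exact: smooth_continuous.
  by rewrite normrM ler_wpM2r.
move=> x y; have [xy|yx] := leP x y; last exact: main (ltW yx).
by rewrite distrC [`|x - y|]distrC; exact: main.
Qed.

Lemma uniform_cvgP (T : choiceType) (F : nat -> T -> R) (f : T -> R) :
  (forall e, 0 < e -> \forall n \near \oo, forall y, `|f y - F n y| < e) ->
  {uniform, F @ \oo --> f}.
Proof.
move=> h Q /= /uniform_nbhs[E [/= entE EQ]].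
move: entE; rewrite -entourage_from_ballE => -[e /= e0 he].
have := h e e0; apply: filterS => n hn; apply: EQ => y _.
by apply: he; rewrite -ball_normE /=; exact: hn.
Qed.

End smooth_functions.

Section partial_derivatives.
Variable R : realType.
Implicit Types f : R * R -> R.

Lemma shift_pair1 (h : R) (z : R * R) : h *: ((1 : R), (0 : R)) + z = (h * 1 + z.1, z.2).
Proof. by case: z => a b; congr (_, _); rewrite /= scaler0 add0r. Qed.

Lemma shift_pair2 (h : R) (z : R * R) : h *: ((0 : R), (1 : R)) + z = (z.1, h * 1 + z.2).
Proof. by case: z => a b; congr (_, _); rewrite /= scaler0 add0r. Qed.

Lemma derive_slice1 f (z : R * R) : 'D_(1, 0) f z = 'D_1 (fun t => f (t, z.2)) z.1.
Proof.
rewrite /derive; set d := (fun _ : R => _); set d' := (fun _ : R => _).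
suff -> : d = d' by []; apply/funext => h; rewrite /d /d' /=.
by rewrite shift_pair1 -surjective_pairing.
Qed.

Lemma derive_slice2 f (z : R * R) : 'D_(0, 1) f z = 'D_1 (fun x => f (z.1, x)) z.2.
Proof.
rewrite /derive; set d := (fun _ : R => _); set d' := (fun _ : R => _).
suff -> : d = d' by []; apply/funext => h; rewrite /d /d' /=.
by rewrite shift_pair2 -surjective_pairing.
Qed.

Lemma partials_prod (A B : R -> R) (w : seq bool) : smooth A -> smooth B ->
  partials w (fun z => A z.1 * B z.2) = fun z =>
    derive1n (count_mem true w) A z.1 * derive1n (count_mem false w) B z.2.
Proof.
move=> sA sB; elim: w => [//|b w IH]; apply/funext => z; rewrite /= IH.
case: b => /=; rewrite ?add0n ?add1n.
  by rewrite derive_slice1 -derive1E /= derive1Mr//; exact: sA.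
rewrite derive_slice2 -derive1E /=; set a := derive1n _ A z.1; set Bn := derive1n _ B.
rewrite (_ : (fun x => a * Bn x) = (fun x => Bn x * a)); last by apply/funext => x; rewrite mulrC.
have hB : derivable Bn z.2 1 by exact: sB.
transitivity (derive1 Bn z.2 * a); first exact: (derive1Mr _ hB).
by rewrite [LHS]mulrC.
Qed.

Lemma test_function_prod (A B : R -> R) (M : R) : smooth A ->
  (forall t, M < `|t| -> A t = 0) -> smoothT B ->
  test_function (fun z => A z.1 * B z.2).
Proof.
move=> sA AM [pB sB]; split.
- by move=> t x /=; rewrite pB.
- by exists M => t x /AM /= ->; rewrite mul0r.
- move=> w z; rewrite partials_prod//.
  apply: differentiableM.
    apply: (@differentiable_comp _ _ _ _ fst (derive1n _ A)).
      by apply: linear_differentiable => y; exact: cvg_fst.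
    by apply/derivable1_diffP; exact: sA.
  apply: (@differentiable_comp _ _ _ _ snd (derive1n _ B)).
    by apply: linear_differentiable => y; exact: cvg_snd.
  by apply/derivable1_diffP; exact: sB.
Qed.

Lemma test_function_slice f (x : R) : test_function f -> smooth (fun t => f (t, x)).
Proof.
move=> [_ _ df].
have E n : derive1n n (fun t => f (t, x)) = fun t => partials (nseq n true) f (t, x).
  elim: n => [//|n IH]; rewrite derive1nS IH; apply/funext => t.
  by rewrite derive1E /= derive_slice1.
move=> n t; rewrite E.
have /(@diff_derivable _ _ _ _ _ ((1 : R), (0 : R))) := df (nseq n true) (t, x).
rewrite /derivable; set d := (fun _ : R => _) => cd; set d' := (fun _ : R => _).
suff <- : d = d' by []; apply/funext => h; rewrite /d /d' /=.
by rewrite shift_pair1.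
Qed.

Lemma test_function_continuous f : test_function f -> continuous f.
Proof. by move=> [_ _ df] z; apply: differentiable_continuous; exact: (df [::] z). Qed.

End partial_derivatives.

(** * Convolution with the covariance *)

Section covariance_convolution.
Variable R : realType.

Lemma distributionTZ (Cov : (R -> R) -> R) (a : R) f : distributionT Cov -> smoothT f ->
  Cov (fun y => a * f y) = a * Cov f.
Proof.
move=> [lin _] sf; have := lin (a - 1) f f sf sf.
rewrite (_ : (fun x => (a - 1) * f x + f x) = (fun y => a * f y)); last first.
  by apply/funext => y; ring.
by move=> ->; ring.
Qed.

Lemma smoothT_shift (f : R -> R) x : smoothT f -> smoothT (fun y => f (y - x)).
Proof.
move=> [pf sf]; split; first by move=> y; rewrite addrAC pf.
have := @smooth_affine R f 1 (- x) sf.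
by rewrite (_ : (fun y => f (1 * y - x)) = (fun y => f (y - x)))//; apply/funext => y; rewrite mul1r.
Qed.

(** A discontinuity would give points tending to [x] with values staying away. Along them the
    translates of [f] converge uniformly with all derivatives, these being Lipschitz, against the
    sequential continuity of [Cov]. The sign in [y - x] makes [h 0 = Cov f]. *)
Lemma convT_continuous (Cov : (R -> R) -> R) f : distributionT Cov -> smoothT f ->
  exists h : CT R, forall x, h x = Cov (fun y => f (y - x)).
Proof.
move=> [lin cov] sf; pose H x := Cov (fun y => f (y - x)).
have pH : Defs.periodic H.
  move=> x; rewrite /H; congr Cov; apply/funext => y.
  by have [pf _] := sf; rewrite opprD addrA -[LHS]pf subrK.
have cH : continuous H.
  move=> x; apply/cvgrPdist_lt => e e0; apply: contrapT => nh.
  have /choice[s hs] : forall n : nat, exists y, `|x - y| < n.+1%:R^-1 /\ e <= `|H x - H y|.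
    move=> n; apply: contrapT => hn; apply: nh; apply/nbhs_ballP.
    exists n.+1%:R^-1; first by rewrite /= invr_gt0.
    move=> y /= xy; rewrite ltNge; apply/negP => ey.
    by apply: hn; exists y.
  have : H (s n) @[n --> \oo] --> H x.
    apply: (cov (fun n y => f (y - s n))) => [n||n]; [exact: smoothT_shift|exact: smoothT_shift|].
    have E c : derive1n n (fun y => f (y - c)) = fun y => derive1n n f (y - c).
      have [_ sf'] := sf; have := derive1n_affine 1 (- c) n sf'.
      rewrite (_ : (fun y => f (1 * y - c)) = (fun y => f (y - c))); last first.
        by apply/funext => y; rewrite mul1r.
      by move=> ->; apply/funext => y; rewrite expr1n !mul1r.
    have [K K0 hK] := smoothT_lipschitz n sf.
    apply: uniform_cvgP => d d0; have Kd : 0 < d / (K + 1) by rewrite divr_gt0// ltr_wpDl.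
    have /cvgrPdist_lt/(_ _ Kd) := @cvg_harmonic R; apply: filterS => k.
    rewrite sub0r normrN ger0_norm ?invr_ge0// => hk y; rewrite !E.
    apply: le_lt_trans (hK _ _) _; rewrite opprB addrC addrA subrK distrC.
    have [h1 _] := hs k; have h2 := lt_trans h1 hk.
    rewrite (@le_lt_trans _ _ ((K + 1) * `|x - s k|))//.
      by rewrite ler_wpM2r// lerDl.
    by rewrite mulrC -ltr_pdivlMr// ltr_wpDl.
  move=> /cvgrPdist_lt/(_ _ e0)[N _ /(_ N (leqnn N))].
  by rewrite ltNge; have [_ ->] := hs N.
have hC : H \in @CT_pred R by apply/asboolP.
by exists (MkCT hC).
Qed.

End covariance_convolution.

Section young.
Context {R : realType} {d} {T : measurableType d}.
Variable mu : {measure set T -> \bar R}.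

Lemma young_mul (e a b : R) : 0 < e -> `|a * b| <= e * a ^+ 2 + (4 * e)^-1 * b ^+ 2.
Proof.
move=> e0; rewrite normrM -(real_normK (num_real a)) -(real_normK (num_real b)).
have e4 : 0 < 4 * e by rewrite mulr_gt0.
rewrite -(ler_pM2l e4) mulrDr [X in _ <= _ + X]mulrA mulfV ?gt_eqF// mul1r.
have := sqr_ge0 (2 * e * `|a| - `|b|); rewrite sqrrB => h.
rewrite -subr_ge0; apply: le_trans h _.
by rewrite le_eqVlt; apply/orP; left; apply/eqP; rewrite mulr2n; ring.
Qed.

(** Cauchy-Schwarz replaced by the weighted Young inequality: the weight [e1] makes the part from
    [f] at most [e / 2], then [n] is taken large for the part from [g_]. *)
Lemma cvg_Rintegral_mul (f : T -> R) (g_ : nat -> T -> R) :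
  measurable_fun setT f -> (forall n, measurable_fun setT (g_ n)) ->
  (\int[mu]_x (f x ^+ 2)%:E < +oo)%E ->
  (forall n, mu.-integrable setT (EFin \o (fun x => f x * g_ n x))) ->
  (\int[mu]_x (g_ n x ^+ 2)%:E)%E @[n --> \oo] --> 0%E ->
  \int[mu]_x (f x * g_ n x) @[n --> \oo] --> 0.
Proof.
move=> mf mg f2 ifg g2.
have f20 : (0 <= \int[mu]_x (f x ^+ 2)%:E)%E by apply: integral_ge0 => x _; rewrite lee_fin sqr_ge0.
have /EFin_fin_numP[A AE] : (\int[mu]_x (f x ^+ 2)%:E)%E \is a fin_num.
  by rewrite ge0_fin_numE.
have A0 : 0 <= A by rewrite -lee_fin -AE.
apply/cvgrPdist_le => e e0; pose e1 := e / 2 / (A + 1).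
have e10 : 0 < e1 by rewrite !divr_gt0// ltr_wpDl.
have : \forall n \near \oo, (\int[mu]_x (g_ n x ^+ 2)%:E < (4 * e1 * (e / 2))%:E)%E.
  have := g2 [set x | (x < (4 * e1 * (e / 2))%:E)%E]; apply.
  apply: open_nbhs_nbhs; split; [exact: open_ereal_lt_ereal|].
  have p : 0 < 4 * e1 * (e / 2) by rewrite mulr_gt0// ?divr_gt0// mulr_gt0.
  by move: p; rewrite -lte_fin.
apply: filterS => n hn; rewrite sub0r normrN.
have msq (h : T -> R) : measurable_fun setT h -> measurable_fun setT (fun x => (h x ^+ 2)%:E).
  by move=> mh; apply/measurable_EFinP; exact: measurable_funX.
apply: le_trans (le_normr_Rintegral _ _) _ => //.
have fin : (\int[mu]_x (`|f x * g_ n x|)%:E)%E \is a fin_num.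
  have i := integrable_norm (ifg n).
  by apply: (integrable_fin_num measurableT i).
rewrite -lee_fin /Rintegral fineK//.
apply: (@le_trans _ _ (\int[mu]_x ((e1 * f x ^+ 2)%:E + ((4 * e1)^-1 * g_ n x ^+ 2)%:E))%E).
  apply: ge0_le_integral => //.
  - apply/measurable_EFinP; apply: measurableT_comp => //; exact: measurable_funM.
  - by apply: emeasurable_funD; apply/measurable_EFinP; apply: measurable_funM => //; exact: measurable_funX.
  - by move=> x _; rewrite -EFinD lee_fin young_mul.
rewrite ge0_integralD//; first last.
- by apply/measurable_EFinP; apply: measurable_funM => //; exact: measurable_funX.
- by move=> x _; rewrite lee_fin mulr_ge0 ?sqr_ge0// invr_ge0 mulr_ge0// ltW.
- by apply/measurable_EFinP; apply: measurable_funM => //; exact: measurable_funX.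
- by move=> x _; rewrite lee_fin mulr_ge0 ?sqr_ge0// ltW.
under eq_integral do rewrite EFinM.
under [X in (_ + X)%E]eq_integral do rewrite EFinM.
have e4 : 0 < 4 * e1 by rewrite mulr_gt0.
rewrite !ge0_integralZl//; try by [exact: msq|move=> x _; rewrite lee_fin sqr_ge0|rewrite lee_fin ltW// ?invr_gt0].
rewrite AE [e]splitr EFinD; apply: leeD.
  by rewrite -EFinM lee_fin /e1 mulrAC ler_pdivrMr ?ltr_wpDl// ler_pM2l ?divr_gt0// lerDl.
rewrite -lee_pdivlMl ?invr_gt0// invrK -EFinM; exact: ltW.
Qed.

End young.

Section wiener_constant.
Context {R : realType} {d} {Omega : measurableType d}.
Variable Pr : probability Omega R.
Local Notation leb := (@lebesgue_measure R).

(** The pairing is the covariance of [xi g] and [xi (F n)]. As [xi g] is centred, the constant [z]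
    may be subtracted from the second factor, which then tends to 0 in L^2. *)
Lemma wiener_constant_pairing (Cov : (R -> R) -> R) xi (F : nat -> R * R -> R)
    (Z : Omega -> R) (z : R) g :
  noise Pr Cov xi -> (forall n, test_function (F n)) -> measurable_fun setT Z ->
  (\forall w \ae Pr, Z w = z) ->
  (\int[Pr]_w ((xi (F n) w - Z w) ^+ 2)%:E)%E @[n --> \oo] --> 0%E ->
  test_function g ->
  \int[leb]_t \int[leb]_(x in `[0, 1]) (convT Cov (fun y => g (t, y)) x * F n (t, x))
    @[n --> \oo] --> 0.
Proof.
move=> [_ gxi exi cxi] tF mZ Zz FZ tg.
have mxi f : test_function f -> measurable_fun setT (xi f) by move=> /gxi[].
have ecov f h : test_function f -> test_function h ->
    (\int[Pr]_w (xi f w * xi h w)%:E = (\int[leb]_t \int[leb]_(x in `[0%R, 1%R])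
      (convT Cov (fun y => f (t, y)) x * h (t, x)))%R%:E)%E.
  by move=> tf th; rewrite -cxi// unlock.
have e0 f : test_function f -> (\int[Pr]_w (xi f w)%:E = 0)%E.
  by move=> tf; rewrite -(exi f tf) unlock.
have sq f : test_function f -> exists C, (\int[Pr]_w (xi f w ^+ 2)%:E <= C%:E)%E.
  move=> tf; have := ecov f f tf tf; set r := (X in X%:E) => h; exists r; rewrite -h.
  by under eq_integral do rewrite expr2.
have isq f : test_function f -> Pr.-integrable setT (EFin \o (fun w => xi f w ^+ 2)).
  move=> tf; have [C hC] := sq f tf; apply/integrableP; split.
    by apply/measurable_EFinP; apply: measurable_funX; exact: mxi.
  apply: le_lt_trans (ltry C); apply: le_trans hC.
  rewrite le_eqVlt; apply/orP; left; apply/eqP; apply: eq_integral => w _ /=.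
  by rewrite ger0_norm// sqr_ge0.
have i1 f : test_function f -> Pr.-integrable setT (EFin \o xi f).
  by move=> tf; have [C hC] := sq f tf; apply: integrable_square hC; exact: mxi.
have i2 n : Pr.-integrable setT (EFin \o (fun w => xi g w * xi (F n) w)).
  have iD := integrableD measurableT (isq g tg) (isq (F n) (tF n)).
  apply: le_integrable iD => //.
    by apply/measurable_EFinP; apply: measurable_funM; exact: mxi.
  move=> w _ /=; rewrite lee_fin normrM [leRHS]ger0_norm ?addr_ge0 ?sqr_ge0//.
  have := sqr_ge0 (`|xi g w| - `|xi (F n) w|); rewrite sqrrB !real_normK ?num_real// mulr2n.
  have := mulr_ge0 (normr_ge0 (xi g w)) (normr_ge0 (xi (F n) w)); lra.
have i3 : Pr.-integrable setT (EFin \o (fun w => z * xi g w)).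
  have := integrableZl measurableT z (i1 g tg); exact.
have i4 n : Pr.-integrable setT (EFin \o (fun w => xi g w * (xi (F n) w - z))).
  have iB := integrableB measurableT (i2 n) i3.
  apply: eq_integrable iB => //.
  by move=> w _ /=; rewrite -EFinB; congr (_%:E); ring.
have -> : (fun n => \int[leb]_t \int[leb]_(x in `[0, 1]) (convT Cov (fun y => g (t, y)) x * F n (t, x)))
    = (fun n => \int[Pr]_w (xi g w * (xi (F n) w - z))).
  apply/funext => n.
  have -> : \int[Pr]_w (xi g w * (xi (F n) w - z)) = \int[Pr]_w (xi g w * xi (F n) w - z * xi g w).
    by apply: eq_Rintegral => w _; ring.
  rewrite RintegralB// RintegralZl//; last exact: i1.
  by rewrite /Rintegral e0//= mulr0 subr0 ecov.
apply: cvg_Rintegral_mul => //.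
- exact: mxi.
- by move=> n; apply: measurable_funB => //; exact: mxi.
- by have [C hC] := sq g tg; apply: le_lt_trans hC (ltry C).
- have -> // : (fun n => (\int[Pr]_w ((xi (F n) w - z) ^+ 2)%:E)%E) =
    (fun n => (\int[Pr]_w ((xi (F n) w - Z w) ^+ 2)%:E)%E).
  apply/funext => n; apply: ae_eq_integral => //.
  + by apply/measurable_EFinP; apply: measurable_funX; apply: measurable_funB => //; exact: mxi.
  + by apply/measurable_EFinP; apply: measurable_funX; apply: measurable_funB => //; exact: mxi.
  + by apply: filterS Zz => w -> _.
Qed.

End wiener_constant.

(** * Pairing with the Duhamel kernel *)

Section duhamel_pairing.
Variable R : realType.
Local Notation leb := (@lebesgue_measure R).
Local Notation leb2 := (leb \x leb)%E.
Let i01 (p : R * R) : R := \1_`[0%R, 1%R] p.2.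

Let mi01 : measurable_fun setT i01.
Proof.
have mi : measurable_fun setT (\1_`[0%R, 1%R] : R -> R) by exact: measurable_indic.
exact: (measurableT_comp mi measurable_snd).
Qed.

Let i01_sq p : i01 p * i01 p = i01 p.
Proof. by rewrite /i01 indicE; case: (_ \in _); rewrite ?mulr1 ?mulr0. Qed.

Let i01_ge0 p : 0 <= i01 p. Proof. by []. Qed.

Lemma integral_prod01 (psi : R * R -> R) : measurable_fun setT psi -> (forall p, 0 <= psi p) ->
  (\int[leb2]_p (psi p * i01 p)%:E = \int[leb]_t \int[leb]_(x in `[0%R, 1%R]) (psi (t, x))%:E)%E.
Proof.
move=> mpsi psi0; pose phi p := (psi p * i01 p)%:E.
have mphi : measurable_fun setT phi by apply/measurable_EFinP; exact: measurable_funM.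
have phi0 p : (0 <= phi p)%E by rewrite lee_fin mulr_ge0.
rewrite (fubini_tonelli1 (m1 := leb) (m2 := leb) phi mphi phi0) /fubini_F.
by apply: eq_integral => t _; rewrite (integral01_indic (fun x => psi (t, x))).
Qed.

Lemma Rintegral_prod01 (psi : R * R -> R) :
  leb2.-integrable setT (EFin \o (fun p => psi p * i01 p)) ->
  (forall t, (\int[leb]_(x in `[0%R, 1%R]) (psi (t, x))%:E)%E \is a fin_num) ->
  \int[leb]_t \int[leb]_(x in `[0, 1]) psi (t, x) = \int[leb2]_p (psi p * i01 p).
Proof.
move=> ipsi fpsi; rewrite /Rintegral.
rewrite -[in RHS](integral12_prod_meas1 (m1 := leb) (m2 := leb) ipsi) /fubini_F.
congr fine; apply: eq_integral => t _.
by rewrite fineK// (integral01_indic (fun x => psi (t, x))).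
Qed.

Lemma duhamel_kernel_integrable :
  leb2.-integrable setT (EFin \o (fun p => duhamel_kernel 1 0 p * i01 p)).
Proof.
have mk := @measurable_duhamel_kernel R 1 0.
apply/integrableP; split; first by apply/measurable_EFinP; exact: measurable_funM.
apply: (@le_lt_trans _ _ (\int[leb2]_p (duhamel_kernel 1 0 p * i01 p)%:E)%E).
  rewrite le_eqVlt; apply/orP; left; apply/eqP; apply: eq_integral => p _ /=.
  by rewrite ger0_norm// mulr_ge0// duhamel_kernel_ge0.
rewrite integral_prod01//; last exact: duhamel_kernel_ge0.
have E t : (\int[leb]_(x in `[0%R, 1%R]) (duhamel_kernel 1 0 (t, x))%:E = (\1_`]0%R, 1%R[ t)%:E)%E.
  rewrite indicE mem_setE in_itv/=; have [t01|t01] := boolP (0 < t < 1).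
    have c1 : continuous (fun _ : R => 1 : R) by move=> y; exact: cvg_cst.
    have := integral_duhamel_kernel 0 t01 c1; rewrite heat_cst => <-.
    by apply: eq_integral => y _; rewrite mulr1.
  by rewrite integral0_eq// => y _; rewrite /duhamel_kernel /= (negbTE t01).
under eq_integral do rewrite E.
by rewrite integral_indic//= setIT lebesgue_measure_itv/= lte_fin ltr01 -EFinB ltry.
Qed.

(** The product [b * F n] is split as [b * (F n - k) + b * k]: only the difference [F n - k] is used
    in L^2, against the bounded and compactly supported [b], while the kernel [k] itself enters
    through L^1. *)
Lemma duhamel_pairing_eq0 (F : nat -> R * R -> R) (a : R -> R) (h : CT R) (M : R) :
  (forall n, measurable_fun setT (F n)) -> (forall n t, continuous (fun x => F n (t, x))) ->
  continuous a -> (forall t, M < `|t| -> a t = 0) ->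
  (forall n, \int[leb]_t \int[leb]_(x in `[0%R, 1%R])
     ((F n (t, x) - duhamel_kernel 1 0 (t, x)) ^+ 2)%:E < +oo)%E ->
  (\int[leb]_t \int[leb]_(x in `[0%R, 1%R])
     ((F n (t, x) - duhamel_kernel 1 0 (t, x)) ^+ 2)%:E)%E @[n --> \oo] --> 0%E ->
  \int[leb]_t \int[leb]_(x in `[0, 1]) (a t * h x * F n (t, x)) @[n --> \oo] --> 0 ->
  \int[leb]_t (if 0 < t < 1 then a t * heat (1 - t) h 0 else 0) = 0.
Proof.
move=> mF cF ca aM Ffin Fcvg pcvg.
pose k := @duhamel_kernel R 1 0; have mk : measurable_fun setT k by exact: measurable_duhamel_kernel.
pose b (p : R * R) := a p.1 * h p.2.
have mb : measurable_fun setT b.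
  apply: measurable_funM.
    by apply: (measurableT_comp (f := a)) => //; exact: continuous_measurable_fun.
  by apply: (measurableT_comp (f := h)) => //; apply: continuous_measurable_fun; exact: CT_continuous.
have [Ca Ca0 hCa] : exists2 C, 0 <= C & forall t, `|a t| <= C.
  have cn : {within `[- `|M|, `|M|], continuous (fun t => `|a t|)}.
    by apply: continuous_subspaceT => t; apply: cvg_norm; exact: ca.
  have MM : - `|M| <= `|M| by rewrite (@le_trans _ _ 0)// oppr_le0.
  have [c _ hc] := EVT_max MM cn; exists `|a c| => // t.
  have [tM|tM] := leP `|t| `|M|; first by apply: hc; rewrite in_itv/= -ler_norml.
  by rewrite aM ?normr0//; apply: le_lt_trans tM; exact: ler_norm.
pose C := Ca * `|h|; have C0 : 0 <= C by rewrite mulr_ge0.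
have bC p : `|b p| <= C by rewrite /b normrM; apply: ler_pM => //; exact: CT_le_norm.
pose f p := b p * i01 p; pose g n p := (F n p - k p) * i01 p.
have mf : measurable_fun setT f by exact: measurable_funM.
have mg n : measurable_fun setT (g n) by apply: measurable_funM => //; exact: measurable_funB.
have gE n : (\int[leb2]_p (g n p ^+ 2)%:E = \int[leb]_t \int[leb]_(x in `[0%R, 1%R])
     ((F n (t, x) - duhamel_kernel 1 0 (t, x)) ^+ 2)%:E)%E.
  rewrite -(integral_prod01 (psi := fun p => (F n p - k p) ^+ 2)).
  - by apply: eq_integral => p _; rewrite /g exprMn [i01 p ^+ 2]i01_sq.
  - by apply: measurable_funX; exact: measurable_funB.
  - by move=> p; exact: sqr_ge0.
have f2 : (\int[leb2]_p (f p ^+ 2)%:E < +oo)%E.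
  apply: (@le_lt_trans _ _ (\int[leb2]_p ((C ^+ 2 * \1_`[- `|M|, `|M|] p.1) * i01 p)%:E)%E).
    apply: ge0_le_integral => //.
    - by move=> p _; rewrite lee_fin sqr_ge0.
    - by apply/measurable_EFinP; exact: measurable_funX.
    - apply/measurable_EFinP; apply: measurable_funM => //; apply: measurable_funM => //.
      have mi : measurable_fun setT (\1_`[- `|M|, `|M|] : R -> R) by exact: measurable_indic.
      exact: (measurableT_comp mi measurable_fst).
    - move=> p _; rewrite lee_fin /f exprMn [i01 p ^+ 2]i01_sq; apply: ler_wpM2r => //.
      rewrite indicE mem_setE in_itv/= -ler_norml.
      have [pM|pM] := leP `|p.1| `|M|.
        by rewrite mulr1 -(real_normK (num_real (b p))) lerXn2r// nnegrE.
      rewrite mulr0 /b aM ?mul0r ?expr0n//.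
      by apply: le_lt_trans pM; exact: ler_norm.
  rewrite (integral_prod01 (psi := fun p => C ^+ 2 * \1_`[- `|M|, `|M|] p.1)); last 2 first.
  - apply: measurable_funM => //.
    have mi : measurable_fun setT (\1_`[- `|M|, `|M|] : R -> R) by exact: measurable_indic.
    exact: (measurableT_comp mi measurable_fst).
  - by move=> p; rewrite mulr_ge0// sqr_ge0.
  have E t : (\int[leb]_(x in `[0%R, 1%R]) (C ^+ 2 * \1_`[- `|M|, `|M|] t)%:E =
      (C ^+ 2)%:E * (\1_`[- `|M|, `|M|] t)%:E)%E.
    rewrite -EFinM; have := integral_cst leb (measurable_itv `[0%R, 1%R]) (C ^+ 2 * \1_`[- `|M|, `|M|] t)%:E.
    by rewrite /cst => ->; rewrite /= lebesgue_measure_itv/= lte_fin ltr01 oppr0 adde0 mule1.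
  under eq_integral do rewrite /= E.
  rewrite ge0_integralZl//; last 2 first.
  - by apply/measurable_EFinP; exact: measurable_indic.
  - by rewrite lee_fin sqr_ge0.
  rewrite integral_indic//= setIT lebesgue_measure_itv/= lte_fin.
  by case: ifP => _; rewrite ?mule0 ?ltry// -EFinB -EFinM ltry.
have ifg n : leb2.-integrable setT (EFin \o (fun p => f p * g n p)).
  have sqi (u : R * R -> R) : measurable_fun setT u -> (\int[leb2]_p (u p ^+ 2)%:E < +oo)%E ->
      leb2.-integrable setT (EFin \o (fun p => u p ^+ 2)).
    move=> mu_ u2; apply/integrableP; split; first by apply/measurable_EFinP; exact: measurable_funX.
    apply: le_lt_trans u2; rewrite le_eqVlt; apply/orP; left; apply/eqP.
    by apply: eq_integral => w _ /=; rewrite ger0_norm// sqr_ge0.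
  have g2 : (\int[leb2]_p (g n p ^+ 2)%:E < +oo)%E by rewrite gE.
  have iD := integrableD measurableT (sqi _ mf f2) (sqi _ (mg n) g2).
  apply: le_integrable iD => //.
    by apply/measurable_EFinP; exact: (measurable_funM mf (mg n)).
  move=> w _ /=; rewrite lee_fin normrM [leRHS]ger0_norm ?addr_ge0 ?sqr_ge0//.
  have := sqr_ge0 (`|f w| - `|g n w|); rewrite sqrrB !real_normK ?num_real// mulr2n.
  have := mulr_ge0 (normr_ge0 (f w)) (normr_ge0 (g n w)); lra.
have ibk : leb2.-integrable setT (EFin \o (fun p => b p * k p * i01 p)).
  have iC := integrableZl measurableT C duhamel_kernel_integrable.
  apply: le_integrable iC => //.
    by apply/measurable_EFinP; apply: measurable_funM => //; exact: measurable_funM.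
  move=> p _ /=; rewrite lee_fin -mulrA normrM.
  rewrite [leRHS]ger0_norm; last by rewrite mulr_ge0// mulr_ge0// duhamel_kernel_ge0.
  rewrite [X in _ * X <= _]ger0_norm; last by rewrite mulr_ge0// duhamel_kernel_ge0.
  by apply: ler_wpM2r => //; rewrite mulr_ge0// duhamel_kernel_ge0.
have ibF n : leb2.-integrable setT (EFin \o (fun p => b p * F n p * i01 p)).
  have iD := integrableD measurableT (ifg n) ibk.
  apply: eq_integrable iD => // p _ /=; rewrite -EFinD; congr (_%:E).
  have -> : f p * g n p = b p * (F n p - k p) * (i01 p * i01 p) by rewrite /f /g; ring.
  by rewrite i01_sq; ring.
have kE t : (\int[leb]_(x in `[0%R, 1%R]) (b (t, x) * k (t, x))%:E =
    (if 0 < t < 1 then a t * heat (1 - t) h 0 else 0)%:E)%E.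
  have [t01|t01] := boolP (0 < t < 1).
    rewrite -heatZ; last exact: CT_continuous.
    rewrite -(integral_duhamel_kernel 0 t01); last by move=> y; apply: cvgMr; exact: CT_continuous.
    by apply: eq_integral => x _; rewrite /b /k /=; congr (_%:E); ring.
  by rewrite integral0_eq// => y _; rewrite /k /duhamel_kernel /= (negbTE t01) mulr0.
have Fn n : \int[leb]_t \int[leb]_(x in `[0, 1]) (a t * h x * F n (t, x)) =
    \int[leb2]_p (b p * F n p * i01 p).
  rewrite -(Rintegral_prod01 (psi := fun p => b p * F n p))// => t.
  apply: integrable_fin_num => //; apply: (@continuous_integrable01 _ (fun x => b (t, x) * F n (t, x))).
  have cb : continuous (fun x => a t * h x) by move=> x; apply: cvgMr; exact: CT_continuous.
  by move=> x; exact: (cvgM (cb x) (cF n t x)).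
have kn : \int[leb]_t (if 0 < t < 1 then a t * heat (1 - t) h 0 else 0) =
    \int[leb2]_p (b p * k p * i01 p).
  rewrite -(Rintegral_prod01 (psi := fun p => b p * k p))//; last by move=> t; rewrite kE.
  by apply: eq_Rintegral => t _; rewrite [in RHS]/Rintegral kE.
rewrite kn.
have l1 := cvg_Rintegral_mul (mu := leb2) mf mg f2 ifg.
have {}l1 : \int[leb2]_p (f p * g n p) @[n --> \oo] --> 0.
  by apply: l1; under eq_fun do rewrite gE.
have fgE n : \int[leb2]_p (f p * g n p) =
    \int[leb2]_p (b p * F n p * i01 p) - \int[leb2]_p (b p * k p * i01 p).
  rewrite -RintegralB//; apply: eq_Rintegral => p _.
  have -> : f p * g n p = b p * (F n p - k p) * (i01 p * i01 p) by rewrite /f /g; ring.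
  by rewrite i01_sq; ring.
have l2 : \int[leb2]_p (f p * g n p) @[n --> \oo] --> 0 - \int[leb2]_p (b p * k p * i01 p).
  under eq_fun do rewrite fgE -Fn; apply: cvgB => //; exact: cvg_cst.
have E : 0 = 0 - \int[leb2]_p (b p * k p * i01 p) := cvg_unique (@Rhausdorff R) l1 l2.
by apply/eqP; rewrite -oppr_eq0 -[- _]sub0r -E.
Qed.

Lemma heat_near0 (f : CT R) x (e : R) : 0 < e ->
  exists2 r, 0 < r & forall s, 0 <= s < r -> `|heat s f x - f x| <= e.
Proof.
move=> e0; have e2 : 0 < e / 2 by rewrite divr_gt0.
have [K K0 hK] := periodic_le_cos f x e2.
pose q (s : R) := K * (1 - expR (- (2 * pi) ^+ 2 * s)).
have cq : continuous q.
  move=> s; apply: cvgMr; apply: cvgB; first exact: cvg_cst.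
  apply: (@continuous_comp _ _ _ (fun s => - (2 * pi) ^+ 2 * s) expR); last exact: continuous_expR.
  exact: mulrl_continuous.
have q0 : q 0 = 0 by rewrite /q mulr0 expR0 subrr mulr0.
have /cvgrPdist_lt/(_ _ e2)/nbhs_ballP[r /= r0 hr] := cq 0.
exists r => // s /andP[s0 sr].
apply: le_trans (heat_korovkin s0 (@CT_continuous R f) hK) _.
rewrite [leRHS](splitr e) lerD2l; apply: ltW.
have : `|q 0 - q s| < e / 2 by apply: hr; rewrite -ball_normE /= sub0r normrN ger0_norm.
by rewrite q0 sub0r normrN; apply: le_lt_trans; exact: ler_norm.
Qed.

(** For [t] within [r] of 1 the value [heat (1 - t) h 0] stays within half of [h 0] and keeps its
    sign, so a nonnegative bump supported there admits no cancellation. The radius depends on [h]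
    alone, before the bump is chosen. *)
Lemma duhamel_pairing_neq0 (h : CT R) : h 0 != 0 ->
  exists2 r, 0 < r & forall a : R -> R, continuous a -> (forall t, 0 <= a t) -> 0 < a 1 ->
    (forall t, r <= `|t - 1| -> a t = 0) ->
    \int[leb]_t (if 0 < t < 1 then a t * heat (1 - t) h 0 else 0) != 0.
Proof.
move=> h0; have hh : 0 < `|h 0| / 2 by rewrite divr_gt0// normr_gt0.
have [r r0 hr] := heat_near0 h 0 hh; exists r => // a ca a0 a1 ar.
pose H t := heat (1 - t) h 0.
have iH : leb.-integrable `]0%R, 1%R[ (EFin \o H).
  have cv : {within `[0, 1], continuous (fun _ : R => h)}.
    by apply: continuous_subspaceT => s; exact: cvg_cst.
  have t01 : 0 < (1 : R) <= 1 by rewrite ltr01 lexx.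
  (* The drift of the polynomial ['X] along the constant path [h]. *)
  have := heat_path_integrable cv 'X 0 t01; congr (_.-integrable _ _).
  apply/funext => s /=; congr (heat _ _ _)%:E; apply/funext => y; exact: hornerX.
have [C C0 hC] : exists2 C, 0 <= C & forall t, `]0%R, 1%R[%classic t -> `|a t| <= C.
  have [c _ hc] := EVT_max (@ler01 R) (continuous_subspaceT ca).
  by exists (a c) => // t /= t01; rewrite ger0_norm//; apply: hc; apply: subset_itv_oo_cc.
have iaH : leb.-integrable `]0%R, 1%R[ (EFin \o (fun t => a t * H t)).
  have iC : leb.-integrable `]0%R, 1%R[ (fun t => C%:E * (EFin \o H) t)%E by apply: integrableZl.
  apply: le_integrable iC => //.
    apply/measurable_EFinP; apply: measurable_funM.
      by apply: measurable_funTS; exact: continuous_measurable_fun.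
    by apply/measurable_EFinP; exact: (measurable_int leb iH).
  move=> t t01 /=; rewrite lee_fin !normrM; apply: ler_wpM2r => //.
  by rewrite [leRHS]ger0_norm//; exact: hC.
have -> : \int[leb]_t (if 0 < t < 1 then a t * heat (1 - t) h 0 else 0) =
    \int[leb]_(t in `]0, 1[) (a t * H t).
  rewrite [RHS]Rintegral_mkcond; apply: eq_Rintegral => t _.
  by rewrite patchE mem_setE in_itv/=.
have a12 : 0 < a 1 / 2 by rewrite divr_gt0.
have /cvgrPdist_lt/(_ _ a12)/nbhs_ballP[eta0 /= eta00 heta] := ca 1.
pose eta := Num.min eta0 1; have eta_gt0 : 0 < eta by rewrite lt_min eta00 ltr01.
(* Lower bound of [h 0] times the integrand on ]1 - eta, 1[, where [a] exceeds half of [a 1]. *)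
pose c0 := h 0 ^+ 2 / 2 * (a 1 / 2).
have c00 : 0 < c0 by rewrite mulr_gt0// divr_gt0// exprn_even_gt0.
pose I t : R := \1_`]1 - eta, 1%R[ t.
have lo t : `]0%R, 1%R[%classic t -> c0 * I t <= h 0 * (a t * H t).
  rewrite /= in_itv/= => /andP[t0 t1]; rewrite /I indicE mem_setE in_itv/= t1 andbT.
  have aH0 : h 0 ^+ 2 / 2 * a t <= h 0 * (a t * H t).
    rewrite mulrC [leRHS]mulrCA; have [rt|rt] := leP r `|t - 1|; first by rewrite ar// !mul0r.
    apply: ler_wpM2l => //.
    have : `|H t - h 0| <= `|h 0| / 2.
      apply: hr; rewrite subr_ge0 ltW//=; apply: le_lt_trans rt; rewrite distrC; exact: ler_norm.
    move=> hs; have : - (h 0 * (H t - h 0)) <= h 0 ^+ 2 / 2.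
      apply: le_trans (ler_norm _) _; rewrite normrN normrM -(real_normK (num_real (h 0))).
      by rewrite expr2 -mulrA; apply: ler_wpM2l.
    lra.
  apply: le_trans aH0; rewrite /c0 -mulrA ler_wpM2l ?divr_ge0 ?sqr_ge0//.
  have [e1|e1] := ltP (1 - eta) t; last by rewrite mulr0.
  rewrite mulr1; have : `|a 1 - a t| < a 1 / 2.
    apply: heta; rewrite -ball_normE /= gtr0_norm ?subr_gt0//.
    by rewrite ltrBlDr -ltrBlDl; apply: le_lt_trans e1; rewrite lerB// ge_min lexx.
  by move=> /(le_lt_trans (ler_norm _)); lra.
have iI : leb.-integrable `]0%R, 1%R[ (EFin \o (fun t => c0 * I t)).
  apply: measurable_bounded_integrable => //.
  - by rewrite /= lebesgue_measure_itv/= lte_fin ltr01 -EFinB ltry.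
  - by apply: measurable_funM => //; apply: measurable_funTS; exact: measurable_indic.
  - exists c0; split; first exact: num_real.
    move=> M' MM' s _ /=; apply: le_trans (ltW MM'); rewrite normrM (gtr0_norm c00).
    by rewrite ler_piMr ?(ltW c00)// /I indicE; case: (_ \in _); rewrite ?normr1 ?normr0.
have hI : \int[leb]_(t in `]0, 1[) (c0 * I t) = c0 * eta.
  rewrite /Rintegral.
  have -> : (\int[leb]_(t in `]0%R, 1%R[) (c0 * I t)%:E = (c0 * eta)%:E)%E; last by [].
  under eq_integral do rewrite EFinM.
  have c0' : (0 <= c0%:E)%E by rewrite lee_fin ltW.
  have I0 t : `]0%R, 1%R[%classic t -> (0 <= (I t)%:E)%E by rewrite lee_fin.
  have mI : measurable_fun (`]0%R, 1%R[%classic : set R) (fun t => (I t)%:E).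
    by apply/measurable_EFinP; apply: measurable_funTS; exact: measurable_indic.
  rewrite ge0_integralZl//.
  rewrite integral_indic// (_ : _ `&` _ = `]1 - eta, 1%R[%classic); last first.
    apply/seteqP; split => t /=; first by case.
    rewrite !in_itv/= => /andP[h1 h2]; rewrite h1 h2; split => //; rewrite andbT.
    by apply: le_lt_trans h1; rewrite subr_ge0 ge_min lexx orbT.
  rewrite /= lebesgue_measure_itv/= lte_fin ltrBlDr ltrDl eta_gt0 -EFinB -EFinM.
  by congr (_ * _)%:E; rewrite opprB addrC subrK.
apply/negP => /eqP J0.
have ihaH : leb.-integrable `]0%R, 1%R[ (EFin \o (fun t => h 0 * (a t * H t))).
  have i : leb.-integrable `]0%R, 1%R[ (fun t => (h 0)%:E * (EFin \o (fun t => (a t * H t)%R)) t)%E.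
    by apply: integrableZl.
  exact: i.
have : \int[leb]_(t in `]0, 1[) (c0 * I t) <= \int[leb]_(t in `]0, 1[) (h 0 * (a t * H t)).
  exact: le_Rintegral.
by rewrite hI RintegralZl// J0 mulr0 leNgt mulr_gt0.
Qed.

(* The bump in time is cut out of the test functions approximating the Duhamel
   kernel: one of them is nonzero at some [(s0, x0)], and its squared, rescaled
   slice through [x0] is smooth, nonnegative and supported near time 1. *)
Lemma pairing_test_function (Cov : (R -> R) -> R) (F : nat -> R * R -> R) :
  distributionT Cov -> (exists f, smoothT f /\ Cov f != 0) ->
  (forall n, test_function (F n)) ->
  (\int[leb]_t \int[leb]_(x in `[0%R, 1%R])
     ((F n (t, x) - duhamel_kernel 1 0 (t, x)) ^+ 2)%:E)%E @[n --> \oo] --> 0%E ->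
  exists2 g, test_function g &
    ~ (\int[leb]_t \int[leb]_(x in `[0, 1]) (convT Cov (fun y => g (t, y)) x * F n (t, x))
      @[n --> \oo] --> 0).
Proof.
move=> Cd [f [sf Cf]] tF Fcvg.
have [h hE] := convT_continuous Cd sf.
have h0 : h 0 != 0.
  by rewrite hE (_ : (fun y => f (y - 0)) = f)//; apply/funext => y; rewrite subr0.
have [r r0 hr] := duhamel_pairing_neq0 h0.
have [N0 _ hN0] : \forall n \near \oo, (\int[leb]_t \int[leb]_(x in `[0%R, 1%R])
     ((F n (t, x) - duhamel_kernel 1 0 (t, x)) ^+ 2)%:E < 1%:E)%E.
  have := Fcvg [set x | (x < 1%:E)%E]; apply.
  by apply: open_nbhs_nbhs; split; [exact: open_ereal_lt_ereal|rewrite /= lte_fin].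
(* From [N0] on the squared distances to the kernel are finite. Clipping the space variable puts
   [F'] in the form treated by [caratheodory_measurable] and changes nothing on the period
   [0, 1]. *)
pose F' n (p : R * R) := F (n + N0)%N (p.1, clip01 p.2).
have cF n t : continuous (fun x => F n (t, x)).
  move=> x; apply: (@continuous_comp _ _ _ (fun x : R => (t, x)) (F n)); last exact: test_function_continuous.
  move=> B [[B1 B2] [/= hB1 hB2] hB]; apply: filterS hB2 => y yB2; apply: hB; split => //=.
  exact: nbhs_singleton.
have cFt n x : continuous (fun t => F n (t, x)).
  move=> t; apply: (@continuous_comp _ _ _ (fun t : R => (t, x)) (F n)); last exact: test_function_continuous.
  move=> B [[B1 B2] [/= hB1 hB2] hB]; apply: filterS hB1 => y yB1; apply: hB; split => //=.
  exact: nbhs_singleton.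
have mF' n : measurable_fun setT (F' n).
  apply: (@caratheodory_measurable _ _ _ (fun x t => F (n + N0)%N (t, x))).
    by move=> x _; exact: continuous_measurable_fun.
  by move=> t; exact: continuous_subspaceT.
have cF' n t : continuous (fun x => F' n (t, x)).
  move=> x; apply: (@continuous_comp _ _ _ (@clip01 R) (fun x => F (n + N0)%N (t, x))).
    exact: continuous_clip01.
  exact: cF.
have F'E n : (\int[leb]_t \int[leb]_(x in `[0%R, 1%R])
     ((F' n (t, x) - duhamel_kernel 1 0 (t, x)) ^+ 2)%:E = \int[leb]_t \int[leb]_(x in `[0%R, 1%R])
     ((F (n + N0)%N (t, x) - duhamel_kernel 1 0 (t, x)) ^+ 2)%:E)%E.
  apply: eq_integral => t _; apply: eq_integral => x; rewrite inE/= in_itv/= => x01.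
  by rewrite /F' /= clip01_id.
have shift (T : topologicalType) (q : nat -> T) (l : T) :
    q n @[n --> \oo] --> l -> q (n + N0)%N @[n --> \oo] --> l.
  by apply: cvg_comp; exact: cvg_addnr.
have key (a : R -> R) : continuous a -> (forall t, 0 <= a t) -> 0 < a 1 ->
    (forall t, r <= `|t - 1| -> a t = 0) ->
    ~ (\int[leb]_t \int[leb]_(x in `[0, 1]) (a t * h x * F' n (t, x)) @[n --> \oo] --> 0).
  move=> ca a0 a1 ar pc; apply/negP: (hr a ca a0 a1 ar); rewrite negbK; apply/eqP.
  have aM t : 1 + r < `|t| -> a t = 0.
    by move=> rt; apply: ar; have := lerB_dist t 1; rewrite normr1; lra.
  have Ffin n : (\int[leb]_t \int[leb]_(x in `[0%R, 1%R])
     ((F' n (t, x) - duhamel_kernel 1 0 (t, x)) ^+ 2)%:E < +oo)%E.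
    rewrite F'E; apply: lt_le_trans (hN0 (n + N0)%N _) (leey _).
    by rewrite /= leq_addl.
  have Fc : (\int[leb]_t \int[leb]_(x in `[0%R, 1%R])
     ((F' n (t, x) - duhamel_kernel 1 0 (t, x)) ^+ 2)%:E)%E @[n --> \oo] --> 0%E.
    under eq_fun do rewrite F'E.
    exact: (shift _ (fun n => (\int[leb]_t \int[leb]_(x in `[0%R, 1%R])
     ((F n (t, x) - duhamel_kernel 1 0 (t, x)) ^+ 2)%:E)%E)).
  exact: (@duhamel_pairing_eq0 F' a h (1 + r) mF' cF' ca aM Ffin Fc pc).
(* Otherwise all pairings vanish, which contradicts [key] for a tent function around time 1. *)
have [n [[s0 x0] /= Fn0]] : exists n z, F n z != 0.
  apply: contrapT => nF; have F0 n z : F n z = 0.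
    by apply/eqP/negPn/negP => Fnz; apply: nF; exists n, z.
  pose a (t : R) := Num.max 0 (r - `|t - 1|).
  apply: (key a).
  - move=> t; apply: (@continuous_max R R (cst 0) (fun t => r - `|t - 1|)); first exact: cvg_cst.
    apply: cvgB; first exact: cvg_cst.
    by apply: cvg_norm; apply: cvgB => //; exact: cvg_cst.
  - by move=> t; rewrite /a le_max lexx.
  - by rewrite /a subrr normr0 subr0 lt_max r0 orbT.
  - by move=> t rt; rewrite /a max_l// subr_le0.
  - apply: cvg_near_cst; apply: nearW => n.
    have J0 t : \int[leb]_(x in `[0, 1]) (a t * h x * F' n (t, x)) = 0.
      by rewrite /Rintegral integral0_eq// => x _; rewrite /F' F0 mulr0.
    under eq_Rintegral do rewrite J0.
    by rewrite /Rintegral integral0_eq.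
have [pF [M hM] dF] := tF n.
(* The map [t -> l * (t - 1) + s0] sends 1 to [s0], and sends every [t] with |t - 1| >= r beyond the
   support bound [M]. *)
pose l := (`|M| + `|s0| + 1) / r.
have l0 : 0 < l by rewrite divr_gt0// ltr_wpDl// addr_ge0.
pose A0 (s : R) := F n (s, x0).
have sA0 : smooth A0 by exact: test_function_slice.
pose A1 t := A0 (l * t + (s0 - l)).
have sA1 : smooth A1 by exact: smooth_affine.
pose A t := A1 t * A1 t.
have sA : smooth A by exact: smoothM.
have AR t : r <= `|t - 1| -> A t = 0.
  move=> rt; rewrite /A /A1 /A0 hM ?mul0r//.
  have -> : l * t + (s0 - l) = l * (t - 1) + s0 by ring.
  have h1 : `|M| + `|s0| + 1 <= `|l * (t - 1)|.
    by rewrite normrM (gtr0_norm l0) /l mulrAC ler_pdivlMr// ler_wpM2l// !addr_ge0.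
  have h2 : `|l * (t - 1)| <= `|l * (t - 1) + s0| + `|s0|.
    by rewrite -{1}(addrK s0 (l * (t - 1))); exact: ler_normB.
  by have := ler_norm M; lra.
have AM t : 1 + r < `|t| -> A t = 0.
  by move=> rt; apply: AR; have := lerB_dist t 1; rewrite normr1; lra.
have sfN : smoothT (fun x => f (- x)).
  have [pf sf'] := sf; split; first by move=> x; rewrite opprD -[LHS]pf subrK.
  have := @smooth_affine R f (-1) 0 sf'.
  rewrite (_ : (fun y => f (-1 * y + 0)) = (fun y => f (- y)))//.
  by apply/funext => y; rewrite mulN1r addr0.
(* The reflection of [f] compensates the one in [convT], so that convolution gives [A t * h x]. *)
exists (fun z => A z.1 * f (- z.2)); first exact: (test_function_prod sA AM sfN).
have convE t x : convT Cov (fun y => A (t, y).1 * f (- (t, y).2)) x = A t * h x.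
  rewrite /convT /= hE; have <- := distributionTZ (A t) Cd (smoothT_shift x sf).
  by congr Cov; apply/funext => y; rewrite opprB.
move=> pc; apply: (key A).
- by have := @smooth_continuous R A 0 sA.
- by move=> t; rewrite /A -expr2 sqr_ge0.
- rewrite /A -expr2 lt_neqAle sqr_ge0 andbT eq_sym expf_eq0/= /A1 mulr1 addrCA subrr addr0.
  exact: Fn0.
- exact: AR.
- have := shift _ _ _ pc; apply: cvg_trans; apply: near_eq_cvg; apply: nearW => k.
  apply: eq_Rintegral => t _; apply: eq_Rintegral => x; rewrite inE/= in_itv/= => x01.
  by rewrite convE /F' /= clip01_id.
Qed.

End duhamel_pairing.

(** * Dirac invariant laws *)

Section degenerate.
Context {R : realType} {d} {Omega : measurableType d}.
Variable Pr : probability Omega R.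
Local Notation leb := (@lebesgue_measure R).

Lemma continuous_eq_rat (f g : R -> R) : continuous f -> continuous g ->
  (forall q : rat, f (ratr q) = g (ratr q)) -> f =1 g.
Proof.
move=> cf cg fg x; apply/eqP; rewrite -subr_eq0; apply/negP => /negP h.
have c : f y - g y @[y --> x] --> f x - g x by apply: cvgB; [exact: cf|exact: cg].
have hn : \forall y \near x, f y - g y != 0 by exact: (cvgr_neq0 _ c h).
have /nbhs_ballP[r /= r0 hr] := hn.
have [q] : exists q, ratr q \in `]x, x + r[ by apply: rat_in_itvoo; rewrite ltrDl.
rewrite in_itv/= => /andP[xq qr].
have : f (ratr q) - g (ratr q) != 0.
  by apply: hr; rewrite -ball_normE /= distrC gtr0_norm ?subr_gt0// ltrBlDl.
by rewrite fg subrr eqxx.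
Qed.

Lemma ae_forall_rat d' (T : measurableType d') (mu : probability T R) (S : rat -> T -> Prop) :
  (forall q, \forall x \ae mu, S q x) -> \forall x \ae mu, forall q, S q x.
Proof.
move=> h; have : \forall x \ae mu, forall n : nat, if unpickle n is Some q then S q x else True.
  by apply: ae_foralln => n; case: (unpickle n) => [q|]; [exact: h|exact: aeW].
by apply: filterS => x hx q; have := hx (pickle q); rewrite pickleK.
Qed.

Lemma has_law_ae_rat d' (T : measurableType d') (P' : probability T R)
    (mu : probability (CT R) R) (X : T -> CT R) (m : R -> R) :
  (forall y, mu ((fun u : CT R => u y) @^-1` [set m y]) = 1%E) ->
  has_law P' X mu -> \forall w \ae P', forall q : rat, X w (ratr q) = m (ratr q).
Proof.
move=> hm [mX lX]; apply: ae_forall_rat => q.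
have mS : measurable ((fun u : CT R => u (ratr q)) @^-1` [set m (ratr q)]).
  rewrite -[X in measurable X]setTI.
  have := CT_continuous_measurable (@CT_eval_continuous R (ratr q)); exact.
have mXS : measurable (X @^-1` ((fun u : CT R => u (ratr q)) @^-1` [set m (ratr q)])).
  by rewrite -[X in measurable X]setTI; exact: mX.
exists (~` (X @^-1` ((fun u : CT R => u (ratr q)) @^-1` [set m (ratr q)]))); split => //.
- exact: measurableC.
- by rewrite probability_setC// lX// hm subee.
Qed.

Lemma variance0_dirac (mu : probability (CT R) R) : gaussian_measure mu ->
  (forall x m v, gaussian_tilt mu (fun f : CT R => f x) m v -> v = 0) ->
  exists f : CT R, forall d' (T : measurableType d') (P' : probability T R) (X : T -> CT R),
    has_law P' X mu -> \forall w \ae P', X w = f.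
Proof.
move=> gmu var0.
have /choice[m hm] y : exists m, mu ((fun u : CT R => u y) @^-1` [set m]) = 1%E.
  have [m [v t]] := gaussian_measure_eval_tilt y gmu; exists m.
  by have [_ _ vE _] := t; apply: vE; exact: var0 t.
(* The function [m] comes from a choice at each point. A continuous representative exists because
   [mu]-almost every function agrees with [m] on the rationals, and a set of full measure is not
   empty. *)
have [f hf] : exists f : CT R, forall q : rat, f (ratr q) = m (ratr q).
  have lid : has_law mu (fun u : CT R => u) mu by split; first exact: measurable_id.
  have [N [mN N0 hN]] := has_law_ae_rat hm lid.
  apply: contrapT => nf; have : mu setT = 0%E.
    suff -> : setT = N by [].
    apply/seteqP; split => // u _; apply: hN => /= hu; apply: nf; by exists u.
  by rewrite probability_setT => /eqP; rewrite onee_eq0.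
exists f => d' T P' X lX; apply: filterS (has_law_ae_rat hm lX) => w hw.
apply/val_inj/funext; apply: continuous_eq_rat; [exact: CT_continuous|exact: CT_continuous|].
by move=> q; rewrite /= hw hf.
Qed.

(** The null set depends on [s]; clipped rational times leave a single one, and path continuity
    covers the other times. *)
Lemma ae_constant_path (u : R -> Omega -> CT R) (f : CT R) :
  (forall s, 0 <= s <= 1 -> \forall w \ae Pr, u s w = f) ->
  (\forall w \ae Pr, {within `[0, 1], continuous (fun s => u s w)}) ->
  \forall w \ae Pr, forall s, 0 <= s <= 1 -> u s w = f.
Proof.
move=> hu cu.
have hq : \forall w \ae Pr, forall q : rat, u (clip01 (ratr q)) w = f.
  by apply: ae_forall_rat => q; apply: hu; exact: clip01_itv.
apply: filterS2 hq cu => w hw cw s s01; apply/val_inj/funext => y.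
have cy := within_continuous_clip01 (CT_within_continuous_comp (@CT_eval_continuous R y) cw).
have cc : continuous (fun _ : R => f y) by move=> r; exact: cvg_cst.
have := continuous_eq_rat cy cc _ s; rewrite /= clip01_id// => -> // q.
by rewrite hw.
Qed.

Lemma degenerate_contradiction (Cov : (R -> R) -> R) xi (P : {poly R})
    (mu : probability (CT R) R) (u0 : Omega -> CT R) u :
  distributionT Cov -> (exists f, smoothT f /\ Cov f != 0) -> noise Pr Cov xi ->
  has_law Pr u0 mu -> mild_solution Pr P xi u0 u ->
  (forall t, 0 <= t <= 1 -> has_law Pr (u t) mu) -> gaussian_measure mu ->
  ~ (forall x m v, gaussian_tilt mu (fun f : CT R => f x) m v -> v = 0).
Proof.
move=> Cd Cn xiN lu0 [mu_ [Z [mZ wZ cZ] usol]] lu gmu var0.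
have [f hf] := variance0_dirac gmu var0.
have o01 : 0 <= (1 : R) <= 1 by rewrite ler01 lexx.
have uf : \forall w \ae Pr, forall s, 0 <= s <= 1 -> u s w = f.
  apply: ae_constant_path => [s s01|]; first exact: hf (lu s s01).
  by apply: filterS usol => w [].
have u0f := hf _ _ _ _ lu0.
(* The value forced on the stochastic convolution by the mild equation at time 1 and place 0 along
   the constant path [f]. *)
pose z := f 0 - heat 1 f 0 - \int[leb]_(s in `[0, 1]) heat (1 - s) (fun y => P.[f y]) 0.
have Zz : \forall w \ae Pr, Z 1 w 0 = z.
  apply: filterS3 uf u0f usol => w hu hu0 [_ hs].
  have := hs 1 0 o01; rewrite hu// hu0.
  have -> : \int[leb]_(s in `[0, 1]) heat (1 - s) (fun y => P.[u s w y]) 0 =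
      \int[leb]_(s in `[0, 1]) heat (1 - s) (fun y => P.[f y]) 0.
    by apply: eq_Rintegral => s; rewrite inE/= in_itv/= => s01; rewrite hu.
  by rewrite /z => ->; ring.
have [F [tF FK FZ]] := wZ 1 0 o01.
have [g tg ng] := pairing_test_function Cd Cn tF FK.
apply: ng; apply: (wiener_constant_pairing xiN tF _ Zz FZ tg).
apply: (measurableT_comp (f := fun u : CT R => u 0)); last exact: mZ.
by apply: CT_continuous_measurable; exact: CT_eval_continuous.
Qed.

End degenerate.

Unset Implicit Arguments.
Set Strict Implicit.
Set Printing Implicit Defensive.

Theorem theorem2p7 (R : realType) (d : measure_display)
    (Omega : measurableType d) (Pr : probability Omega R)
    (Cov : (R -> R) -> R)
    (Cov_distribution : distributionT Cov)
    (Cov_bounded : L2_bounded_convT Cov)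
    (Cov_neq0 : exists f, smoothT f /\ Cov f != 0)
    (xi : (R * R -> R) -> Omega -> R)
    (xi_noise : noise Pr Cov xi)
    (P : {poly R})
    (P_deg_odd : odd (size P).-1)
    (P_deg_ge3 : (3 <= (size P).-1)%N)
    (P_lead : lead_coef P < 0)
    (mu : probability (CT R) R)
    (u0 : Omega -> CT R) (u : R -> Omega -> CT R)
    (u0_law : has_law Pr u0 mu)
    (u0_indep : independent_of_noise Pr xi u0)
    (u_solution : mild_solution Pr P xi u0 u)
    (mu_invariant : invariant_measure Pr P xi mu) :
  ~ gaussian_measure mu.
Proof.
move=> gmu; have lu := mu_invariant u0 u u0_law u0_indep u_solution.
apply: (degenerate_contradiction Cov_distribution Cov_neq0 xi_noise u0_law u_solution lu gmu).
move=> x m v; apply: (gaussian_invariant_variance0 xi_noise _ u0_law u0_indep u_solution lu gmu).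
exact: leq_trans P_deg_ge3 (leq_pred _).
Qed.
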